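(* Let $U$ be a unitary operator and $A$ a self-adjoint operator on $\mathcal{H}$, and let $\Theta$ be an open subset of $\mathbb{T}$. Assume that $U$ is propagating with respect to $A$ on $e^{i\Theta}$ and that $U\in\mathcal{C}^{1,1}(A)$. Then: (i) $U$ has a finite number of eigenvalues in $e^{i\Theta}$, and each of these eigenvalues has finite multiplicity. (ii) Let $\Theta'\subset\Theta$ be defined by $e^{i\Theta'}=e^{i\Theta}\setminus\sigma_{\mathrm{pp}}(U)$. For any $(\psi,\varphi)\in\mathcal{K}^2$, the functions $z\mapsto\langle\varphi,(1-zU^* )^{-1}\psi\rangle$ (holomorphic on $\mathbb{D}$) and $z\mapsto\langle\varphi,(1-\bar z^{-1}U^* )^{-1}\psi\rangle$ (antiholomorphic on $\mathbb{D}$, with value $0$ at $z=0$) extend continuously to $\mathbb{D}\cup e^{i\Theta'}$. (iii) The spectrum of $U$ has no singular continuous component in $e^{i\Theta}$. If moreover $U$ is strictly propagating with respect to $A$ on $e^{i\Theta}$, then statements (i) and (iii) can be replaced by: $U$ is purely absolutely continuous on $e^{i\Theta}$.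
   Context: $\mathcal{H}$ is an infinite-dimensional complex Hilbert space, with inner product antilinear in the first variable; $\mathbb{D}$ is the open unit disk and $\mathbb{T}$ the one-dimensional torus. $(E_\Delta)_{\Delta\in\mathcal{B}(\mathbb{T})}$ is the spectral family of $U$, i.e. $U=\int_{\mathbb{T}}e^{i\theta}\,dE(\theta)$; $\sigma_{\mathrm{pp}}(U)$ is the set of eigenvalues of $U$. $A$ is self-adjoint with domain $\mathcal{D}(A)$. $C^1(A)$: $B\in\mathcal{B}(\mathcal{H})$ belongs to $C^1(A)$ if the form $(\varphi,\phi)\mapsto\langle A\varphi,B\phi\rangle-\langle\varphi,BA\phi\rangle$ on $\mathcal{D}(A)\times\mathcal{D}(A)$ extends continuously to a bounded form on $\mathcal{H}\times\mathcal{H}$; the associated bounded operator is $\mathrm{ad}_A(B)=[A,B]$. $\mathcal{C}^{1,1}(A)$: $B\in\mathcal{B}(\mathcal{H})$ belongs to $\mathcal{C}^{1,1}(A)$ if $\int_0^1\|e^{iA\tau}Be^{-iA\tau}+e^{-iA\tau}Be^{iA\tau}-2B\|\,\frac{d\tau}{\tau^2}<\infty$. One has $\mathcal{C}^{1,1}(A)\subset C^1(A)$. For a unitary $U\in C^1(A)$, $U^*AU-A$ denotes the bounded operator $U^*(\mathrm{ad}_AU)$. For a Borel set $\Theta\subset\mathbb{T}$: $U$ is propagating with respect to $A$ on $\Theta$ (or on $e^{i\Theta}$) if there exist $c>0$ and a compact operator $K$ such that $E_\Theta(U^*AU-A)E_\Theta\ge cE_\Theta+K$; $U$ is strictly propagating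 with respect to $A$ on $\Theta$ (or on $e^{i\Theta}$) if there exists $c>0$ such that $E_\Theta(U^*AU-A)E_\Theta\ge cE_\Theta$. $\mathcal{K}=(\mathcal{D}(A),\mathcal{H})_{1/2,1}$ is the real interpolation space (where $\mathcal{D}(A)$ carries the graph norm), continuously and densely embedded in $\mathcal{H}$. *)

(* Defs.v *)
From HB Require Import structures.
From mathcomp Require Import all_boot all_order all_algebra.
From mathcomp Require Import all_classical all_reals all_analysis.
From mathcomp Require Import complex sesquilinear.

Set Implicit Arguments.
Unset Strict Implicit.
Unset Printing Implicit Defensive.
Import Order.TTheory GRing.Theory Num.Theory numFieldNormedType.Exports.

Local Open Scope classical_set_scope.
Local Open Scope ring_scope.
Local Open Scope complex_scope.

(* R is an arbitrary realType and the field of complex numbers is R[i], whose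
   topology lives on the alias R[i]^o. *)

HB.mixin Record isHilbert (R : realType) H of CompleteNormedModule R[i] H := {
  dotH : {dot H for Num.conj} ;
  dotH_norm : forall x : H, dotH x x = `|x| ^+ 2 }.

#[short(type="hilbertType")]
HB.structure Definition Hilbert (R : realType) :=
  {H of isHilbert R H & CompleteNormedModule R[i] H}.

(* {dot _ for _} is linear in its first variable, whereas inner is antilinear
   in the first variable and linear in the second. *)
Definition inner (R : realType) (H : hilbertType R) (x y : H) : R[i] :=
  dotH y x.

Definition circle_set (R : realType) : set R[i]^o := [set z | `|z| = 1].

(* The torus, identified with the unit circle through t |-> e^(it); thus
   e^(i Theta) is the image of Theta under set_val. *)
Definition torus (R : realType) := set_type (@circle_set R).

HB.instance Definition _ (R : realType) :=
  Topological.copy (torus R) (set_type (@circle_set R)).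

Definition torus1 (R : realType) : torus R :=
  exist _ (1 : R[i]^o) (mem_set (normr1 R[i])).

HB.instance Definition _ (R : realType) := isPointed.Build (torus R) (torus1 R).

Definition borel_torus (R : realType) := g_sigma_algebraType (@open (torus R)).

Section Operators.
Context {R : realType} {H : hilbertType R}.
Implicit Types (x y : H) (B T U V : H -> H).

Definition rnorm x : R := complex.Re `|x|.

Definition finite_dim (V : set H) :=
  exists n (b : 'I_n -> H), forall x, V x ->
    exists c : 'I_n -> R[i], x = \sum_(i < n) c i *: b i.

Definition bounded_op B := linear B /\ continuous B.

(* Meaningful for bounded operators only (sup is 0 on unbounded sets). *)
Definition opnorm B : R := sup [set rnorm (B x) | x in [set x | `|x| <= 1]].

Definition compact_op B :=
  bounded_op B /\ precompact (B @` [set x | `|x| <= 1]).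

(* The adjoint is the unique map in this set, which is nonempty for bounded B
   by the Riesz representation theorem. *)
Definition adj B : H -> H :=
  xget (fun=> 0) [set B' | forall x y, inner (B' x) y = inner x (B y)].

Definition op_inv B : H -> H :=
  xget (fun=> 0) [set B' | cancel B B' /\ cancel B' B].

Definition unitary U :=
  [/\ bounded_op U, adj U \o U = id & U \o adj U = id].

(* The order of C makes [0 <= z] mean that z is real and nonnegative, so that
   T - B is in particular self-adjoint when it is bounded. *)
Definition op_le B T := forall x, 0 <= inner x (T x - B x).

Definition point_spectrum U : set R[i]^o :=
  [set l | exists2 x, x != 0 & U x = l *: x].

Definition eigen_subspace (U : H -> H) (l : R[i]) : set H := [set x | U x = l *: x].

Definition sesquilinear_form (q : H -> H -> R[i]) :=
  (forall x, scalar (q x)) /\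
  (forall (a : R[i]) x x' y, q (a *: x + x') y = a^* * q x y + q x' y).

Definition bounded_form (q : H -> H -> R[i]) :=
  sesquilinear_form q /\ exists M : R[i], forall x y, `|q x y| <= M * `|x| * `|y|.

(* An operator defined on [dom]; the values of [app] outside [dom] carry no
   information. *)
Record partial_op := PartialOp { dom : set H ; app :> H -> H }.

Definition linear_partial_op (A : partial_op) :=
  dom A 0 /\ forall (a : R[i]) x y, dom A x -> dom A y ->
    dom A (a *: x + y) /\ A (a *: x + y) = a *: A x + A y.

(* The last clause is the equality of the graphs of A and of its adjoint. *)
Definition self_adjoint (A : partial_op) :=
  [/\ linear_partial_op A, dense (dom A) &
      forall y z, (dom A y /\ A y = z) <->
                  (forall x, dom A x -> inner (A x) y = inner x z)].

(* W t = e^(itA), by Stone's theorem the unique strongly continuous unitary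
   group with generator iA. *)
Definition unitary_group (A : partial_op) (W : R -> H -> H) :=
  [/\ forall t, unitary (W t),
      W 0 = id,
      forall s t, W (s + t) = W s \o W t,
      forall x, continuous (fun t => W t x) &
      forall x y, (dom A x /\ A x = y) <->
        (t^-1)%:C *: (W t x - x) @[t --> 0^'] --> (0 +i* 1 : R[i]) *: y].

Definition commutator_form (A : partial_op) B x y : R[i] :=
  inner (A x) (B y) - inner x (B (A y)).

Definition in_C1 (A : partial_op) B := bounded_op B /\
  exists q, bounded_form q /\
    forall x y, dom A x -> dom A y -> q x y = commutator_form A B x y.

(* T = ad_A(B) = [A, B]; T is unique because [dom A] is dense. *)
Definition is_ad (A : partial_op) B T := bounded_op T /\
  forall x y, dom A x -> dom A y -> inner x (T y) = commutator_form A B x y.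

(* The integrand does not depend on the witness W, since W is unique. *)
Definition in_C11 (A : partial_op) B := bounded_op B /\
  exists W, unitary_group A W /\
    (\int[lebesgue_measure]_(t in `]0%R, 1%R])
       (opnorm (fun x => W t (B (W (- t) x)) + W (- t) (B (W t x)) - 2 *: B x)
        / t ^+ 2)%:E < +oo)%E.

Definition graph_norm (A : partial_op) x : R :=
  Num.sqrt (rnorm x ^+ 2 + rnorm (A x) ^+ 2).

(* Peetre's K-functional of the couple (D(A), H): the decompositions
   x = y + (x - y) with y in D(A). *)
Definition K_functional (A : partial_op) (t : R) x : R :=
  inf [set graph_norm A y + t * rnorm (x - y) | y in dom A].

(* The space (D(A), H)_{s,1}. *)
Definition interpolation1 (A : partial_op) (s : R) : set H :=
  [set x | (\int[lebesgue_measure]_(t in `]0%R, +oo[)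
             (t `^ (- s) * K_functional A t x / t)%:E < +oo)%E].

Definition orthogonal_projection B :=
  [/\ bounded_op B, B \o B = B & forall x y, inner (B x) y = inner x (B y)].

Definition projection_valued_measure (E : set (borel_torus R) -> H -> H) :=
  [/\ forall D, measurable D -> orthogonal_projection (E D),
      E setT = id,
      forall D D', measurable D -> measurable D' -> E (D `&` D') = E D \o E D' &
      forall F : (set (borel_torus R))^nat,
        (forall n, measurable (F n)) -> trivIset setT F ->
        forall x, \sum_(0 <= k < n) E (F k) x @[n --> \oo] -->
                  E (\bigcup_n F n) x].

Definition spectral_measure (E : set (borel_torus R) -> H -> H) x
    (D : set (borel_torus R)) : \bar R := (complex.Re (inner x (E D x)))%:E.

(* U is the integral of z = e^(i theta) against E, in the weak sense and split
   into real and imaginary parts; the diagonal matrix elements determine U by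
   polarization. *)
Definition spectral_family U (E : set (borel_torus R) -> H -> H) :=
  projection_valued_measure E /\
  forall x, inner x (U x) =
    fine (\int[spectral_measure E x]_z (complex.Re (set_val z))%:E)%E +i*
    fine (\int[spectral_measure E x]_z (complex.Im (set_val z))%:E)%E.

(* U^* A U - A stands for the bounded operator U^* (ad_A U). *)
Definition propagating (A : partial_op) U (E : set (borel_torus R) -> H -> H)
    (Theta : set (torus R)) :=
  in_C1 A U /\ exists T, is_ad A U T /\
    exists (c : R) (K : H -> H), [/\ 0 < c, compact_op K &
      op_le (fun x => c%:C *: E Theta x + K x)
            (fun x => E Theta (adj U (T (E Theta x))))].

Definition strictly_propagating (A : partial_op) U
    (E : set (borel_torus R) -> H -> H) (Theta : set (torus R)) :=
  in_C1 A U /\ exists T, is_ad A U T /\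
    exists c : R, 0 < c /\
      op_le (fun x => c%:C *: E Theta x)
            (fun x => E Theta (adj U (T (E Theta x)))).

Definition arc_length (D : set (borel_torus R)) : \bar R :=
  lebesgue_measure [set t : R | 0 <= t < 2 * pi /\
    exists2 z : torus R, D z & set_val z = cos t +i* sin t].

(* The spectral measure of x has no atom and is carried by a set of zero
   length. *)
Definition sing_cont_vector (E : set (borel_torus R) -> H -> H) x :=
  (forall z, spectral_measure E x [set z] = 0%E) /\
  exists N, [/\ measurable N, arc_length N = 0%E &
                spectral_measure E x (~` N) = 0%E].

(* E_Theta annihilates the singular continuous subspace. *)
Definition no_sing_cont_on (E : set (borel_torus R) -> H -> H)
    (Theta : set (torus R)) :=
  forall x, sing_cont_vector E x -> E Theta x = 0.

(* The range of E_Theta is contained in the absolutely continuous subspace. *)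
Definition purely_ac_on (E : set (borel_torus R) -> H -> H)
    (Theta : set (torus R)) :=
  forall x, spectral_measure E (E Theta x) `<< arc_length.

End Operators.
Arguments partial_op {R} H.

Definition disk (R : realType) : set R[i]^o := [set z | `|z| < 1].

Definition holomorphic_on (R : realType) (D : set R[i]^o)
    (f : R[i]^o -> R[i]^o) := forall z, D z -> derivable f z 1.

Definition antiholomorphic_on (R : realType) (D : set R[i]^o)
    (f : R[i]^o -> R[i]^o) := holomorphic_on D (fun z => (f z)^*).

(* f, considered on D only, extends continuously to D `|` S. *)
Definition extends_continuously (R : realType) (f : R[i]^o -> R[i]^o)
    (D S : set R[i]^o) :=
  exists g : R[i]^o -> R[i]^o,
    {in D, g =1 f} /\ {within D `|` S, continuous g}.

Definition resolvent_in (R : realType) (H : hilbertType R) (U : H -> H)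
    (phi psi : H) (z : R[i]^o) : R[i]^o :=
  inner phi (op_inv (fun x => x - z *: adj U x) psi).

(* 1 - z^*^-1 U^* is invertible for 0 < |z| < 1 because |z^*^-1| > 1. *)
Definition resolvent_out (R : realType) (H : hilbertType R) (U : H -> H)
    (phi psi : H) (z : R[i]^o) : R[i]^o :=
  if z == 0 then 0
  else inner phi (op_inv (fun x => x - (z^*)^-1 *: adj U x) psi).

(* Main.v *)
(** The Mourre commutator method, run with bounded operators only. Let W be the
    unitary group generated by A. Averaging W t U W(-t) over |t| <= 2^-k gives
    operators U_k close to U whose commutator T_k with the bounded difference
    quotient (W eta - 1) / (i eta), eta = 4^-k, converges in norm to T = [A, U];
    the C^{1,1} hypothesis makes the errors summable in k. Near a point of
    e^(i Theta) which is not an eigenvalue the compact term of the Mourre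
    estimate becomes small, and the strict estimate that remains makes
    1 - z (U_k - e T_k) coercive with constant of order e, uniformly for |z| <= 1
    close to the conjugate point. For vectors of the interpolation space the
    matrix elements of its inverse satisfy Mourre's differential inequality in
    e; integrating it over the dyadic intervals 2^-(k+1) <= e <= 2^-k and
    summing over k yields boundedness and uniform continuity of
    <phi, (1 - z U)^-1 phi> up to the circle, which is (ii) after polarization.

    By the virial theorem <U psi, T psi> = 0 for an eigenvector psi, so an
    infinite orthonormal sequence of eigenvectors with eigenvalues in
    e^(i Theta) would contradict the compactness of K; this is (i). Finally, if
    u = (1 - z U)^-1 psi with |z| = 1 - h, then (1 - |z|^2) |u|^2 <= 2 |<psi, u>|
    while |E_D psi| <= 2 h |u| for an arc D of size h around the conjugate of
    z / |z|. Hence the spectral measure of psi is bounded by a multiple of arc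
    length away from the eigenvalues, which gives (iii) and absolute
    continuity. *)

Require Import Defs.
From HB Require Import structures.
From mathcomp Require Import all_boot all_order all_algebra.
From mathcomp Require Import all_classical all_reals all_analysis.
From mathcomp Require Import measurable_realfun.
From mathcomp Require Import complex sesquilinear.
From mathcomp Require Import ring lra.

Set Implicit Arguments.
Unset Strict Implicit.
Unset Printing Implicit Defensive.
Import Order.TTheory GRing.Theory Num.Theory numFieldNormedType.Exports.

Local Open Scope classical_set_scope.
Local Open Scope ring_scope.
Local Open Scope complex_scope.

(** * Hilbert spaces and coercive operators *)

(** The class [C^{1,1}] does not make [[A, [A, U]]] bounded, so the method needs a regularization. A
    discrete one avoids both the domain of [A] and operator-valued integrals: [U_k] is a mean over a
    square grid of translates, and difference quotients of step [eta = (2^-k)^2] telescope along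
    each side of the grid. Hence the commutator of [U_k] is [T_k] exactly, and the commutator of
    [T_k] is a single second difference, of size [2^k p_k], which the factor [e] in front of it
    reduces to [p_k].

    The exponent 1/2 comes from the quadratic estimate [a e |u|^2 <= |F|], where
    [u = (1 - z (U_k - e T_k))^-1 phi] and [F = <phi, u>]: the vector [u] costs [e^(-1/2)] only.
    Over a dyadic interval an approximant [phi_k] of [phi] then contributes [2^(-k/2) |A phi_k|],
    and passing to the next one contributes [2^(k/2) |phi_(k+1) - phi_k|]; membership in the
    interpolation space is what makes both summable.

    The differential inequality is never differentiated: increments of [F] are estimated up to a
    quadratic error, and a bootstrap on the supremum of [|F|] replaces the integration of the
    inequality. *)

Section HilbertBasics.
Context {R : realType} {H : hilbertType R}.
Implicit Types (x y : H) (a b : R[i]).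

(** Moduli and norms are elements of [R[i]]; the real-valued versions [cn] and [rnorm] bring the
    estimates within reach of [lra] and [nra]. *)
Definition cn a : R := complex.Re `|a|.

Lemma norm_cn a : `|a| = (cn a)%:C.
Proof. by rewrite /cn; case: a. Qed.

Lemma cn_ge0 a : 0 <= cn a.
Proof. by rewrite -ler0c -norm_cn. Qed.

Lemma cnM a b : cn (a * b) = cn a * cn b.
Proof. by apply: complexI; rewrite rmorphM/= -!norm_cn normrM. Qed.

Lemma cnD a b : cn (a + b) <= cn a + cn b.
Proof. by rewrite -lecR rmorphD/= -!norm_cn ler_normD. Qed.

Lemma cnN a : cn (- a) = cn a.
Proof. by rewrite /cn normrN. Qed.

Lemma cn_conj a : cn (a^*) = cn a.
Proof. by rewrite /cn normcJ. Qed.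

Lemma cn0 : cn 0 = 0.
Proof. by rewrite /cn normr0. Qed.

Lemma cnR (t : R) : cn t%:C = `|t|.
Proof.
by apply: complexI; rewrite -norm_cn normc_def/= expr0n/= addr0 sqrtr_sqr.
Qed.

Lemma cn_eq0 a : cn a = 0 -> a = 0.
Proof. by move=> h; apply/normr0_eq0; rewrite norm_cn h. Qed.

Lemma cn_sqr a : cn a ^+ 2 = complex.Re a ^+ 2 + complex.Im a ^+ 2.
Proof. by apply: complexI; rewrite rmorphXn/= -norm_cn add_Re2_Im2. Qed.

Lemma cn_Re a : `|complex.Re a| <= cn a.
Proof. by rewrite -lecR -norm_cn normc_ge_Re. Qed.

Lemma Re_le_cn a : complex.Re a <= cn a.
Proof. exact: le_trans (ler_norm _) (cn_Re _). Qed.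

Lemma cnV a : cn a^-1 = (cn a)^-1.
Proof. by apply: complexI; rewrite fmorphV/= -!norm_cn normfV. Qed.

Lemma norm_rnorm x : `|x| = (rnorm x)%:C.
Proof.
have := normr_ge0 x; rewrite lecE/= => /andP[/eqP h _].
by rewrite /rnorm; move: h; case: (`|x|) => s t/= ->.
Qed.

Lemma rnorm_ge0 x : 0 <= rnorm x.
Proof. by rewrite -ler0c -norm_rnorm. Qed.

Lemma rnorm0 : rnorm (0 : H) = 0.
Proof. by rewrite /rnorm normr0. Qed.

Lemma rnorm_eq0 x : rnorm x = 0 -> x = 0.
Proof. by move=> h; apply/normr0_eq0; rewrite norm_rnorm h. Qed.

Lemma rnormD x y : rnorm (x + y) <= rnorm x + rnorm y.
Proof. by rewrite -lecR rmorphD/= -!norm_rnorm ler_normD. Qed.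

Lemma rnormN x : rnorm (- x) = rnorm x.
Proof. by rewrite /rnorm normrN. Qed.

Lemma rnormB x y : rnorm (x - y) <= rnorm x + rnorm y.
Proof. by rewrite -(rnormN y) rnormD. Qed.

Lemma rdistC x y : rnorm (x - y) = rnorm (y - x).
Proof. by rewrite /rnorm distrC. Qed.

Lemma rnormZ a x : rnorm (a *: x) = cn a * rnorm x.
Proof. by apply: complexI; rewrite rmorphM/= -norm_rnorm -norm_cn -norm_rnorm normrZ. Qed.

Lemma innerC x y : inner y x = conjc (inner x y).
Proof. by rewrite /inner hermC expr0 mul1r. Qed.

Lemma inner_rnorm x : inner x x = (rnorm x ^+ 2)%:C.
Proof. by rewrite /inner dotH_norm norm_rnorm rmorphXn. Qed.

Lemma innerDr x y z : inner x (y + z) = inner x y + inner x z.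
Proof. by rewrite /inner linearDl. Qed.

Lemma innerDl x y z : inner (y + z) x = inner y x + inner z x.
Proof. by rewrite /inner linearDr. Qed.

Lemma innerZr a x y : inner x (a *: y) = a * inner x y.
Proof. by rewrite /inner linearZl_LR. Qed.

Lemma innerZl a x y : inner (a *: x) y = conjc a * inner x y.
Proof. by rewrite innerC innerZr rmorphM/= (innerC y x). Qed.

Lemma innerNr x y : inner x (- y) = - inner x y.
Proof. by rewrite -scaleN1r innerZr mulN1r. Qed.

Lemma innerNl x y : inner (- x) y = - inner x y.
Proof. by rewrite innerC innerNr rmorphN/= (innerC y x). Qed.

Lemma innerBr x y z : inner x (y - z) = inner x y - inner x z.
Proof. by rewrite innerDr innerNr. Qed.

Lemma innerBl x y z : inner (y - z) x = inner y x - inner z x.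
Proof. by rewrite innerDl innerNl. Qed.

Lemma inner0r x : inner x 0 = 0.
Proof. by rewrite -(subrr x) innerBr subrr. Qed.

Lemma inner0l x : inner 0 x = 0.
Proof. by rewrite -(subrr x) innerBl subrr. Qed.

Lemma inner_suml I (r : seq I) (F : I -> H) x :
  inner (\sum_(i <- r) F i) x = \sum_(i <- r) inner (F i) x.
Proof.
elim: r => [|i r IH]; first by rewrite !big_nil inner0l.
by rewrite !big_cons innerDl IH.
Qed.

Lemma inner_sumr I (r : seq I) (F : I -> H) x :
  inner x (\sum_(i <- r) F i) = \sum_(i <- r) inner x (F i).
Proof.
elim: r => [|i r IH]; first by rewrite !big_nil inner0r.
by rewrite !big_cons innerDr IH.
Qed.

Lemma rnorm_sum I (r : seq I) (F : I -> H) :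
  rnorm (\sum_(i <- r) F i) <= \sum_(i <- r) rnorm (F i).
Proof.
elim: r => [|i r IH]; first by rewrite !big_nil rnorm0.
rewrite !big_cons; apply: le_trans (rnormD _ _) _; exact: lerD.
Qed.

Definition re x y : R := complex.Re (inner x y).

Lemma reC x y : re x y = re y x.
Proof. by rewrite /re (innerC y x); case: (inner y x). Qed.

Lemma re_rnorm x : re x x = rnorm x ^+ 2.
Proof. by rewrite /re inner_rnorm. Qed.

Lemma reDr x y z : re x (y + z) = re x y + re x z.
Proof. by rewrite /re innerDr; case: (inner x y); case: (inner x z). Qed.

Lemma reDl x y z : re (y + z) x = re y x + re z x.
Proof. by rewrite reC reDr !(reC x). Qed.

Lemma reNr x y : re x (- y) = - re x y.
Proof. by rewrite /re innerNr; case: (inner x y). Qed.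

Lemma reNl x y : re (- x) y = - re x y.
Proof. by rewrite reC reNr (reC x). Qed.

Lemma reBr x y z : re x (y - z) = re x y - re x z.
Proof. by rewrite reDr reNr. Qed.

Lemma reBl x y z : re (y - z) x = re y x - re z x.
Proof. by rewrite reDl reNl. Qed.

Lemma reZr (t : R) x y : re x (t%:C *: y) = t * re x y.
Proof. by rewrite /re innerZr; case: (inner x y) => p q /=; rewrite mul0r subr0. Qed.

Lemma reZl (t : R) x y : re (t%:C *: x) y = t * re x y.
Proof. by rewrite reC reZr reC. Qed.

Lemma rnormD_sqr x y : rnorm (x + y) ^+ 2 = rnorm x ^+ 2 + 2 * re x y + rnorm y ^+ 2.
Proof. by rewrite -!re_rnorm !(reDl, reDr) (reC y x); ring. Qed.

Lemma rnormB_sqr x y : rnorm (x - y) ^+ 2 = rnorm x ^+ 2 - 2 * re x y + rnorm y ^+ 2.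
Proof. by rewrite rnormD_sqr reNr rnormN; ring. Qed.

Lemma re_le x y : re x y <= rnorm x * rnorm y.
Proof.
have [x0|x0] := eqVneq (rnorm x) 0.
  by rewrite (rnorm_eq0 x0) /re inner0l rnorm0 mul0r.
have [y0|y0] := eqVneq (rnorm y) 0.
  by rewrite (rnorm_eq0 y0) /re inner0r rnorm0 mulr0.
have xp : 0 < rnorm x by rewrite lt_def x0 rnorm_ge0.
have yp : 0 < rnorm y by rewrite lt_def y0 rnorm_ge0.
have := sqr_ge0 (rnorm ((rnorm y)%:C *: x - (rnorm x)%:C *: y)).
rewrite rnormB_sqr reZl reZr !rnormZ !cnR !(ger0_norm (rnorm_ge0 _)).
have : 0 < rnorm x * rnorm y by rewrite mulr_gt0.
nra.
Qed.

Lemma cauchy_schwarz x y : cn (inner x y) <= rnorm x * rnorm y.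
Proof.
have [->|/eqP i0] := eqVneq (inner x y) 0; first by rewrite cn0 mulr_ge0 ?rnorm_ge0.
set z := inner x y in i0 *.
have nz : cn z != 0 by apply/eqP => /cn_eq0.
(* [w] is the phase that turns [inner x y] into its modulus, which reduces the claim to [re_le]. *)
pose w := (cn z)%:C^-1 * conjc z.
have : re x (w *: y) = cn z.
  rewrite /re innerZr -/z /w -mulrA [X in _ * X]mulrC -sqr_normc norm_cn.
  by rewrite expr2 mulKf// eq_complex/= eqxx andbT.
move=> <-; apply: le_trans (re_le _ _) _; rewrite rnormZ.
suff -> : cn w = 1 by rewrite mul1r.
by rewrite /w cnM cn_conj cnV cnR (ger0_norm (cn_ge0 _)) mulVf.
Qed.

Lemma inner_ext x y : (forall z, inner z x = inner z y) -> x = y.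
Proof.
move=> h; apply/eqP; rewrite -subr_eq0; apply/eqP/rnorm_eq0/eqP.
by rewrite -sqrf_eq0 -re_rnorm /re innerBr h subrr.
Qed.

End HilbertBasics.

(* Testing against all inner products turns an identity between vectors into a
   ring identity between scalars. *)
Ltac hring := apply: inner_ext => ?;
  rewrite !(innerDr, innerNr, innerZr, inner0r, conjcK); ring.

Section Topology.
Context {R : realType} {H : hilbertType R}.
Implicit Types (x y : H) (a b : R[i]).

Lemma posC (e : R[i]) : 0 < e -> exists2 r : R, 0 < r & e = r%:C.
Proof.
rewrite ltcE/= => /andP[/eqP h h']; exists (complex.Re e) => //.
by move: h h'; case: e => s t/= ->.
Qed.

Lemma cvg_rnorm {T} (F : set_system T) {FF : Filter F} (f : T -> H) x :
  f @ F --> x <-> forall e : R, 0 < e -> \forall t \near F, rnorm (f t - x) < e.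
Proof.
rewrite cvgrPdist_lt; split=> h e e0.
  have := h e%:C; rewrite ltcR => /(_ e0).
  by apply: filterS => t; rewrite norm_rnorm ltcR rdistC.
have [r r0 ->] := posC e0; apply: filterS (h r r0) => t.
by rewrite norm_rnorm ltcR rdistC.
Qed.

Lemma cvg_cn {T} (F : set_system T) {FF : Filter F} (f : T -> R[i]^o) (a : R[i]^o) :
  f @ F --> a <-> forall e : R, 0 < e -> \forall t \near F, cn (f t - a) < e.
Proof.
rewrite cvgrPdist_lt; split=> h e e0.
  have := h e%:C; rewrite ltcR => /(_ e0).
  by apply: filterS => t; rewrite norm_cn ltcR -cnN opprB.
have [r r0 ->] := posC e0; apply: filterS (h r r0) => t.
by rewrite norm_cn ltcR -cnN opprB.
Qed.

Lemma nbhs_rnorm x (A : set H) :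
  nbhs x A <-> exists2 e : R, 0 < e & forall y, rnorm (y - x) < e -> A y.
Proof.
split.
  move=> /nbhs_ballP[_ /posC[r r0 ->] h]; exists r => // y yr; apply: h.
  by rewrite -ball_normE/= norm_rnorm ltcR rdistC.
case=> e e0 h; apply/nbhs_ballP; exists e%:C => /=; first by rewrite ltcR.
by move=> y; rewrite -ball_normE/= norm_rnorm ltcR rdistC => /h.
Qed.

Lemma nbhs_cn (a : R[i]^o) (A : set R[i]^o) :
  nbhs a A <-> exists2 e : R, 0 < e & forall b, cn (b - a) < e -> A b.
Proof.
split.
  move=> /nbhs_ballP[_ /posC[r r0 ->] h]; exists r => // y yr; apply: h.
  by rewrite -ball_normE/= norm_cn ltcR -cnN opprB.
case=> e e0 h; apply/nbhs_ballP; exists e%:C => /=; first by rewrite ltcR.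
by move=> y; rewrite -ball_normE/= norm_cn ltcR -cnN opprB => /h.
Qed.

Lemma complete_rnorm (u : nat -> H) :
  (forall e : R, 0 < e -> exists n, forall m, (n <= m)%N -> rnorm (u m - u n) < e) ->
  exists l, forall e : R, 0 < e -> exists n, forall m, (n <= m)%N -> rnorm (u m - l) < e.
Proof.
move=> h; have /cauchy_cvgP/cvg_ex[l /= ul] : cauchy (u @ \oo).
  apply: cauchy_exP => _ /posC[r r0 ->].
  have [n hn] := h r r0; exists (u n).
  exists n => // m /= nm; rewrite -ball_normE/= norm_rnorm ltcR rdistC; exact: hn.
exists l => e e0; have /cvg_rnorm/(_ e e0)[n _ hn] := ul.
by exists n => m nm; apply: hn.
Qed.

End Topology.

Section LinearOperators.
Context {R : realType} {H : hilbertType R}.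
Implicit Types (x y : H) (a b : R[i]) (B C : H -> H).

Definition bnd (M : R) B := forall x, rnorm (B x) <= M * rnorm x.

(** A relation rather than the function [adj]: it passes through sums and conjugations, and
    [adjp_linear] extracts linearity from the mere existence of an adjoint. *)
Definition adjp B B' := forall x y, inner (B' x) y = inner x (B y).

Section linear.
Variable (B : H -> H).
Hypothesis linB : linear B.

Lemma lopD x y : B (x + y) = B x + B y.
Proof. by have := linB 1 x y; rewrite !scale1r. Qed.

Lemma lop0 : B 0 = 0.
Proof. by apply: (@addrI _ (B 0)); rewrite -lopD !addr0. Qed.

Lemma lopZ a x : B (a *: x) = a *: B x.
Proof. by have := linB a x 0; rewrite !addr0 lop0 addr0. Qed.

Lemma lopN x : B (- x) = - B x.
Proof. by rewrite -scaleN1r lopZ scaleN1r. Qed.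

Lemma lopB x y : B (x - y) = B x - B y.
Proof. by rewrite lopD lopN. Qed.

Lemma lop_sum I (r : seq I) (F : I -> H) :
  B (\sum_(i <- r) F i) = \sum_(i <- r) B (F i).
Proof.
elim: r => [|i r IH]; first by rewrite !big_nil lop0.
by rewrite !big_cons lopD IH.
Qed.

End linear.

Lemma bounded_op_bnd B : bounded_op B -> exists2 M, 0 <= M & bnd M B.
Proof.
case=> linB contB; have : {for 0, continuous B} by apply: contB.
rewrite /prop_for /continuous_at lop0// => /cvg_rnorm/(_ 1 ltr01)/nbhs_rnorm[e e0 h].
exists (2 / e); first by rewrite divr_ge0// ltW.
move=> x; have [->|/eqP x0] := eqVneq x 0; first by rewrite lop0// rnorm0 mulr0.
have xp : 0 < rnorm x by rewrite lt_def rnorm_ge0 andbT; apply/eqP => /rnorm_eq0.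
pose t := e / 2 / rnorm x.
have t0 : 0 < t by rewrite !divr_gt0.
have := h (t%:C *: x); rewrite !subr0 rnormZ cnR gtr0_norm// lopZ// rnormZ cnR gtr0_norm//.
have -> : t * rnorm x = e / 2 by rewrite /t divfK// gt_eqF.
have -> : e / 2 < e by lra.
move=> /(_ isT) h1.
have -> : 2 / e * rnorm x = t^-1 by rewrite /t; field; rewrite !gt_eqF.
by apply: ltW; rewrite -(ltr_pM2l t0) mulfV ?gt_eqF.
Qed.

Lemma bndW M M' B : M <= M' -> bnd M B -> bnd M' B.
Proof. by move=> MM h x; apply: le_trans (h x) _; rewrite ler_wpM2r ?rnorm_ge0. Qed.

Lemma bndD M M' B C : bnd M B -> bnd M' C -> bnd (M + M') (fun x => B x + C x).
Proof.
move=> hB hC x; apply: le_trans (rnormD _ _) _; rewrite mulrDl.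
by apply: lerD; [exact: hB|exact: hC].
Qed.

Lemma bndB M M' B C : bnd M B -> bnd M' C -> bnd (M + M') (fun x => B x - C x).
Proof.
move=> hB hC x; apply: le_trans (rnormB _ _) _; rewrite mulrDl.
by apply: lerD; [exact: hB|exact: hC].
Qed.

Lemma bndZ M a B : bnd M B -> bnd (cn a * M) (fun x => a *: B x).
Proof. by move=> hB x; rewrite rnormZ -mulrA ler_wpM2l ?cn_ge0//; apply: hB. Qed.

Lemma adjpC B B' : adjp B B' -> adjp B' B.
Proof. by move=> h x y; rewrite innerC -h -innerC. Qed.

Lemma adjp_linear B B' : adjp B B' -> linear B.
Proof.
move=> h a x y; apply: inner_ext => z.
by rewrite -h !(innerDr, innerZr) -!h.
Qed.

Lemma adjp_comp B B' C C' : adjp B B' -> adjp C C' -> adjp (B \o C) (C' \o B').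
Proof. by move=> hB hC x y /=; rewrite hC hB. Qed.

Lemma adjpD B B' C C' : adjp B B' -> adjp C C' ->
  adjp (fun x => B x + C x) (fun x => B' x + C' x).
Proof. by move=> hB hC x y /=; rewrite innerDl innerDr hB hC. Qed.

Lemma adjpZ a B B' : adjp B B' -> adjp (fun x => a *: B x) (fun x => conjc a *: B' x).
Proof. by move=> hB x y /=; rewrite innerZl innerZr conjcK hB. Qed.

Lemma adjpN B B' : adjp B B' -> adjp (fun x => - B x) (fun x => - B' x).
Proof. by move=> hB x y /=; rewrite innerNl innerNr hB. Qed.

Lemma adjpB B B' C C' : adjp B B' -> adjp C C' ->
  adjp (fun x => B x - C x) (fun x => B' x - C' x).
Proof. by move=> hB hC; apply: adjpD => //; apply: adjpN. Qed.

Lemma adjp_id : adjp id id.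
Proof. by []. Qed.

Lemma adjp_sum I (r : seq I) (F F' : I -> H -> H) :
  (forall i, adjp (F i) (F' i)) ->
  adjp (fun x => \sum_(i <- r) F i x) (fun x => \sum_(i <- r) F' i x).
Proof.
move=> h x y; rewrite inner_suml inner_sumr; apply: eq_bigr => i _; exact: h.
Qed.

Lemma adjp_bnd M B B' : 0 <= M -> adjp B B' -> bnd M B -> bnd M B'.
Proof.
move=> M0 h hB x; have [->|x0] := eqVneq (rnorm (B' x)) 0.
  by rewrite mulr_ge0 ?rnorm_ge0.
have xp : 0 < rnorm (B' x) by rewrite lt_def x0 rnorm_ge0.
rewrite -(ler_pM2r xp) -expr2 -re_rnorm /re h -/(re _ _).
apply: le_trans (re_le _ _) _.
by rewrite mulrAC mulrC ler_wpM2r ?rnorm_ge0.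
Qed.

Definition coercive (a : R) B := forall u, a * rnorm u ^+ 2 <= re u (B u).

Lemma coercive_adjp (a : R) B B' : adjp B B' -> coercive a B -> coercive a B'.
Proof. by move=> h hB u; rewrite reC /re h; apply: hB. Qed.

Lemma coercive_lower (a : R) B u : 0 < a -> coercive a B -> a * rnorm u <= rnorm (B u).
Proof.
move=> a0 h; have := le_trans (h u) (re_le _ _).
have [->|u0] := eqVneq (rnorm u) 0; first by rewrite mulr0 rnorm_ge0.
have up : 0 < rnorm u by rewrite lt_def u0 rnorm_ge0.
by rewrite expr2 mulrA mulrC ler_pM2l.
Qed.

(* Lax-Milgram: the map u |-> u - t (B u - f) is a contraction for small t. *)
Lemma coercive_surj (a M : R) B : 0 < a -> linear B -> bnd M B -> coercive a B ->
  forall f, exists u, B u = f.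
Proof.
move=> a0 linB hM hB f.
pose b := `|M| + a; have b0 : 0 < b by rewrite /b ltr_wpDl.
have hb : bnd b B by apply: bndW hM; rewrite /b; have := ler_norm M; lra.
(* This [t] minimizes [1 - 2 t a + t^2 b^2], which bounds the square of the contraction factor; the
   minimum is [q2], and [a <= b] makes it nonnegative. *)
pose t := a / b ^+ 2; pose q2 := 1 - a ^+ 2 / b ^+ 2; pose q := Num.sqrt q2.
have ab : a <= b by rewrite /b lerDr.
have q20 : 0 <= q2.
  by rewrite /q2 subr_ge0 ler_pdivrMr ?exprn_gt0// mul1r lerXn2r ?nnegrE// ltW.
have q0 : 0 <= q by rewrite sqrtr_ge0.
have q1 : q < 1.
  rewrite -sqrtr1 ltr_sqrt// /q2 ltrBlDr ltrDl divr_gt0 ?exprn_gt0//.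
have qq : q ^+ 2 = q2 by rewrite sqr_sqrtr.
have ctr (w : H) : rnorm (w - t%:C *: B w) <= q * rnorm w.
  rewrite -(@ler_pXn2r _ 2)// ?nnegrE ?mulr_ge0 ?rnorm_ge0// rnormB_sqr reZr rnormZ.
  rewrite cnR !exprMn qq.
  have t0 : 0 < t by rewrite divr_gt0// exprn_gt0.
  rewrite (gtr0_norm t0) /q2.
  have h1 : rnorm (B w) ^+ 2 <= b ^+ 2 * rnorm w ^+ 2.
    by rewrite -exprMn lerXn2r ?nnegrE ?mulr_ge0 ?rnorm_ge0 ?(ltW b0)//; apply: hb.
  have h2 := hB w.
  have e1 : t ^+ 2 * (b ^+ 2 * rnorm w ^+ 2) = a ^+ 2 / b ^+ 2 * rnorm w ^+ 2.
    by rewrite /t; field; rewrite gt_eqF.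
  have e2 : t * (a * rnorm w ^+ 2) = a ^+ 2 / b ^+ 2 * rnorm w ^+ 2.
    by rewrite /t; field; rewrite gt_eqF.
  have h3 : t ^+ 2 * rnorm (B w) ^+ 2 <= t ^+ 2 * (b ^+ 2 * rnorm w ^+ 2).
    by rewrite ler_wpM2l// sqr_ge0.
  have h4 : t * (a * rnorm w ^+ 2) <= t * re w (B w) by rewrite ler_wpM2l// ltW.
  lra.
pose S (u : H) : H := u - t%:C *: (B u - f).
pose s n : H := iter n S 0.
have SS (u v : H) : rnorm (S u - S v) <= q * rnorm (u - v).
  have -> : S u - S v = (u - v) - t%:C *: B (u - v).
    rewrite /S (lopB linB); hring.
  exact: ctr.
have step n : rnorm (s n.+1 - s n) <= q ^+ n * rnorm (s 1%N).
  elim: n => [|n IH]; first by rewrite expr0 mul1r /s/= subr0.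
  apply: le_trans (SS _ _) _; rewrite exprS -mulrA ler_wpM2l//.
have q1' : 0 < 1 - q by rewrite subr_gt0.
pose K := rnorm (s 1%N) / (1 - q).
have K0 : 0 <= K by rewrite divr_ge0 ?rnorm_ge0// ltW.
have dist n m : rnorm (s (n + m)%N - s n) <= q ^+ n * K.
  have : rnorm (s (n + m)%N - s n) <= q ^+ n * (1 - q ^+ m) * K.
    elim: m => [|m IH]; first by rewrite addn0 subrr rnorm0 expr0 subrr mulr0 mul0r.
    rewrite addnS -(subrK (s (n + m)%N) (s _.+1)) -addrA.
    apply: le_trans (rnormD _ _) _.
    apply: le_trans (lerD (step _) IH) _.
    have -> : rnorm (s 1%N) = (1 - q) * K by rewrite /K mulrC divfK// gt_eqF.
    by rewrite exprD exprS le_eqVlt; apply/orP; left; apply/eqP; ring.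
  move=> h; apply: le_trans h _; rewrite -mulrA ler_wpM2l ?exprn_ge0//.
  by rewrite ler_piMl// lerBlDr lerDl exprn_ge0.
have qn e : 0 < e -> exists n, q ^+ n * K < e.
  move=> e0; have /(@cvg_geometric _ K) : `|q| < 1 by rewrite ger0_norm.
  move=> /cvgrPdist_lt/(_ e e0)[n _ /(_ n (leqnn n))].
  rewrite /geometric/= sub0r normrN => h; exists n.
  by apply: le_lt_trans (ler_norm _) _; rewrite mulrC.
have [e e0|u hu] := @complete_rnorm _ _ s.
  have [n hn] := qn e e0; exists n => m nm.
  by rewrite -(subnKC nm); apply: le_lt_trans (dist _ _) hn.
exists u; apply/eqP; rewrite -subr_eq0; apply/eqP.
have Su : S u = u.
  apply/eqP; rewrite -subr_eq0; apply/eqP/rnorm_eq0/eqP; rewrite eq_le rnorm_ge0 andbT.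
  apply/ler_addgt0Pl => e e0; rewrite addr0.
  have e2 : 0 < e / 2 by rewrite divr_gt0.
  have [n hn] := hu (e / 2) e2.
  have -> : S u - u = (S u - S (s n)) + (s n.+1 - u) by rewrite addrA subrK.
  apply: le_trans (rnormD _ _) _.
  have h1 := SS u (s n); have h2 := hn n (leqnn n); have h3 := hn n.+1 (leqnSn n).
  rewrite rdistC in h2.
  have h4 : q * rnorm (u - s n) <= 1 * rnorm (u - s n).
    by rewrite ler_wpM2r ?rnorm_ge0// ltW.
  lra.
have /eqP : t%:C *: (B u - f) = 0.
  by move: Su; rewrite /S => /eqP; rewrite -subr_eq0 addrAC subrr sub0r oppr_eq0 => /eqP.
have tn : t != 0 by rewrite gt_eqF// divr_gt0// exprn_gt0.
rewrite scaler_eq0 => /orP[|/eqP//].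
by rewrite eq_complex/= (negPf tn).
Qed.

Lemma coercive_inv (a M : R) B : 0 < a -> linear B -> bnd M B -> coercive a B ->
  cancel B (op_inv B) /\ cancel (op_inv B) B.
Proof.
move=> a0 linB hM hB; rewrite /op_inv.
have surj := coercive_surj a0 linB hM hB.
pose G f := projT1 (cid (surj f)).
have BG : cancel G B by move=> f; rewrite /G; case: cid.
have inj u v : B u = B v -> u = v.
  move=> h; apply/eqP; rewrite -subr_eq0; apply/eqP/rnorm_eq0.
  have := coercive_lower (u - v) a0 hB; rewrite lopB// h subrr rnorm0.
  by rewrite pmulr_rle0// => h'; apply/eqP; rewrite eq_le h' rnorm_ge0.
have GB : cancel B G by move=> u; apply: inj; rewrite BG.
by case: xgetP => [B' _ //|/(_ G)]; case.
Qed.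

End LinearOperators.

(** * Regularization of C^{1,1} operators *)

Definition conj_op {R : realType} {H : hilbertType R} (W : R -> H -> H)
  (B : H -> H) (t : R) : H -> H := fun x => W t (B (W (- t) x)).

Section SecondDifferences.
Context {R : realType} {H : hilbertType R}.
Variables (F : R -> H) (k : nat) (w : R).
Hypothesis hw : forall s t, `|t| <= 2^-1 ^+ k ->
  rnorm (F (s + t) + F (s - t) - 2 *: F s) <= w.

Let N := (2 ^ k)%N.
Let tau : R := 2^-1 ^+ k.
Let eta : R := 4^-1 ^+ k.

Let tau_gt0 : 0 < tau. Proof. by rewrite exprn_gt0// invr_gt0. Qed.
Let eta_gt0 : 0 < eta. Proof. by rewrite exprn_gt0// invr_gt0. Qed.
Let tauN : tau * N%:R = 1.
Proof. by rewrite /tau /N natrX -exprMn mulVf ?expr1n// pnatr_eq0. Qed.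
Let etaN : eta * N%:R = tau.
Proof. 
rewrite /eta /tau /N natrX -exprMn; congr (_ ^+ _).
by field.
Qed.
Let etaNN : eta * N%:R ^+ 2 = 1.
Proof. by rewrite expr2 mulrA etaN tauN. Qed.
Let w_ge0 : 0 <= w.
Proof. by apply: le_trans (rnorm_ge0 _) (@hw 0 0 _); rewrite normr0 ltW. Qed.

Lemma sd_pair c a b : `|a| <= tau -> `|b| <= tau ->
  rnorm ((F (c + a) + F (c - a)) - (F (c + b) + F (c - b))) <= 2 * w.
Proof.
move=> ha hb.
have -> : (F (c + a) + F (c - a)) - (F (c + b) + F (c - b)) =
  (F (c + a) + F (c - a) - 2 *: F c) - (F (c + b) + F (c - b) - 2 *: F c) by hring.
apply: le_trans (rnormB _ _) _; rewrite mulr_natl mulr2n.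
by apply: lerD; apply: hw.
Qed.

(** A discrete Fejer mean: [N^2 * eta = 1], and the nodes [(i - j) eta] fill the interval of radius
    [tau] with triangular weights. Keeping [i] and [j] apart is what lets its differences of step
    [eta] telescope. *)
Definition avg2 : H := eta%:C *:
  \sum_(i < N) \sum_(j < N) F ((i%:R - j%:R) * eta).

Lemma avg2_near : rnorm (avg2 - F 0) <= w.
Proof.
have Ng : 0 < N%:R :> R by rewrite ltr0n expn_gt0.
(* Exchanging [i] and [j] pairs each node with its opposite, so that twice the error is a mean of
   second differences at [0]. *)
have e1 : 2 *: (avg2 - F 0) = eta%:C *: \sum_(i < N) \sum_(j < N)
    (F ((i%:R - j%:R) * eta) + F (- ((i%:R - j%:R) * eta)) - 2 *: F 0).
  have -> : \sum_(i < N) \sum_(j < N)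
    (F ((i%:R - j%:R) * eta) + F (- ((i%:R - j%:R) * eta)) - 2 *: F 0) =
    2 *: (\sum_(i < N) \sum_(j < N) F ((i%:R - j%:R) * eta)) -
    (N%:R ^+ 2)%:C *: (2 *: F 0).
    rewrite (_ : 2 *: (\sum_(i < N) _) = \sum_(i < N) \sum_(j < N) F ((i%:R - j%:R) * eta) +
       \sum_(i < N) \sum_(j < N) F (- ((i%:R - j%:R) * eta))); last first.
      rewrite [X in _ + X]exchange_big/= scaler_nat mulr2n; congr (_ + _).
      by apply: eq_bigr => i _; apply: eq_bigr => j _; rewrite -mulNr opprB.
    rewrite -big_split/=.
    have -> : (N%:R ^+ 2)%:C *: (2 *: F 0) = \sum_(i < N) \sum_(j < N) (2 *: F 0).
      rewrite !sumr_const !card_ord -mulrnA -natrX -[RHS]scaler_nat.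
      by rewrite rmorph_nat/= expnS expn1.
    rewrite -sumrB; apply: eq_bigr => i _.
    by rewrite -big_split/= -sumrB.
  rewrite !scalerBr /avg2 [X in _ = _ - X]scalerA -rmorphM/= etaNN scale1r.
  by rewrite !scalerA mulrC.
have h2 : 2 * rnorm (avg2 - F 0) <= w.
  have -> : 2 * rnorm (avg2 - F 0) = rnorm (2 *: (avg2 - F 0)).
    by rewrite rnormZ -(rmorph_nat (real_complex R)) cnR ger0_norm.
  rewrite e1 rnormZ cnR (gtr0_norm eta_gt0).
  have h : rnorm (\sum_(i < N) \sum_(j < N)
    (F ((i%:R - j%:R) * eta) + F (- ((i%:R - j%:R) * eta)) - 2 *: F 0)) <= N%:R ^+ 2 * w.
    apply: le_trans (rnorm_sum _ _) _.
    have -> : N%:R ^+ 2 * w = \sum_(i < N) \sum_(j < N) w.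
      by rewrite !sumr_const !card_ord -mulrnA -natrX mulr_natl expnS expn1.
    apply: ler_sum => i _; apply: le_trans (rnorm_sum _ _) _; apply: ler_sum => j _.
    have := @hw 0 ((i%:R - j%:R) * eta); rewrite add0r sub0r; apply.
    rewrite normrM (gtr0_norm eta_gt0) -/tau -etaN mulrC ler_wpM2l ?(ltW eta_gt0)//.
    have := ltn_ord i; have := ltn_ord j; rewrite -!(ltr_nat R) => hj hi.
    have := ler0n R i; have := ler0n R j => i0 j0.
    by rewrite ler_norml; lra.
  apply: le_trans (_ : eta * (N%:R ^+ 2 * w) <= _); first by rewrite ler_wpM2l// ltW.
  by rewrite mulrA etaNN mul1r.
by have := rnorm_ge0 (avg2 - F 0); lra.
Qed.

(** Since [tau * N = 1], this is the mean over [j] of the difference quotients of step [tau],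
    divided by ['i], at the points [- j eta]. *)
Definition davg : H := - 'i%C *:
  \sum_(j < N) (F (tau - j%:R * eta) - F (- (j%:R * eta))).

Lemma sum_telescope (a : nat -> H) n : \sum_(j < n) (a j.+1 - a j) = a n - a 0%N.
Proof.
elim: n => [|n IH]; first by rewrite big_ord0 subrr.
by rewrite big_ord_recr/= IH addrC addrA subrK.
Qed.

Lemma cn_i : cn ('i%C : R[i]) = 1.
Proof.
apply/eqP; rewrite -(@eqrXn2 _ 2)// ?cn_ge0//.
by rewrite cn_sqr/= expr0n/= add0r expr1n.
Qed.

Lemma davg_near : rnorm (davg -
  (- 'i%C * (2^-1 * 2 ^+ k)%:C) *: (F tau - F (- tau))) <= 3 * (2 ^+ k * w).
Proof.
have -> : (- 'i%C * (2^-1 * 2 ^+ k)%:C) *: (F tau - F (- tau)) =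
   - 'i%C *: \sum_(j < N) (2^-1%:C *: (F tau - F (- tau))).
  rewrite sumr_const card_ord -scalerA; congr (_ *: _).
  by rewrite rmorphM/= mulrC -scalerA -[RHS]scaler_nat rmorphXn/= rmorph_nat natrX.
rewrite /davg -scalerBr -sumrB rnormZ cnN cn_i mul1r.
pose g j := F (tau - j%:R * eta) - F (- (j%:R * eta)).
pose D := F tau - F (- tau).
set S := \sum_(j < N) _.
pose w1 := g 0%N - g N.
have hw1 : rnorm w1 <= w.
  have -> : w1 = F (0 + tau) + F (0 - tau) - 2 *: F 0.
    by rewrite /w1 /g !mul0r subr0 oppr0 (mulrC N%:R) etaN subrr add0r sub0r; hring.
  by apply: hw; rewrite ger0_norm ?(ltW tau_gt0).
(* The sum is added to its reversal [j |-> N - j]. The reversal maps [0 .. N-1] to [1 .. N], whence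
   the boundary term [w1], itself a second difference at [0]. *)
have e2 : 2 *: S = \sum_(j < N) (g j + g (N - j)%N - D) + w1.
  have revN : \sum_(j < N) g j = \sum_(j < N) g (N - j)%N + w1.
    have : \sum_(j < N.+1) g j = \sum_(j < N.+1) g (N - j)%N.
      by rewrite (reindex_inj rev_ord_inj)/=; apply: eq_bigr => j _; rewrite subSS.
    rewrite [LHS]big_ord_recr [RHS]big_ord_recr/= subnn /w1 => h.
    by rewrite addrA -h addrK.
  have -> : S = \sum_(j < N) g j - \sum_(j < N) (2^-1%:C *: D).
    by rewrite -sumrB.
  rewrite scalerBr [X in X - _]scaler_nat mulr2n {2}revN addrA -big_split/= addrAC.
  congr (_ + _); rewrite scaler_sumr -sumrB; apply: eq_bigr => j _; congr (_ - _).
  by rewrite scalerA -(rmorph_nat (real_complex R)) -rmorphM/= mulfV ?scale1r// pnatr_eq0.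
have h2 : 2 * rnorm S <= N%:R * (4 * w) + w.
  have -> : 2 * rnorm S = rnorm (2 *: S).
    by rewrite rnormZ -(rmorph_nat (real_complex R)) cnR ger0_norm.
  rewrite e2; apply: le_trans (rnormD _ _) _; apply: lerD => //.
  apply: le_trans (rnorm_sum _ _) _.
  have -> : N%:R * (4 * w) = \sum_(j < N) (4 * w) by rewrite sumr_const card_ord mulr_natl.
  apply: ler_sum => j _.
  pose s := j%:R * eta.
  have s0 : 0 <= s by rewrite mulr_ge0// ltW.
  have st : s <= tau by rewrite /s -etaN [leRHS]mulrC ler_wpM2r ?(ltW eta_gt0)// ler_nat ltnW.
  (* Two comparisons of symmetric pairs, centred at [tau / 2] and at [- (tau / 2)], each of the form
     treated by [sd_pair]. *)
  have -> : g j + g (N - j)%N - D =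
    ((F (tau / 2 + (tau / 2 - s)) + F (tau / 2 - (tau / 2 - s))) -
     (F (tau / 2 + tau / 2) + F (tau / 2 - tau / 2))) -
    ((F (- (tau / 2) + (tau / 2 - s)) + F (- (tau / 2) - (tau / 2 - s))) -
     (F (- (tau / 2) + tau / 2) + F (- (tau / 2) - tau / 2))).
    rewrite /g /D natrB 1?ltnW// mulrBl (mulrC N%:R) etaN -/s.
    have -> : tau / 2 + (tau / 2 - s) = tau - s by field.
    have -> : tau / 2 - (tau / 2 - s) = s by field.
    have -> : tau / 2 + tau / 2 = tau by field.
    have -> : - (tau / 2) + (tau / 2 - s) = - s by field.
    have -> : - (tau / 2) - (tau / 2 - s) = s - tau by field.
    have -> : - (tau / 2) - tau / 2 = - tau by field.
    have -> : tau / 2 - tau / 2 = 0 by ring.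
    have -> : - (tau / 2) + tau / 2 = 0 by ring.
    have -> : tau - (tau - s) = s by ring.
    have -> : - (tau - s) = s - tau by ring.
    hring.
  have b1 : `|tau / 2 - s| <= tau by rewrite ler_norml; have := tau_gt0; lra.
  have b2 : `|tau / 2| <= tau by rewrite ger0_norm; have := tau_gt0; lra.
  apply: le_trans (rnormB _ _) _.
  have -> : 4 * w = 2 * w + 2 * w by ring.
  by apply: lerD; apply: sd_pair.
have N1 : 1 <= N%:R :> R by rewrite ler1n expn_gt0.
have NE : 2 ^+ k = N%:R :> R by rewrite natrX.
rewrite NE; have h3 := ler_wpM2r w_ge0 N1; rewrite mul1r in h3; have := w_ge0; lra.
Qed.

End SecondDifferences.

Definition ugroup {R : realType} {H : hilbertType R} (W : R -> H -> H) :=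
  [/\ W 0 = id, forall s t, W (s + t) = W s \o W t & forall t, adjp (W t) (W (- t))].

(* For a summable p this is the dyadic form of U in C^{1,1}(A). *)
Definition zygmund {R : realType} {H : hilbertType R} (W : R -> H -> H)
    (U : H -> H) (p : nat -> R) :=
  forall k t x, `|t| <= 2^-1 ^+ k ->
    rnorm (conj_op W U t x + conj_op W U (- t) x - 2 *: U x) <=
    2^-1 ^+ k * p k * rnorm x.

Section Averages.
Context {R : realType} {H : hilbertType R}.
Variables (W : R -> H -> H) (U Us : H -> H) (p : nat -> R).
Hypotheses (gW : ugroup W) (adjU : adjp U Us) (zyg : zygmund W U p).

Let W0 : W 0 = id. Proof. by case: gW. Qed.
Let WD s t x : W (s + t) x = W s (W t x). Proof. by case: gW => _ ->. Qed.
Let adjW t : adjp (W t) (W (- t)). Proof. by case: gW. Qed.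

Lemma group_linear t : linear (W t). Proof. exact: adjp_linear (adjW t). Qed.

Lemma groupNK t x : W t (W (- t) x) = x.
Proof. by rewrite -WD subrr W0. Qed.

Lemma groupK t x : W (- t) (W t x) = x.
Proof. by rewrite -WD addNr W0. Qed.

Lemma group_iso t x : rnorm (W t x) = rnorm x.
Proof.
apply/eqP; rewrite -(@eqrXn2 _ 2)// ?rnorm_ge0//.
by rewrite -!re_rnorm /re; have := adjW (- t) x (W t x); rewrite opprK groupK => ->.
Qed.

Lemma adjp_conj t B B' : adjp B B' -> adjp (conj_op W B t) (conj_op W B' t).
Proof.
move=> h; have := adjp_comp (adjW t) (adjp_comp h (adjW (- t))).
by rewrite opprK.
Qed.

Lemma conj_opD B s t x : conj_op W (conj_op W B s) t x = conj_op W B (t + s) x.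
Proof. by rewrite /conj_op opprD (addrC (- t)) !WD. Qed.

Lemma conj_op0 B : conj_op W B 0 = B.
Proof. by rewrite /conj_op oppr0 W0. Qed.

Lemma conj_bnd B t M : bnd M B -> bnd M (conj_op W B t).
Proof. by move=> h x; rewrite /conj_op group_iso -(group_iso (- t) x); apply: h. Qed.

Let F x (t : R) := conj_op W U t x.

(** Conjugation by the unitary [W s] moves the base point of a second difference from [0] to [s]. *)
Lemma zygmund_shift k s t x : `|t| <= 2^-1 ^+ k ->
  rnorm (F x (s + t) + F x (s - t) - 2 *: F x s) <= 2^-1 ^+ k * p k * rnorm x.
Proof.
move=> ht; have := zyg (W (- s) x) ht; rewrite group_iso; apply: le_trans.
rewrite -[leRHS](group_iso s) le_eqVlt; apply/orP; left; apply/eqP; congr rnorm.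
rewrite (lopB (group_linear s)) (lopD (group_linear s)) (lopZ (group_linear s)).
by rewrite /F -!(conj_opD _ _ s).
Qed.

(* Uavg k approximates U at the scale 2^-k; its commutator with the bounded
   operator (W eta - 1) / (i eta), eta = 4^-k, which replaces A, is Tavg k. *)
Definition Uavg k x : H := avg2 (F x) k.
Definition Tavg k x : H := davg (F x) k.
Let eta k : R := 4^-1 ^+ k.
(** This is the commutator of [(W t - 1) / (i t)] with [B], multiplied on the right by [W (- t)]. *)
Definition Wdiff B (t : R) x : H := ('i%C * t%:C)^-1 *: (conj_op W B t x - B x).
(** The central difference quotient of step [2^-k]. Halving the step changes it by second
    differences only, which makes it the link between [Tavg k] and the limit [T]. *)
Definition Sdiff k x : H :=
  (- 'i%C * (2^-1 * 2 ^+ k)%:C) *: (F x (2^-1 ^+ k) - F x (- 2^-1 ^+ k)).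

Lemma Uavg_adjp k : exists B', adjp (Uavg k) B'.
Proof.
eexists; apply: adjpZ; apply: adjp_sum => i; apply: adjp_sum => j.
exact: adjp_conj adjU.
Qed.

Lemma Tavg_adjp k : exists B', adjp (Tavg k) B'.
Proof.
eexists; apply: adjpZ; apply: adjp_sum => i; apply: adjpB; exact: adjp_conj adjU.
Qed.

Lemma Sdiff_adjp k : exists B', adjp (Sdiff k) B'.
Proof. by eexists; apply: adjpZ; apply: adjpB; exact: adjp_conj adjU. Qed.

Lemma Uavg_near k : bnd (2^-1 ^+ k * p k) (fun x => Uavg k x - U x).
Proof.
move=> x; have -> : U x = F x 0 by rewrite /F conj_op0.
by apply: avg2_near => s t; apply: zygmund_shift.
Qed.

Let two2 k : 2 ^+ k * 2^-1 ^+ k = 1 :> R.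
Proof. by rewrite -exprMn mulfV ?expr1n// pnatr_eq0. Qed.

Lemma Tavg_Sdiff k : bnd (3 * p k) (fun x => Tavg k x - Sdiff k x).
Proof.
move=> x; apply: le_trans (davg_near (w := 2^-1 ^+ k * p k * rnorm x) _) _.
  by move=> s t; apply: zygmund_shift.
rewrite [leLHS](_ : _ = (2 ^+ k * 2^-1 ^+ k) * (3 * p k * rnorm x)); last by ring.
by rewrite two2 mul1r.
Qed.

Lemma Sdiff_step k : bnd (p k.+1) (fun x => Sdiff k.+1 x - Sdiff k x).
Proof.
move=> x; pose t : R := 2^-1 ^+ k.+1.
have t0 : 0 <= t by rewrite exprn_ge0// invr_ge0.
have tt : 2^-1 ^+ k = t + t by rewrite /t exprS; field.
have h1 := @zygmund_shift k.+1 t t x; have h2 := @zygmund_shift k.+1 (- t) t x.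
rewrite (ger0_norm t0) lexx in h1 h2.
have -> : Sdiff k.+1 x - Sdiff k x = (- 'i%C * (2^-1 * 2 ^+ k)%:C) *:
  ((F x (- t + t) + F x (- t - t) - 2 *: F x (- t)) -
   (F x (t + t) + F x (t - t) - 2 *: F x t)).
  rewrite /Sdiff tt -/t exprS opprD subrr addNr !rmorphM/=.
  have -> : (2 : R)%:C = 2 by rewrite rmorph_nat.
  hring.
rewrite rnormZ cnM cnN cn_i mul1r cnR ger0_norm ?mulr_ge0 ?invr_ge0 ?exprn_ge0//.
apply: le_trans (_ : 2^-1 * 2 ^+ k * (2 * (2^-1 ^+ k.+1 * p k.+1 * rnorm x)) <= _).
  rewrite ler_wpM2l ?mulr_ge0 ?invr_ge0 ?exprn_ge0//.
  apply: le_trans (rnormB _ _) _; rewrite mulr_natl mulr2n; apply: lerD.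
    exact: h2.
  exact: h1.
have -> : 2^-1 * 2 ^+ k * (2 * (2^-1 ^+ k.+1 * p k.+1 * rnorm x)) =
   2 ^+ k.+1 * 2^-1 ^+ k.+1 * (p k.+1 * rnorm x) / 2 by rewrite (exprS 2); field.
rewrite two2 mul1r ler_piMr ?invf_le1//; last by lra.
have := le_trans (rnorm_ge0 _) (h1 isT).
by rewrite -mulrA pmulr_rge0// exprn_gt0 ?invr_gt0.
Qed.

Let etaP k : (2 ^ k)%:R * eta k = 2^-1 ^+ k.
Proof. rewrite /eta natrX -exprMn; congr (_ ^+ _); by field. Qed.

Let eta_gt0 k : 0 < eta k. Proof. by rewrite exprn_gt0// invr_gt0. Qed.

(** Translating the nodes by [eta] raises [i] by one; the sum over [i] telescopes and leaves [davg]
    without any error term. *)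
Lemma Wdiff_Uavg k : Wdiff (Uavg k) (eta k) = Tavg k.
Proof.
apply/funext => x; rewrite /Wdiff.
have -> : conj_op W (Uavg k) (eta k) x = avg2 (fun t => F x (eta k + t)) k.
  rewrite /conj_op /Uavg /avg2 (lopZ (group_linear _)); congr (_ *: _).
  rewrite (lop_sum (group_linear _)); apply: eq_bigr => i _.
  rewrite (lop_sum (group_linear _)); apply: eq_bigr => j _.
  by rewrite /F -conj_opD.
rewrite /avg2 -scalerBr scalerA invfM -mulrA mulVf; last first.
  by rewrite eq_complex/= gt_eqF.
rewrite mulr1 /Tavg /davg; congr (_ *: _).
  by apply: (@mulfI _ 'i%C); rewrite ?mulfV ?mulrN -?expr2 ?sqr_i ?opprK// eq_complex/= oner_eq0 andbF.
rewrite exchange_big [X in _ - X]exchange_big -sumrB; apply: eq_bigr => j _.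
rewrite -sumrB.
pose a n := F x ((n%:R - j%:R) * eta k).
rewrite (eq_bigr (fun i : 'I__ => a i.+1 - a i)); last first.
  move=> i _; rewrite /a; congr (F x _ - _).
  by rewrite -(@natr1 R i) /eta; ring.
rewrite (sum_telescope a) /a; congr (F x _ - F x _).
  by rewrite mulrBl etaP.
by rewrite sub0r mulNr.
Qed.

(** The sum over [j] telescopes in turn and leaves one second difference of step [2^-k]; the
    division by [4^-k] turns its bound [2^-k * p k] into [2^k * p k]. *)
Lemma Wdiff_Tavg k : bnd (2 ^+ k * p k) (Wdiff (Tavg k) (eta k)).
Proof.
move=> x; rewrite /Wdiff.
have -> : conj_op W (Tavg k) (eta k) x = davg (fun t => F x (eta k + t)) k.
  rewrite /conj_op /Tavg /davg (lopZ (group_linear _)); congr (_ *: _).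
  rewrite (lop_sum (group_linear _)); apply: eq_bigr => i _.
  by rewrite (lopB (group_linear _)) /F -!(conj_opD _ _ (eta k)).
have -> : davg (fun t => F x (eta k + t)) k - davg (F x) k =
   - 'i%C *: (F x (eta k + 2^-1 ^+ k) + F x (eta k - 2^-1 ^+ k) - 2 *: F x (eta k)).
  rewrite /davg -scalerBr; congr (_ *: _); rewrite -sumrB.
  pose a n := F x (2^-1 ^+ k + eta k - n%:R * eta k).
  pose b n := F x (eta k - n%:R * eta k).
  rewrite (eq_bigr (fun j : 'I__ => (b j.+1 - b j) - (a j.+1 - a j))); last first.
    move=> j _; rewrite /a /b.
    have -> : 2^-1 ^+ k - j%:R * 4^-1 ^+ k = 2^-1 ^+ k + eta k - j.+1%:R * eta k.
      by rewrite -(@natr1 R j) /eta; ring.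
    have -> : eta k + (2^-1 ^+ k + eta k - j.+1%:R * eta k) =
              2^-1 ^+ k + eta k - j%:R * eta k by rewrite -(@natr1 R j) /eta; ring.
    have -> : - (j%:R * 4^-1 ^+ k) = eta k - j.+1%:R * eta k.
      by rewrite -(@natr1 R j) /eta; ring.
    have -> : eta k + (eta k - j.+1%:R * eta k) = eta k - j%:R * eta k.
      by rewrite -(@natr1 R j) /eta; ring.
    hring.
  rewrite sumrB (sum_telescope a) (sum_telescope b) /a /b etaP !mul0r !subr0.
  have -> : 2^-1 ^+ k + eta k - 2^-1 ^+ k = eta k by ring.
  rewrite (addrC (2^-1 ^+ k)); hring.
rewrite scalerA rnormZ cnM cnV cnM cnN cn_i mulr1 mul1r cnR (gtr0_norm (eta_gt0 k)).
apply: le_trans (ler_wpM2l _ (zygmund_shift (k := k) _ _ _)) _.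
- by rewrite invr_ge0 ltW.
- by rewrite ger0_norm ?exprn_ge0 ?invr_ge0.
rewrite le_eqVlt; apply/orP; left; apply/eqP.
rewrite !mulrA; congr (_ * _ * _).
rewrite /eta -exprVn -exprMn; congr (_ ^+ _); by field.
Qed.

End Averages.

(** * Differential inequality for the deformed resolvent *)

Section Deformation.
Context {R : realType} {H : hilbertType R}.
Implicit Types (x y : H) (B M : H -> H).

(** Replaces a bound on a derivative: over [n] equal pieces the quadratic errors add up to
    [K * (b - a)^2 / n], which is arbitrarily small whatever [K] is. *)
Lemma mean_value (f : R -> R[i]) (a b L K : R) : a <= b -> 0 <= L -> 0 <= K ->
  (forall s t, a <= s <= b -> a <= t <= b ->
     cn (f t - f s) <= L * `|t - s| + K * `|t - s| ^+ 2) ->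
  cn (f b - f a) <= L * (b - a).
Proof.
move=> ab L0 K0 h; apply/ler_addgt0Pr => e e0.
pose D := b - a; have D0 : 0 <= D by rewrite subr_ge0.
pose n := (Num.truncn (K * D ^+ 2 / e)).+1.
have hn : K * D ^+ 2 / e < n%:R by apply: truncnS_gt.
have n0 : 0 < n%:R :> R by rewrite ltr0n.
pose hh := D / n%:R; have hh0 : 0 <= hh by rewrite divr_ge0// ltW.
pose s i : R := a + i%:R * hh.
have sn : s n = b by rewrite /s /hh mulrC divfK ?gt_eqF// /D addrC subrK.
have sin i : (i <= n)%N -> a <= s i <= b.
  move=> ni; rewrite lerDl mulr_ge0//= -sn lerD2l ler_wpM2r// ler_nat//.
have step i : (i < n)%N -> cn (f (s i.+1) - f (s i)) <= L * hh + K * hh ^+ 2.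
  move=> ni; apply: le_trans (h _ _ (sin _ (ltnW ni)) (sin _ ni)) _.
  have -> : s i.+1 - s i = hh by rewrite /s -(@natr1 R i); ring.
  by rewrite (ger0_norm hh0).
have tot i : (i <= n)%N -> cn (f (s i) - f a) <= i%:R * (L * hh + K * hh ^+ 2).
  elim: i => [_|i IH ni]; first by rewrite /s mul0r addr0 subrr cn0 mul0r.
  have -> : f (s i.+1) - f a = (f (s i.+1) - f (s i)) + (f (s i) - f a) by ring.
  apply: le_trans (cnD _ _) _; rewrite -(@natr1 R i) mulrDl mul1r addrC.
  by apply: lerD; [exact: IH (ltnW ni)|exact: step].
have := tot n (leqnn n); rewrite sn => /le_trans; apply.
have -> : n%:R * (L * hh + K * hh ^+ 2) = L * D + K * D ^+ 2 / n%:R.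
  by rewrite /hh; field; rewrite gt_eqF.
rewrite lerD2l ler_pdivrMr//; move: hn; rewrite ltr_pdivrMr// => /ltW.
by rewrite (mulrC e).
Qed.

(** The adjoint is carried along because the commutator estimate pairs [op_inv M phi] with
    [op_inv M' phi], and both obey the same bounds by [copC]. *)
Record cop (c : R) M M' := {
  cop_gt0 : 0 < c;
  cop_adj : adjp M M';
  cop_bnd : exists b, bnd b M;
  cop_coe : coercive c M }.

Lemma cop_linear c M M' : cop c M M' -> linear M.
Proof. by case=> _ /adjp_linear. Qed.

Lemma copC c M M' : cop c M M' -> cop c M' M.
Proof.
case=> c0 adjM [b hb] coe; split => //; first exact: adjpC.
- exists `|b|; apply: adjp_bnd adjM _ => //; apply: bndW hb; exact: ler_norm.
- exact: coercive_adjp coe.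
Qed.

Lemma cop_inv c M M' : cop c M M' -> cancel M (op_inv M) /\ cancel (op_inv M) M.
Proof.
by move=> h; case: (h) => c0 _ [b hb] coe; apply: coercive_inv c0 (cop_linear h) hb coe.
Qed.

Lemma op_invK c M M' x : cop c M M' -> M (op_inv M x) = x.
Proof. by move=> /cop_inv[_]. Qed.

Lemma op_invKV c M M' x : cop c M M' -> op_inv M (M x) = x.
Proof. by move=> /cop_inv[]. Qed.

Lemma op_inv_le c M M' x : cop c M M' -> rnorm (op_inv M x) <= rnorm x / c.
Proof.
move=> h; case: (h) => c0 _ _ coe.
by rewrite ler_pdivlMr// mulrC -{2}(op_invK x h); apply: coercive_lower.
Qed.

Lemma op_inv_swap c M M' x y : cop c M M' ->
  inner (op_inv M' x) y = inner x (op_inv M y).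
Proof.
move=> h; rewrite -{1}(op_invK y h) -(cop_adj h) (op_invK x (copC h))//.
Qed.

Lemma op_inv_linear c M M' : cop c M M' -> linear (op_inv M).
Proof.
move=> h; apply: (@adjp_linear _ _ _ (op_inv M')) => x y.
exact: op_inv_swap h.
Qed.

Definition energy M x : R[i] := inner x (op_inv M x).

(** Coercivity tested at [op_inv M x]. It bounds this vector by the square root of the energy over
    [c], which loses only [c^(-1/2)] where [op_inv_le] loses [c^-1]. *)
Lemma energy_le c M M' x : cop c M M' ->
  c * rnorm (op_inv M x) ^+ 2 <= cn (energy M x).
Proof.
move=> h; apply: le_trans (cop_coe h _) _; rewrite (op_invK x h) reC /re.
exact: Re_le_cn.
Qed.

Lemma energy_adj c M M' x : cop c M M' -> cn (energy M' x) = cn (energy M x).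
Proof.
by move=> h; rewrite /energy -(op_inv_swap x x h) -cn_conj -innerC.
Qed.

Lemma energy_le' c M M' x : cop c M M' ->
  c * rnorm (op_inv M' x) ^+ 2 <= cn (energy M x).
Proof. by move=> h; rewrite -(energy_adj x h); apply: energy_le (copC h). Qed.

Lemma resolvent_diff c1 c2 M1 M1' M2 M2' x : cop c1 M1 M1' -> cop c2 M2 M2' ->
  energy M2 x - energy M1 x =
  inner (op_inv M2' x) (M1 (op_inv M1 x) - M2 (op_inv M1 x)).
Proof.
move=> h1 h2; rewrite (op_inv_swap _ _ h2) (lopB (op_inv_linear h2)).
by rewrite (op_invK x h1) (op_invKV _ h2) innerBr.
Qed.

Definition deform (z : R[i]) V T (e : R) : H -> H :=
  fun x => x - z *: (V x - e%:C *: T x).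

Section commutator.
Variables (W : R -> H -> H) (V T : H -> H) (eta e c : R) (z : R[i]) (M' : H -> H).
Let M := deform z V T e.
Hypotheses (gW : ugroup W) (eta0 : 0 < eta) (e0 : 0 <= e) (z1 : cn z <= 1).
Hypotheses (copM : cop c M M') (linT : linear T) (VT : Wdiff W V eta = T).
Variables (b rho : R).
Hypotheses (bT : bnd b T) (bR : bnd rho (Wdiff W T eta)) (b0 : 0 <= b) (rho0 : 0 <= rho).
Variable (phi : H).
Let u := op_inv M phi.
Let v := op_inv M' phi.
Let A := rnorm (W eta phi - phi).

Let ie0 : ('i%C * eta%:C : R[i]) != 0.
Proof.
by rewrite mulf_neq0// eq_complex/= ?oner_eq0 ?andbF// gt_eqF.
Qed.

Lemma WdiffE (B : H -> H) x : W eta (B x) = B (W eta x) + ('i%C * eta%:C) *: Wdiff W B eta (W eta x).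
Proof.
rewrite /Wdiff scalerA mulfV// scale1r /conj_op (groupK gW) addrC subrK//.
Qed.

Lemma deform_comm x : W eta (M x) =
  M (W eta x) - (z * ('i%C * eta%:C)) *: (T (W eta x) - e%:C *: Wdiff W T eta (W eta x)).
Proof.
have lW := group_linear gW eta.
rewrite /M /deform !(lopB lW) !(lopZ lW) !(lopB lW) !(lopZ lW).
by rewrite !WdiffE VT; hring.
Qed.

Let uM : M u = phi. Proof. exact: op_invK copM. Qed.

(** [M (W eta u - u)] is [W eta phi - phi] up to [eta] times a bounded commutator, and coercivity
    inverts [M]. The factor [eta = 4^-k] compensates the loss of [1 / c]. *)
Lemma translate_resolvent :
  rnorm (W eta u - u) <= (A + eta * ((b + e * rho) * rnorm u)) / c.
Proof.
have c0 := cop_gt0 copM.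
rewrite ler_pdivlMr// mulrC.
apply: le_trans (coercive_lower _ c0 (cop_coe copM)) _.
rewrite (lopB (cop_linear copM)) uM.
have dc := deform_comm u; rewrite uM in dc.
pose y := T (W eta u) - e%:C *: Wdiff W T eta (W eta u).
have -> : M (W eta u) = W eta phi + (z * ('i%C * eta%:C)) *: y by rewrite dc subrK.
have -> : W eta phi + (z * ('i%C * eta%:C)) *: y - phi =
  (W eta phi - phi) + (z * ('i%C * eta%:C)) *: y by hring.
apply: le_trans (rnormD _ _) _; rewrite lerD2l rnormZ !cnM cn_i mul1r cnR (gtr0_norm eta0).
rewrite mulrAC mulrC; apply: ler_pM; rewrite ?mulr_ge0 ?rnorm_ge0 ?cn_ge0 ?(ltW eta0)//.
apply: le_trans (_ : 1 * rnorm y <= _); first by rewrite ler_wpM2r ?rnorm_ge0.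
rewrite mul1r /y mulrDl -(group_iso gW eta u).
apply: le_trans (rnormB _ _) _; apply: lerD; first exact: bT.
by rewrite rnormZ cnR (ger0_norm e0) -mulrA ler_wpM2l//; apply: bR.
Qed.

(* Here [A_eta,M] = -z (T - e R) W_eta with A_eta = (W_eta - 1)/(i eta), so
   that z G T G is a commutator of A_eta with G up to small terms. *)
Lemma commutator_bound m : rnorm u <= m -> rnorm v <= m ->
  cn (z * inner v (T u)) <= e * rho * m ^+ 2 + 2 * (A / eta) * m +
    b * m * ((A + eta * ((b + e * rho) * m)) / c).
Proof.
move=> um vm.
have m0 : 0 <= m := le_trans (rnorm_ge0 _) um.
have c0 := cop_gt0 copM.
(* Three contributions: the second commutator, which carries the factor [e]; the commutator of the
   difference quotient with the inverse of [M], which falls on [phi]; the error of replacing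
   [W eta u] by [u]. *)
have -> : z * inner v (T u) = z * e%:C * inner v (Wdiff W T eta (W eta u))
  - ('i%C * eta%:C)^-1 * (inner v (W eta phi - phi) - inner (W (- eta) phi - phi) u)
  - z * inner v (T (W eta u - u)).
  have e1 : inner v (W eta phi) = inner phi (W eta u)
    - (z * ('i%C * eta%:C)) * (inner v (T (W eta u)) - e%:C * inner v (Wdiff W T eta (W eta u))).
    rewrite -{1}uM deform_comm innerBr innerZr innerBr innerZr; congr (_ - _).
    by rewrite /v (op_inv_swap _ _ copM) (op_invKV _ copM).
  have e2 : inner (W (- eta) phi) u = inner phi (W eta u) by case: gW => _ _ ->.
  have e3 : inner v phi = inner phi u by rewrite /v (op_inv_swap _ _ copM).
  rewrite innerBr innerBl e1 e2 e3 (lopB linT) innerBr.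
  by field; apply/andP; split=> //; rewrite eq_complex/= ?oner_eq0 ?andbF// gt_eqF.
have Wu : rnorm (W eta u) <= m by rewrite (group_iso gW).
have AE : rnorm (W (- eta) phi - phi) = A.
  rewrite /A -(group_iso gW eta (_ - _)) (lopB (group_linear gW _)) (groupNK gW).
  by rewrite rdistC.
apply: le_trans (cnD _ _) _; rewrite cnN; apply: lerD; last first.
  rewrite cnM; apply: le_trans (ler_piMl (cn_ge0 _) z1) _.
  apply: le_trans (cauchy_schwarz _ _) _; rewrite -mulrA mulrCA.
  apply: ler_pM; rewrite ?rnorm_ge0//; apply: le_trans (bT _) _; rewrite ler_wpM2l//.
  apply: le_trans translate_resolvent _; rewrite ler_wpM2r ?invr_ge0 ?(ltW c0)//.
  rewrite lerD2l !ler_wpM2l ?(ltW eta0)// addr_ge0// mulr_ge0//.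
apply: le_trans (cnD _ _) _; rewrite cnN; apply: lerD.
  rewrite !cnM cnR (ger0_norm e0) -[leRHS]mulrA -[leLHS]mulrA.
  apply: le_trans (ler_piMl _ z1) _; first by rewrite mulr_ge0 ?cn_ge0.
  rewrite ler_wpM2l// ; apply: le_trans (cauchy_schwarz _ _) _.
  rewrite expr2 mulrCA; apply: ler_pM; rewrite ?rnorm_ge0//.
  by apply: le_trans (bR _) _; rewrite ler_wpM2l.
rewrite cnM cnV cnM cn_i mul1r cnR (gtr0_norm eta0).
have -> : 2 * (A / eta) * m = eta^-1 * (m * A + A * m) by ring.
rewrite ler_wpM2l ?invr_ge0 ?(ltW eta0)//.
apply: le_trans (cnD _ _) _; rewrite cnN; apply: lerD; apply: le_trans (cauchy_schwarz _ _) _.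
  by rewrite ler_wpM2r ?rnorm_ge0.
by rewrite AE ler_wpM2l ?rnorm_ge0.
Qed.

End commutator.
End Deformation.

(** Since [s <= 1/2], each use of the second hypothesis halves the excess of the bound over
    [Z = 2 * (1 + cn f0)]. The initial bound [B] is thus forgotten, and a last use with [Y = Z]
    gives the claim. *)
Lemma self_improvement {R : realType} {T : Type} (I : T -> Prop) (f : T -> R[i]) (f0 : R[i])
    (s B : R) : 0 <= s -> s <= 2^-1 -> (forall t, I t -> cn (f t) <= B) ->
  (forall Y, 1 <= Y -> (forall t, I t -> cn (f t) <= Y) ->
     forall t, I t -> cn (f t - f0) <= s * Y) ->
  forall t, I t -> cn (f t - f0) <= 2 * s * (1 + cn f0).
Proof.
move=> s0 s2 hB h t It.
pose Z := 2 * (1 + cn f0); have c0 := cn_ge0 f0.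
have Z1 : 1 <= Z by rewrite /Z; lra.
have B0 : 0 <= B := le_trans (cn_ge0 _) (hB t It).
have half n : forall t', I t' -> cn (f t') <= Z + 2^-1 ^+ n * B.
  elim: n => [|n IH] t' It'.
    by rewrite expr0 mul1r; have := hB _ It'; lra.
  have nB : 0 <= 2^-1 ^+ n * B by rewrite mulr_ge0// exprn_ge0// invr_ge0.
  have Y1 : 1 <= Z + 2^-1 ^+ n * B by lra.
  have := h _ Y1 IH t' It'.
  have hh : s * (Z + 2^-1 ^+ n * B) <= 2^-1 * (Z + 2^-1 ^+ n * B).
    by rewrite ler_wpM2r//; lra.
  have := cnD (f t' - f0) f0; rewrite subrK exprS -mulrA /Z; move: hh; rewrite /Z.
  set x := _ ^+ n * B; lra.
have := h Z Z1 _ t It; rewrite /Z mulrA (mulrC s); apply => t' It'.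
apply/ler_addgt0Pr => e e0.
have /(@cvg_geometric _ B) : `|2^-1 : R| < 1 by rewrite ger0_norm; lra.
move=> /cvgrPdist_lt/(_ e e0)[n _ /(_ n (leqnn n))].
rewrite /geometric/= sub0r normrN => hn; apply: le_trans (half n t' It') _.
by rewrite lerD2l mulrC ltW// (le_lt_trans (ler_norm _)).
Qed.

(** * One dyadic step of the differential inequality *)

Section DyadicStep.
Context {R : realType} {H : hilbertType R}.
Variables (W : R -> H -> H) (U : H -> H) (V T : nat -> H -> H).
Variables (p q : nat -> R) (a b P : R) (z : R[i]) (k : nat).
Hypothesis gW : ugroup W.
Hypothesis a0 : 0 < a.
Hypothesis b0 : 0 <= b.
Hypothesis z1 : cn z <= 1.
Hypothesis p0 : forall k, 0 <= p k.
Hypothesis pP : forall k, p k <= P.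
Hypothesis q0 : 0 <= q k.
Hypothesis adjV : forall k, exists V', adjp (V k) V'.
Hypothesis adjT : forall k, exists T', adjp (T k) T'.
Hypothesis bndU : exists b', bnd b' U.
Hypothesis bV : forall k, bnd (2^-1 ^+ k * p k) (fun x => V k x - U x).
Hypothesis VT : forall k, Wdiff W (V k) (4^-1 ^+ k) = T k.
Hypothesis bT : forall k, bnd b (T k).
Hypothesis bTd : bnd (q k) (fun x => T k.+1 x - T k x).
Hypothesis bR : forall k, bnd (2 ^+ k * p k) (Wdiff W (T k) (4^-1 ^+ k)).
Variable phi : nat -> H.

Let eps n : R := 2^-1 ^+ n.
Let Mk n e := deform z (V n) (T n) e.

Hypothesis coe : forall n e, (k <= n)%N -> eps n.+1 <= e <= eps n ->
  coercive (a * e) (Mk n e).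

Let eps_gt0 n : 0 < eps n. Proof. by rewrite exprn_gt0// invr_gt0. Qed.
Let eps_le1 n : eps n <= 1. Proof. by rewrite exprn_ile1// ?invr_ge0// invf_le1// ler1n. Qed.
Let epsS n : eps n.+1 = eps n / 2. Proof. by rewrite /eps exprS mulrC. Qed.

Lemma deform_adjoint n e : exists M', adjp (Mk n e) M'.
Proof.
have [V' hV] := adjV n; have [T' hT] := adjT n.
by eexists; apply: adjpB adjp_id _; apply: adjpZ; apply: adjpB hV _; apply: adjpZ hT.
Qed.

Lemma deform_bnd n e : exists M, bnd M (Mk n e).
Proof.
have [bU hU] := bndU.
have hV : bnd (2^-1 ^+ n * p n + bU) (V n).
  by move=> x; rewrite -(subrK (U x) (V n x)); exact: bndD (bV n) hU x.
have hid : bnd 1 (fun x : H => x) by move=> x; rewrite mul1r.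
eexists; exact: bndB hid (bndZ z (bndB hV (bndZ e%:C (bT n)))).
Qed.

Lemma deform_cop n e : (k <= n)%N -> eps n.+1 <= e <= eps n ->
  exists M', cop (a * e) (Mk n e) M'.
Proof.
move=> kn he; have [M' hM] := deform_adjoint n e; exists M'; split => //.
- by rewrite mulr_gt0//; case/andP: he => + _; apply: lt_le_trans.
- exact: deform_bnd.
- exact: coe.
Qed.

Let E := eps k.
Let sigma := Num.sqrt E.
Let alpha := rnorm (W (4^-1 ^+ k) (phi k) - phi k) / 4^-1 ^+ k.
Let delta := rnorm (phi k.+1 - phi k).
Let kappa := Num.sqrt (2 / a).
Let F e := energy (Mk k e) (phi k).
Let I e := eps k.+1 <= e <= eps k.

Let P0 : 0 <= P. Proof. exact: le_trans (p0 0%N) (pP 0%N). Qed.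
Let E_gt0 : 0 < E. Proof. exact: eps_gt0. Qed.
Let sigma_gt0 : 0 < sigma. Proof. by rewrite sqrtr_gt0; apply: eps_gt0. Qed.
Let sigma2 : sigma ^+ 2 = E. Proof. by rewrite sqr_sqrtr// ltW//; apply: eps_gt0. Qed.
Let kappa_gt0 : 0 < kappa. Proof. by rewrite sqrtr_gt0 divr_gt0. Qed.
Let kappa2 : kappa ^+ 2 = 2 / a. Proof. by rewrite sqr_sqrtr// divr_ge0// ltW. Qed.
Let alpha_ge0 : 0 <= alpha.
Proof. by rewrite divr_ge0 ?rnorm_ge0// exprn_ge0// invr_ge0. Qed.

Let alphaE : rnorm (W (4^-1 ^+ k) (phi k) - phi k) = 4^-1 ^+ k * alpha.
Proof. by rewrite /alpha mulrC divfK// expf_neq0// invr_eq0 pnatr_eq0. Qed.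

(** The sum of the coefficients of [p k], [E] and [sigma * alpha] in the bounds [t1] and [t2] that
    end the proof of [interval_step]. *)
Let C1 := a^-1 + 2 * b * (b + P) / a ^+ 2 + (1 + b / a) * kappa.

Let four_eps : 4^-1 ^+ k = E ^+ 2.
Proof. by rewrite /E /eps -exprM mulnC exprM; congr (_ ^+ _); field. Qed.

Let F_diff s t : I s -> I t -> exists M1 M2, [/\ cop (a * s) (Mk k s) M1, cop (a * t) (Mk k t) M2 &
  F t - F s = (s - t)%:C * (z * inner (op_inv M2 (phi k)) (T k (op_inv (Mk k s) (phi k))))].
Proof.
move=> Is It.
have [M1 h1] := deform_cop (leqnn k) Is; have [M2 h2] := deform_cop (leqnn k) It.
exists M1, M2; split=> //; rewrite /F (resolvent_diff _ h1 h2).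
set u := op_inv _ _; rewrite -!innerZr; congr inner.
by rewrite /Mk /deform rmorphB/=; hring.
Qed.

Let interval_step Y : 1 <= Y -> (forall e, I e -> cn (F e) <= Y) ->
  forall e, I e -> cn (F e - F E) <= C1 * (p k + E + sigma * alpha) * Y.
Proof.
move: alphaE alpha_ge0; generalize alpha => al aE al0.
move=> Y1 hY e0 Ie0.
have Y0 : 0 <= Y by lra.
(* By the energy estimate and [s >= E / 2], [m] bounds the vectors obtained by inverting the
   deformed operator and its adjoint on [phi k]. The condition [1 <= Y] gives [Num.sqrt Y <= Y],
   which keeps the final bound linear in [Y]. *)
pose m := kappa * Num.sqrt Y / sigma.
have m0 : 0 <= m by rewrite !mulr_ge0 ?invr_ge0 ?sqrtr_ge0.
have m2 : m ^+ 2 = 2 * Y / (a * E).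
  by rewrite /m !exprMn kappa2 sqr_sqrtr// exprVn sigma2; field; rewrite (gt_eqF a0) (gt_eqF E_gt0).
have mY : m <= kappa / sigma * Y.
  rewrite /m mulrAC ler_wpM2l ?divr_ge0 ?(ltW kappa_gt0) ?(ltW sigma_gt0)//.
  have := sqrtr_ge0 Y; have := sqr_sqrtr Y0; nra.
clearbody m.
have Ige s : I s -> E / 2 <= s <= E by rewrite /I epsS.
have Ispos s : I s -> 0 < s by move=> /Ige/andP[+ _]; apply: lt_le_trans; rewrite divr_gt0.
have um s M1 : I s -> cop (a * s) (Mk k s) M1 ->
    rnorm (op_inv (Mk k s) (phi k)) <= m /\ rnorm (op_inv M1 (phi k)) <= m.
  move=> Is hc; have le_m x : a * s * rnorm x ^+ 2 <= cn (F s) -> rnorm x <= m.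
    move=> hx; rewrite -(@ler_pXn2r _ 2)// ?nnegrE ?rnorm_ge0// m2 ler_pdivlMr ?mulr_gt0//.
    have := hY s Is; have /andP[s1 s2] := Ige s Is; have x2 := sqr_ge0 (rnorm x).
    have : a * (E / 2) * rnorm x ^+ 2 <= a * s * rnorm x ^+ 2.
      by rewrite ler_wpM2r// ler_wpM2l// ltW.
    lra.
  by split; apply: le_m; [exact: energy_le hc|exact: energy_le' hc].
(* The bound of [commutator_bound] after two simplifications: [s * (2^k * p k) <= p k], and
   [eta / (a * s) <= 2 * E / a] because [eta = E^2]. *)
pose L := p k * m ^+ 2 + 2 * al * m + b * m * (2 * E / a * (al + (b + p k) * m)).
have bpk : 0 <= b + p k by rewrite addr_ge0.
have L0 : 0 <= L.
  rewrite /L !addr_ge0 ?mulr_ge0 ?sqr_ge0// ?addr_ge0 ?mulr_ge0// ?invr_ge0// ltW//.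
have key s M1 : I s -> cop (a * s) (Mk k s) M1 ->
    cn (z * inner (op_inv M1 (phi k)) (T k (op_inv (Mk k s) (phi k)))) <= L.
  move=> Is hc; have [um1 vm1] := um s M1 Is hc.
  have /andP[s1 s2] := Ige s Is; have s0 := Ispos s Is.
  have [T' /adjp_linear linT] := adjT k.
  have rho0 : 0 <= 2 ^+ k * p k by rewrite mulr_ge0// exprn_ge0.
  have eta0 : 0 < 4^-1 ^+ k :> R by rewrite exprn_gt0// invr_gt0.
  apply: le_trans (commutator_bound gW eta0 (ltW s0) z1 hc linT (VT k) (bT k) (bR k) b0 rho0 um1 vm1) _.
  have srho : s * (2 ^+ k * p k) <= p k.
    rewrite mulrA ler_piMl//; apply: le_trans (_ : E * 2 ^+ k <= _).
      by rewrite ler_wpM2r// exprn_ge0.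
    by rewrite /E /eps -exprMn mulVf ?expr1n// pnatr_eq0.
  rewrite aE {1}(mulrC (4^-1 ^+ k)) mulfK ?(gt_eqF eta0)// /L.
  apply: lerD; first by rewrite lerD2r ler_wpM2r// sqr_ge0.
  rewrite ler_wpM2l ?mulr_ge0// ler_pdivrMr ?mulr_gt0//.
  rewrite -mulrDr four_eps.
  apply: le_trans (_ : E ^+ 2 * (al + (b + p k) * m) <= _).
    by rewrite ler_wpM2l ?sqr_ge0// lerD2l ler_wpM2r// lerD2l.
  have -> : 2 * E / a * (al + (b + p k) * m) * (a * s) =
      2 * E * s * (al + (b + p k) * m) by field; rewrite gt_eqF.
  rewrite ler_wpM2r ?addr_ge0 ?mulr_ge0//.
  rewrite expr2; have := eps_gt0 k; rewrite -/E => Ep.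
  have : E * (E / 2) <= E * s by rewrite ler_wpM2l// ltW.
  lra.
(* Bounds the second-order part of the increments of [F]. It contains [E^-2], but [mean_value]
   eliminates it. *)
pose K := rnorm (phi k) * ((2 / (a * E)) ^+ 2 * b * (b * m)).
have K0 : 0 <= K.
  by rewrite !mulr_ge0 ?rnorm_ge0 ?invr_ge0 ?mulr_ge0 ?(ltW a0) ?(ltW E_gt0).
have /andP[e01 e02] := Ie0.
have -> : cn (F e0 - F E) = cn (F E - F e0) by rewrite -cnN opprB.
have IE : I E by rewrite /I lexx andbT epsS /E; have := eps_gt0 k; lra.
apply: le_trans (_ : L * (E - e0) <= _).
  apply: (@mean_value _ F e0 E L K) => // s t /andP[s1 s2] /andP[t1 t2].
  have Is : I s by rewrite /I s2 (le_trans e01 s1).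
  have It : I t by rewrite /I t2 (le_trans e01 t1).
  have [M1 [M2 [h1 h2 ->]]] := F_diff Is It.
  rewrite cnM cnR.
  have -> : L * `|t - s| + K * `|t - s| ^+ 2 = `|s - t| * (L + K * `|s - t|).
    by rewrite (distrC t s); ring.
  rewrite ler_wpM2l//.
  set y := T k _.
  have -> : z * inner (op_inv M2 (phi k)) y = z * inner (op_inv M1 (phi k)) y +
      z * (inner (op_inv M2 (phi k)) y - inner (op_inv M1 (phi k)) y) by ring.
  apply: le_trans (cnD _ _) _; apply: lerD; first exact: key h1.
  rewrite cnM; apply: le_trans (ler_piMl (cn_ge0 _) z1) _.
  rewrite (op_inv_swap _ _ h1) (op_inv_swap _ _ h2) -innerBr.
  apply: le_trans (cauchy_schwarz _ _) _; rewrite /K -mulrA ler_wpM2l ?rnorm_ge0//.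
  have -> : op_inv (Mk k t) y - op_inv (Mk k s) y =
     op_inv (Mk k t) ((z * (s - t)%:C) *: T k (op_inv (Mk k s) y)).
    rewrite -[X in _ - X](op_invKV _ h2) -(lopB (op_inv_linear h2)); congr (op_inv _ _).
    rewrite -{1}(op_invK y h1) /Mk /deform rmorphB/=; hring.
  have ym : rnorm y <= b * m.
    by apply: le_trans (bT _ _) _; rewrite ler_wpM2l//; case: (um s M1 Is h1).
  have lbi s' : I s' -> (a * s')^-1 <= 2 / (a * E).
    move=> Is'; have /andP[s1' _] := Ige _ Is'.
    have sp := Ispos _ Is'; have aE0 : 0 < a * E by rewrite mulr_gt0.
    rewrite -[leRHS]invrK lef_pV2 ?posrE ?mulr_gt0// ?invr_gt0 ?divr_gt0//.
    by rewrite invf_div -mulrA ler_wpM2l// ltW.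
  apply: le_trans (op_inv_le _ h2) _; rewrite rnormZ cnM cnR.
  have Qy : rnorm (T k (op_inv (Mk k s) y)) <= b * (2 / (a * E) * (b * m)).
    apply: le_trans (bT _ _) _; rewrite ler_wpM2l//.
    apply: le_trans (op_inv_le _ h1) _; rewrite mulrC; apply: ler_pM; rewrite ?rnorm_ge0//.
      by rewrite invr_ge0 mulr_ge0 ?(ltW a0) ?(ltW (Ispos _ Is)).
    exact: lbi.
  have -> : (2 / (a * E)) ^+ 2 * b * (b * m) * `|s - t| =
     (1 * `|s - t|) * (b * (2 / (a * E) * (b * m))) * (2 / (a * E)) by ring.
  apply: ler_pM; rewrite ?mulr_ge0 ?rnorm_ge0 ?cn_ge0//.
  - by rewrite invr_ge0 mulr_ge0 ?(ltW a0) ?(ltW (Ispos _ It)).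
  - apply: ler_pM; rewrite ?mulr_ge0 ?rnorm_ge0 ?cn_ge0// ler_wpM2r//.
  - exact: lbi.
apply: le_trans (_ : L * (E / 2) <= _).
  by rewrite ler_wpM2l//; move: e01; rewrite epsS -/E; lra.
pose x1 := p k + 2 * b * E * (b + p k) / a.
(* The interval has length [E / 2]; this cancels the negative powers of [E], since
   [m^2 * (E / 2) = Y / a] and [E * m] is of order [sigma * Y]. *)
have -> : L * (E / 2) = (a^-1 * x1) * Y + (1 + b * E / a) * al * (E * m).
  have -> : L * (E / 2) = x1 * (m ^+ 2 * (E / 2)) + (1 + b * E / a) * al * (E * m).
    by rewrite /L /x1; field; rewrite gt_eqF.
  by rewrite m2; congr (_ + _); field; rewrite !gt_eqF.
have Em : E * m <= kappa * sigma * Y.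
  apply: le_trans (_ : E * (kappa / sigma * Y) <= _); first by rewrite ler_wpM2l// ltW.
  by rewrite -sigma2 le_eqVlt; apply/orP; left; apply/eqP; field; rewrite gt_eqF.
have E0 : 0 <= E by rewrite ltW.
have E1 : E <= 1 := eps_le1 k.
have ai : 0 < a^-1 by rewrite invr_gt0.
have ab0 : 0 <= b / a by rewrite divr_ge0// ltW.
have t2 : (1 + b * E / a) * al * (E * m) <= (1 + b / a) * kappa * (sigma * al) * Y.
  apply: le_trans (_ : (1 + b / a) * al * (kappa * sigma * Y) <= _); last first.
    by rewrite le_eqVlt; apply/orP; left; apply/eqP; ring.
  apply: ler_pM => //; rewrite ?mulr_ge0 ?addr_ge0 ?divr_ge0 ?mulr_ge0 ?(ltW a0)//.
  by rewrite ler_wpM2r// lerD2l mulrAC ler_piMr.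
have t1 : a^-1 * x1 <= a^-1 * p k + 2 * b * (b + P) / a ^+ 2 * E.
  rewrite /x1 mulrDr lerD2l.
  have -> : a^-1 * (2 * b * E * (b + p k) / a) = 2 * b / a ^+ 2 * E * (b + p k).
    by field; rewrite gt_eqF.
  have -> : 2 * b * (b + P) / a ^+ 2 * E = 2 * b / a ^+ 2 * E * (b + P) by ring.
  by rewrite ler_wpM2l ?mulr_ge0 ?invr_ge0 ?sqr_ge0// lerD2l.
apply: le_trans (lerD (ler_wpM2r Y0 t1) t2) _.
rewrite -mulrDl ler_wpM2r//.
have u1 : 0 <= 2 * b * (b + P) / a ^+ 2.
  by rewrite !mulr_ge0 ?invr_ge0 ?sqr_ge0// addr_ge0.
have u2 : 0 <= (1 + b / a) * kappa by rewrite mulr_ge0 ?addr_ge0 ?(ltW kappa_gt0).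
have u3 : 0 <= sigma * al by rewrite mulr_ge0 ?(ltW sigma_gt0).
have u0 := ltW ai; have pk := p0 k.
rewrite /C1; move: u0 u1 u2 u3 pk E0.
set A0 := a^-1; set A1 := 2 * b * (b + P) / _; set A2 := (_ * kappa); set sa := sigma * al.
move=> h1 h2 h3 h4 h5 h6.
have := mulr_ge0 h1 h6; have := mulr_ge0 h1 h4; have := mulr_ge0 h2 h5.
have := mulr_ge0 h2 h4; have := mulr_ge0 h3 h5; have := mulr_ge0 h3 h6.
lra.
Qed.

Let d := 2 * p k + p k.+1 + q k.
Let rk := p k + p k.+1 + q k + E + sigma * alpha + delta / sigma.
(** One term for each of the three moves of [dyadic_step]. The factors 8 and 16 include the growth
    of [1 + cn F], by at most 2 after the first move and 4 after the second. *)
Definition step_const : R := 2 * C1 + 8 / a + 16 * kappa.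

(** Three moves: [e] goes from [eps k] to [eps k.+1] with [V k], [T k], [phi k] fixed; [V] and [T]
    pass to the index [k.+1]; [phi] does. The smallness hypothesis lets each move absorb the energy
    at its own end point. *)
Lemma dyadic_step : step_const * rk <= 1 ->
  cn (energy (Mk k.+1 (eps k.+1)) (phi k.+1) - energy (Mk k (eps k)) (phi k))
  <= step_const * rk * (1 + cn (energy (Mk k (eps k)) (phi k))).
Proof.
move=> hr.
have sg := sigma_gt0; have kg := kappa_gt0; have al := alpha_ge0.
have delta0 : 0 <= delta := rnorm_ge0 _.
have E0 : 0 < E := eps_gt0 k.
have sa0 : 0 <= sigma * alpha by rewrite mulr_ge0// ltW.
have ds0 : 0 <= delta / sigma by rewrite divr_ge0// ltW.
have pk := p0 k; have pk1 := p0 k.+1; have qk := q0.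
have ai : 0 < a^-1 by rewrite invr_gt0.
have C10 : 0 <= C1.
  have u1 : 0 <= 2 * b * (b + P) / a ^+ 2.
    by rewrite !mulr_ge0 ?invr_ge0 ?sqr_ge0// addr_ge0.
  have u2 : 0 <= (1 + b / a) * kappa.
    by rewrite mulr_ge0 ?addr_ge0 ?(ltW kg) ?divr_ge0 ?(ltW a0).
  by rewrite /C1 addr_ge0// addr_ge0// ltW.
have rk0 : 0 <= rk by rewrite /rk; lra.
have b1 : C1 * rk <= 2^-1.
  have : 0 <= (8 / a + 16 * kappa) * rk by rewrite mulr_ge0// addr_ge0// mulr_ge0// ltW.
  by move: hr; rewrite /step_const; lra.
have b2 : a^-1 * rk <= 8^-1.
  have : 0 <= (2 * C1 + 16 * kappa) * rk by rewrite mulr_ge0// addr_ge0// mulr_ge0// ltW.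
  by move: hr; rewrite /step_const; lra.
have b3 : kappa * rk <= 16^-1.
  have : 0 <= (2 * C1 + 8 / a) * rk by rewrite mulr_ge0// addr_ge0// mulr_ge0// ltW.
  by move: hr; rewrite /step_const; lra.
set F0 := energy (Mk k (eps k)) _; set F3 := energy (Mk k.+1 _) (phi k.+1).
pose F1 := F (eps k.+1); pose F2 := energy (Mk k.+1 (eps k.+1)) (phi k).
have kk1 : eps k.+1 <= eps k by rewrite epsS; move: E0; rewrite /E; lra.
have I1 : I (eps k.+1) by rewrite /I lexx.
have J1 : eps k.+2 <= eps k.+1 <= eps k.+1.
  by rewrite lexx andbT (epsS k.+1); have := eps_gt0 k.+1; lra.
have [M1 h1] := deform_cop (leqnn k) I1.
have [M2 h2] := deform_cop (leqnSn k) J1.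
have st1 : cn (F1 - F0) <= 2 * (C1 * rk) * (1 + cn F0).
  pose s := C1 * (p k + E + sigma * alpha).
  have sC : s <= C1 * rk.
    by rewrite /s ler_wpM2l// /rk; lra.
  have s0 : 0 <= s by rewrite mulr_ge0//; lra.
  (* The a priori bound is the crude one that coercivity gives on the interval; it blows up with
     [k], but the conclusion does not depend on it. *)
  have := @self_improvement R R I F F0 s (rnorm (phi k) ^+ 2 / (a * (E / 2))) s0 _ _ _ (eps k.+1) I1.
  move=> hh; apply: le_trans (hh _ _ _) _.
  - exact: le_trans sC b1.
  - move=> e Ie; have [M' h] := deform_cop (leqnn k) Ie.
    rewrite /F /energy; apply: le_trans (cauchy_schwarz _ _) _.
    rewrite expr2 -mulrA ler_wpM2l ?rnorm_ge0//; apply: le_trans (op_inv_le _ h) _.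
    move: Ie; rewrite /I epsS -/E => /andP[e1 _].
    have e0 : 0 < e by apply: lt_le_trans e1; rewrite divr_gt0.
    rewrite ler_wpM2l ?rnorm_ge0// lef_pV2 ?posrE ?mulr_gt0 ?divr_gt0//.
    by rewrite ler_wpM2l// ltW.
  - by move=> Y Y1 hY t It; apply: interval_step.
  by rewrite ler_wpM2r ?addr_ge0 ?cn_ge0//; lra.
have half_pos : 0 < a * eps k.+1 by rewrite mulr_gt0.
have amgm (c x y fx fy : R) : 0 < c -> 0 <= x -> 0 <= y -> c * x ^+ 2 <= fx -> c * y ^+ 2 <= fy ->
   c * (x * y) <= (fx + fy) / 2.
  move=> c0 x0 y0 hx hy; have : 0 <= c * (x - y) ^+ 2 by rewrite mulr_ge0 ?sqr_ge0// ltW.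
  rewrite sqrrB; lra.
have st2 : cn (F2 - F1) <= 4 * (a^-1 * rk) * (1 + cn F1).
  rewrite /F2 /F1 /F (resolvent_diff _ h1 h2).
  set u := op_inv (Mk k (eps k.+1)) _; set v := op_inv M2 _.
  (* The factor 2 in [d] comes from [2^-k = 2 * eps k.+1]. The common factor [eps k.+1] is then
     cancelled by the product of the two inverses, each of order [eps k.+1 ^ (-1/2)]. *)
  have D1 : rnorm (Mk k (eps k.+1) u - Mk k.+1 (eps k.+1) u) <= eps k.+1 * d * rnorm u.
    have -> : Mk k (eps k.+1) u - Mk k.+1 (eps k.+1) u =
      z *: ((V k.+1 u - U u) - (V k u - U u) - (eps k.+1)%:C *: (T k.+1 u - T k u)).
      by rewrite /Mk /deform; hring.
    rewrite rnormZ; apply: le_trans (ler_piMl (rnorm_ge0 _) z1) _.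
    apply: le_trans (rnormB _ _) _; rewrite rnormZ cnR (gtr0_norm (eps_gt0 _)).
    apply: le_trans (lerD (rnormB _ _) (lexx _)) _.
    have v1 := bV k.+1 u; have v2 := bV k u.
    have v3 : eps k.+1 * rnorm (T k.+1 u - T k u) <= eps k.+1 * (q k * rnorm u).
      by rewrite ler_wpM2l ?bTd// ltW.
    apply: le_trans (lerD (lerD v1 v2) v3) _.
    have -> : 2^-1 ^+ k = 2 * eps k.+1 by rewrite epsS mulrC divfK.
    rewrite -/(eps k.+1) /d; lra.
  have u2 := energy_le (phi k) h1; have v2 := energy_le' (phi k) h2.
  have uv := amgm _ _ _ _ _ half_pos (rnorm_ge0 _) (rnorm_ge0 _) u2 v2.
  set X := cn (energy (Mk k _) _) in u2 uv *; set Y := cn (energy (Mk k.+1 _) _) in v2 uv.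
  set Z := cn (inner _ _).
  have Zle : Z <= d / a * ((X + Y) / 2).
    apply: le_trans (cauchy_schwarz _ _) _.
    apply: le_trans (ler_wpM2l (rnorm_ge0 _) D1) _.
    have -> : rnorm v * (eps k.+1 * d * rnorm u) = d / a * (a * eps k.+1 * (rnorm u * rnorm v)).
      by field; rewrite gt_eqF.
    by rewrite ler_wpM2l// divr_ge0 ?(ltW a0)// /d; lra.
  (* The new energy [Y] occurs in its own estimate; it is absorbed because [d / a <= 1/4]. *)
  have YX : Y <= X + Z.
    rewrite /Z /v -(resolvent_diff _ h1 h2) addrC; apply: le_trans (cnD _ _).
    by rewrite subrK.
  have da : d / a <= 2 * (a^-1 * rk).
    rewrite mulrC mulrCA ler_wpM2l ?(ltW ai)// /d /rk; lra.
  have X0 : 0 <= X := cn_ge0 _. have Z0 : 0 <= Z := cn_ge0 _.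
  have da0 : 0 <= d / a by rewrite divr_ge0 ?(ltW a0)// /d; lra.
  have w1 : d / a * ((X + Y) / 2) <= d / a * (X + Z / 2) by rewrite ler_wpM2l//; lra.
  have w2 : d / a * (Z / 2) <= 4^-1 * (Z / 2) by rewrite ler_wpM2r ?divr_ge0//; lra.
  have w3 : d / a * X <= 2 * (a^-1 * rk) * X by rewrite ler_wpM2r.
  have w4 : 0 <= a^-1 * rk by rewrite mulr_ge0// ltW.
  have w5 : 0 <= a^-1 * rk * X by rewrite mulr_ge0.
  lra.
have st3 : cn (F3 - F2) <= 4 * (kappa * rk) * (1 + cn F2).
  have -> : F3 - F2 = inner (phi k.+1 - phi k) (op_inv (Mk k.+1 (eps k.+1)) (phi k.+1))
     + inner (op_inv M2 (phi k)) (phi k.+1 - phi k).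
    rewrite innerBl innerBr (op_inv_swap _ (phi k.+1) h2) (op_inv_swap _ (phi k) h2).
    by rewrite /F3 /F2 /energy addrA subrK.
  have u2 := energy_le (phi k.+1) h2; have v2 := energy_le' (phi k) h2.
  rewrite -/F3 in u2; rewrite -/F2 in v2.
  set u := op_inv _ _ in u2 *; set v := op_inv _ _ in v2 *.
  (* The square root in the energy estimate is linearized by [4 * cn f <= (1 + cn f)^2]; here
     [(kappa / sigma)^2] is the inverse of [a * eps k.+1]. *)
  have sq (x : H) f : a * eps k.+1 * rnorm x ^+ 2 <= cn f -> rnorm x <= kappa / sigma * ((1 + cn f) / 2).
    move=> hx; have f0 := cn_ge0 f.
    have ks : 0 <= kappa / sigma by rewrite divr_ge0// ltW.
    rewrite -(@ler_pXn2r _ 2)// ?nnegrE ?rnorm_ge0//; last first.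
      by rewrite mulr_ge0// divr_ge0// addr_ge0.
    rewrite exprMn (expr_div_n kappa) kappa2 sigma2 (_ : 2 / a / E = (a * eps k.+1)^-1); last first.
      by rewrite epsS -/E; field; rewrite !gt_eqF.
    rewrite mulrC ler_pdivlMr// mulrC; apply: le_trans hx _.
    have := sqr_ge0 (1 - cn f); rewrite exprMn sqrrB sqrrD expr1n exprVn.
    have -> : (2 : R) ^+ 2 = 4 by ring.
    lra.
  have u3 := sq _ _ u2; have v3 := sq _ _ v2.
  set Z := cn (_ + _).
  have beta : kappa / sigma * delta <= kappa * rk.
    rewrite -mulrA ler_wpM2l ?(ltW kg)// (mulrC _ delta) /rk; lra.
  have Zle : Z <= kappa * rk * ((1 + cn F3) / 2 + (1 + cn F2) / 2).
    apply: le_trans (cnD _ _) _.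
    apply: le_trans (lerD (cauchy_schwarz _ _) (cauchy_schwarz _ _)) _; rewrite -/delta.
    rewrite (mulrC delta) -mulrDl mulrC.
    apply: le_trans (_ : delta * (kappa / sigma * ((1 + cn F3) / 2 + (1 + cn F2) / 2)) <= _).
      by rewrite ler_wpM2l// mulrDr; apply: lerD.
    rewrite mulrA (mulrC delta) ler_wpM2r//.
    by have := cn_ge0 F3; have := cn_ge0 F2; lra.
  have F32 : cn F3 <= cn F2 + Z.
    have -> : Z = cn (F3 - F2).
      rewrite /Z; congr cn.
      rewrite innerBl innerBr /u /v (op_inv_swap _ (phi k.+1) h2) (op_inv_swap _ (phi k) h2).
      by rewrite /F3 /F2 /energy addrA subrK.
    by rewrite addrC; apply: le_trans (cnD _ _); rewrite subrK.
  have kr0 : 0 <= kappa * rk by rewrite mulr_ge0// ltW.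
  have Z0 : 0 <= Z := cn_ge0 _. have f20 := cn_ge0 F2.
  have w1 : kappa * rk * ((1 + cn F3) / 2 + (1 + cn F2) / 2) <= kappa * rk * ((1 + cn F2) + Z / 2).
    by rewrite ler_wpM2l//; lra.
  have w2 : kappa * rk * (Z / 2) <= 16^-1 * (Z / 2) by rewrite ler_wpM2r ?divr_ge0.
  have w3 : 0 <= kappa * rk * (1 + cn F2) by rewrite mulr_ge0// addr_ge0.
  lra.
have y0 := cn_ge0 F0.
have y1 : cn F1 <= cn F0 + cn (F1 - F0).
  by rewrite addrC; apply: le_trans (cnD _ _); rewrite subrK.
have y2 : cn F2 <= cn F1 + cn (F2 - F1).
  by rewrite addrC; apply: le_trans (cnD _ _); rewrite subrK.
have -> : F3 - F0 = (F3 - F2) + (F2 - F1) + (F1 - F0) by ring.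
apply: le_trans (cnD _ _) _; apply: le_trans (lerD (cnD _ _) (lexx _)) _.
set x1 := C1 * rk in b1 st1; set x2 := a^-1 * rk in b2 st2; set x3 := kappa * rk in b3 st3.
have x10 : 0 <= x1 by rewrite mulr_ge0.
have x20 : 0 <= x2 by rewrite mulr_ge0// ltW.
have x30 : 0 <= x3 by rewrite mulr_ge0// ltW.
have Y0 : 0 <= 1 + cn F0 by lra.
have z1' : 1 + cn F1 <= 2 * (1 + cn F0).
  have : x1 * (1 + cn F0) <= 2^-1 * (1 + cn F0) by rewrite ler_wpM2r.
  lra.
have z2' : 1 + cn F2 <= 4 * (1 + cn F0).
  have : x2 * (1 + cn F1) <= 8^-1 * (1 + cn F1) by rewrite ler_wpM2r// addr_ge0 ?cn_ge0.
  lra.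
have q2 : x2 * (1 + cn F1) <= x2 * (2 * (1 + cn F0)) by rewrite ler_wpM2l.
have q3 : x3 * (1 + cn F2) <= x3 * (4 * (1 + cn F0)) by rewrite ler_wpM2l.
have -> : step_const * rk = 2 * x1 + 8 * x2 + 16 * x3 by rewrite /step_const /x1 /x2 /x3; ring.
lra.
Qed.

End DyadicStep.

(** * Limiting absorption principle *)

Definition summable_seq {R : realType} (p : nat -> R) :=
  (forall k, 0 <= p k) /\ exists S : R, forall n, \sum_(k < n) p k <= S.

Section SummableSequences.
Context {R : realType}.
Implicit Types p q : nat -> R.

Lemma summable_seqD p q : summable_seq p -> summable_seq q ->
  summable_seq (fun k => p k + q k).
Proof.
case=> p0 [S hS] [q0 [S' hS']]; split; first by move=> k; rewrite addr_ge0.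
exists (S + S') => n; by rewrite big_split/=; apply: lerD; [exact: hS|exact: hS'].
Qed.

Lemma summable_seqZ c p : 0 <= c -> summable_seq p -> summable_seq (fun k => c * p k).
Proof.
move=> c0 [p0 [S hS]]; split; first by move=> k; rewrite mulr_ge0.
by exists (c * S) => n; rewrite -mulr_sumr ler_wpM2l.
Qed.

Lemma summable_seqS p : summable_seq p -> summable_seq (fun k => p k.+1).
Proof.
move=> [p0 [S hS]]; split; first by move=> k.
exists S => n; apply: le_trans (hS n.+1); by rewrite big_ord_recl ler_wpDl.
Qed.

Lemma summable_seq_le p q : summable_seq q -> (forall k, 0 <= p k <= q k) -> summable_seq p.
Proof.
move=> [q0 [S hS]] h; split; first by move=> k; case/andP: (h k).
by exists S => n; apply: le_trans (hS n); apply: ler_sum => i _; case/andP: (h i).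
Qed.

Lemma summable_geo (r : R) : 0 <= r < 1 -> summable_seq (fun k => r ^+ k).
Proof.
move=> /andP[r0 r1]; split; first by move=> k; rewrite exprn_ge0.
have r1' : 0 < 1 - r by rewrite subr_gt0.
exists (1 - r)^-1; elim => [|n IH]; first by rewrite big_ord0 invr_ge0 ltW.
rewrite big_ord_recl/= expr0.
have -> : \sum_(i < n) r ^+ (bump 0 i) = r * \sum_(i < n) r ^+ i.
  by rewrite mulr_sumr; apply: eq_bigr => i _; rewrite /bump/= add1n exprS.
apply: le_trans (lerD (lexx _) (ler_wpM2l r0 IH)) _.
by rewrite le_eqVlt; apply/orP; left; apply/eqP; field; rewrite gt_eqF.
Qed.

Lemma summable_geometric : summable_seq (fun k => 2^-1 ^+ k : R).
Proof. by apply: summable_geo; rewrite invr_ge0 ler0n invf_lt1// ltr1n. Qed.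

Lemma summable_tail p : summable_seq p -> forall e, 0 < e ->
  exists N, forall m n, (N <= m)%N -> \sum_(m <= k < n) p k <= e.
Proof.
move=> [p0 [S hS]] e e0.
pose A := [set \sum_(k < n) p k | n in [set: nat]].
have supA : has_sup A.
  by split; [exists (\sum_(k < 0) p k), 0%N|exists S => _ [n _ <-]].
have [_ [N _ <-] hN] := sup_adherent e0 supA.
exists N => m n Nm; have [nm|mn] := leqP n m.
  by rewrite big_geq// ltW.
have h1 : \sum_(k < n) p k <= sup A.
  by apply: ub_le_sup => //; [case: supA|exists n].
have h2 : \sum_(k < n) p k = \sum_(0 <= k < N) p k + \sum_(N <= k < m) p k + \sum_(m <= k < n) p k.
  by rewrite -!big_cat_nat ?big_mkord// ?(leq_trans Nm)// ltnW.
have h3 : 0 <= \sum_(N <= k < m) p k by apply: sumr_ge0.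
rewrite big_mkord in h2; move: hN h1; rewrite h2; lra.
Qed.

Lemma summable_cvg0 p : summable_seq p -> forall e, 0 < e ->
  exists N, forall n, (N <= n)%N -> p n <= e.
Proof.
move=> sp e e0; have [N hN] := summable_tail sp e0.
by exists N => n Nn; have := hN n n.+1 Nn; rewrite big_nat1.
Qed.

Lemma summable_bounded p : summable_seq p -> exists P : R, forall k, p k <= P.
Proof.
move=> [p0 [S hS]]; exists S => k; apply: le_trans (hS k.+1).
by rewrite big_ord_recr/= lerDr; apply: sumr_ge0.
Qed.

(** As long as [S <= 1/2] one has [(1 + x) * (1 + 2 * S) <= 1 + 2 * (S + x)], so a linear factor
    takes the place of the usual exponential. *)
Lemma gronwall (f r : nat -> R) m : (forall k, 0 <= r k) -> 0 <= f m ->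
  (forall n, \sum_(m <= k < n) r k <= 2^-1) ->
  (forall k, (m <= k)%N -> f k.+1 <= f k + r k * f k) ->
  forall n, (m <= n)%N -> f n <= 2 * f m.
Proof.
move=> r0 fm hr hf n mn; have {mn} [d ->] : exists d, n = (m + d)%N.
  by exists (n - m)%N; rewrite subnKC.
suff h : f (m + d)%N <= f m * (1 + 2 * \sum_(m <= k < m + d) r k).
  apply: le_trans h _; rewrite mulrC ler_wpM2r//; have := hr (m + d)%N; lra.
elim: d => [|d IH]; first by rewrite addn0 big_geq// mulr0 addr0 mulr1.
rewrite addnS big_nat_recr ?leq_addr//=.
set x := r (m + d)%N; set S := \sum_(m <= k < _) _ in IH *.
apply: le_trans (hf _ (leq_addr _ _)) _; rewrite -/x.
have x0 : 0 <= x := r0 _.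
have S0 : 0 <= S by apply: sumr_ge0.
have S2 : S <= 2^-1 := hr _.
have h1 : x * f (m + d)%N <= x * (f m * (1 + 2 * S)) by rewrite ler_wpM2l.
have h2 : x * f m * (2 * S) <= x * f m * 1.
  by rewrite ler_wpM2l ?mulr_ge0//; lra.
lra.
Qed.

End SummableSequences.

Section LimitingAbsorption.
Context {R : realType} {H : hilbertType R}.
Variables (W : R -> H -> H) (U Us : H -> H) (V T : nat -> H -> H).
Variables (p q : nat -> R) (a b : R) (Z : R[i] -> Prop) (k0 : nat).
Hypothesis gW : ugroup W.
Hypothesis a0 : 0 < a.
Hypothesis b0 : 0 <= b.
Hypothesis Z1 : forall z, Z z -> cn z <= 1.
Hypothesis sp : summable_seq p.
Hypothesis sq : summable_seq q.
Hypothesis adjU : adjp U Us.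
Hypothesis bU : bnd 1 U.
Hypothesis adjV : forall k, exists V', adjp (V k) V'.
Hypothesis adjT : forall k, exists T', adjp (T k) T'.
Hypothesis bV : forall k, bnd (2^-1 ^+ k * p k) (fun x => V k x - U x).
Hypothesis VT : forall k, Wdiff W (V k) (4^-1 ^+ k) = T k.
Hypothesis bT : forall k, bnd b (T k).
Hypothesis bTd : forall k, bnd (q k) (fun x => T k.+1 x - T k x).
Hypothesis bR : forall k, bnd (2 ^+ k * p k) (Wdiff W (T k) (4^-1 ^+ k)).

Let eps n : R := 2^-1 ^+ n.

Hypothesis coe : forall z, Z z -> forall n e, (k0 <= n)%N -> eps n.+1 <= e <= eps n ->
  coercive (a * e) (deform z (V n) (T n) e).

Variable (phi : nat -> H) (phi0 : H).
Hypothesis sphi1 : summable_seq (fun k => Num.sqrt (eps k) *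
  (rnorm (W (4^-1 ^+ k) (phi k) - phi k) / 4^-1 ^+ k)).
Hypothesis sphi2 : summable_seq (fun k => rnorm (phi k.+1 - phi k) / Num.sqrt (eps k)).
Hypothesis phi_cvg : forall e, 0 < e -> exists N, forall n, (N <= n)%N -> rnorm (phi n - phi0) <= e.

Let p0 := sp.1.
Let bU' : exists b', bnd b' U. Proof. by exists 1. Qed.
Let eps_gt0 n : 0 < eps n. Proof. by rewrite exprn_gt0// invr_gt0. Qed.
Let linU : linear U. Proof. exact: adjp_linear adjU. Qed.
Let Iend n : eps n.+1 <= eps n <= eps n.
Proof. by rewrite lexx andbT /eps exprS; have := eps_gt0 n; rewrite /eps; lra. Qed.
Let Fk k z := energy (deform z (V k) (T k) (eps k)) (phi k).
Definition resolventU (z : R[i]) : H -> H := op_inv (fun x => x - z *: U x).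

Lemma one_sub_coercive z : coercive (1 - cn z) (fun x => x - z *: U x).
Proof.
move=> u; rewrite reBr re_rnorm mulrBl mul1r lerD2l lerN2.
apply: le_trans (re_le _ _) _; rewrite rnormZ mulrCA expr2 ler_wpM2l ?cn_ge0//.
by rewrite ler_wpM2l ?rnorm_ge0//; have := bU u; rewrite mul1r.
Qed.

Lemma one_sub_adjp z : adjp (fun x => x - z *: U x) (fun x => x - conjc z *: Us x).
Proof. by apply: adjpB => //; apply: adjpZ. Qed.

Lemma one_sub_cop z : cn z < 1 ->
  cop (1 - cn z) (fun x => x - z *: U x) (fun x => x - conjc z *: Us x).
Proof.
move=> z1; split; first by rewrite subr_gt0.
- exact: one_sub_adjp.
- exists (1 + cn z * 1); apply: bndB; last exact: bndZ.
  by move=> x; rewrite mul1r.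
- exact: one_sub_coercive.
Qed.

Let deform_err k z x : cn z <= 1 ->
  rnorm (deform z (V k) (T k) (eps k) x - (x - z *: U x)) <= eps k * (p k + b) * rnorm x.
Proof.
move=> z1.
have -> : deform z (V k) (T k) (eps k) x - (x - z *: U x) =
  - z *: ((V k x - U x) - (eps k)%:C *: T k x) by rewrite /deform; hring.
rewrite rnormZ cnN; apply: le_trans (ler_piMl (rnorm_ge0 _) z1) _.
apply: le_trans (rnormB _ _) _; rewrite mulrDr mulrDl; apply: lerD; first exact: bV.
by rewrite rnormZ cnR (gtr0_norm (eps_gt0 _)) -mulrA ler_wpM2l ?bT// ltW.
Qed.

Let eps_cvg0 e : 0 < e -> exists N, forall n, (N <= n)%N -> eps n <= e.
Proof. exact: (@summable_cvg0 R _ summable_geometric e). Qed.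

(** Strictly inside the disk [1 - z U] is coercive by itself, and the deformed operators, which are
    close to it in norm, inherit half of the constant. The rate depends on [z]; the lemma only
    identifies the limit. *)
Let Fk_cvg z : Z z -> cn z < 1 -> forall e, 0 < e ->
  exists N, forall n, (N <= n)%N -> cn (Fk n z - inner phi0 (resolventU z phi0)) <= e.
Proof.
move=> Zz z1 e e0.
pose g := (1 - cn z) / 2; have g0 : 0 < g by rewrite divr_gt0// subr_gt0.
have [P hP] := summable_bounded sp.
have P0 : 0 <= P := le_trans (p0 0%N) (hP 0%N).
have hU := one_sub_cop z1.
pose B := rnorm phi0 + 1; have B0 : 0 < B by rewrite /B ltr_wpDl ?rnorm_ge0.
have [N1 hN1] := @eps_cvg0 (g / (P + b + 1)) (divr_gt0 g0 (ltr_wpDl (addr_ge0 P0 b0) ltr01)).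
pose e1 := Num.min 1 (e / 3 * g / B).
have e10 : 0 < e1 by rewrite lt_min ltr01 !divr_gt0// mulr_gt0// divr_gt0.
have [N2 hN2] := phi_cvg e10.
(* Chosen so that the last product, [B / g] times [e3 * (P + b + 1) * (B / (1 - cn z))], equals
   [e / 3]. *)
pose e3 := e / 3 * g * (1 - cn z) / (B ^+ 2 * (P + b + 1)).
have Pb1 : 0 < P + b + 1 by rewrite ltr_wpDl// addr_ge0.
have z1' : 0 < 1 - cn z by rewrite subr_gt0.
have e30 : 0 < e3 by rewrite divr_gt0 ?mulr_gt0 ?divr_gt0 ?exprn_gt0.
have [N3 hN3] := eps_cvg0 e30.
exists (maxn (maxn N1 N2) (maxn N3 k0)) => n; rewrite !geq_max => /andP[/andP[n1 n2] /andP[n3 n4]].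
have [M' [M0 adjM bM _]] := deform_cop a0 adjV adjT bU' bV bT (coe Zz) n4 (Iend n).
pose M := deform z (V n) (T n) (eps n).
have hM : cop g M M'.
  split=> // u.
  have -> : M u = (u - z *: U u) + (M u - (u - z *: U u)) by rewrite addrC subrK.
  rewrite reDr; have h1 := one_sub_coercive z u.
  have h2 : `|re u (M u - (u - z *: U u))| <= g * rnorm u ^+ 2.
    apply: le_trans (cn_Re _) _; apply: le_trans (cauchy_schwarz _ _) _.
    rewrite mulrC; apply: le_trans (ler_wpM2r (rnorm_ge0 _) (deform_err n u (Z1 Zz))) _.
    have -> : eps n * (p n + b) * rnorm u * rnorm u = eps n * (p n + b) * rnorm u ^+ 2 by ring.
    rewrite ler_wpM2r ?sqr_ge0//.
    have := hN1 n n1; rewrite ler_pdivlMr//; apply: le_trans.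
    by rewrite ler_wpM2l ?(ltW (eps_gt0 _))//; have := hP n; lra.
  move: h2; rewrite ler_norml => /andP[h2 _].
  rewrite /g in h2 *; lra.
have d1 := hN2 n n2.
have phinB : rnorm (phi n) <= B.
  have := rnormD (phi n - phi0) phi0; rewrite subrK /B => h; apply: le_trans h _.
  have e11 : e1 <= 1 by rewrite ge_min lexx.
  lra.
have phi0B : rnorm phi0 <= B by rewrite /B; lra.
have d1' : rnorm (phi n - phi0) <= e / 3 * g / B by apply: le_trans d1 _; rewrite ge_min lexx orbT.
have -> : Fk n z - inner phi0 (resolventU z phi0) =
   inner (phi n - phi0) (op_inv M (phi n)) + inner phi0 (op_inv M (phi n - phi0)) +
   (energy M phi0 - energy (fun x => x - z *: U x) phi0).
  rewrite (lopB (op_inv_linear hM)) innerBl innerBr /energy /Fk /energy -/M /resolventU; ring.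
have -> : e = e / 3 + e / 3 + e / 3 by field.
apply: le_trans (cnD _ _) _; apply: lerD; first (apply: le_trans (cnD _ _) _; apply: lerD).
- apply: le_trans (cauchy_schwarz _ _) _.
  have -> : e / 3 = (e / 3 * g / B) * (B / g) by field; rewrite !gt_eqF.
  apply: ler_pM; rewrite ?rnorm_ge0//; apply: le_trans (op_inv_le _ hM) _.
  by rewrite ler_wpM2r// invr_ge0 ltW.
- apply: le_trans (cauchy_schwarz _ _) _.
  have -> : e / 3 = B * ((e / 3 * g / B) / g) by field; rewrite !gt_eqF.
  apply: ler_pM; rewrite ?rnorm_ge0//; apply: le_trans (op_inv_le _ hM) _.
  by rewrite ler_wpM2r// invr_ge0 ltW.
rewrite (resolvent_diff _ hU hM).
set u := op_inv (fun x => x - z *: U x) phi0.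
apply: le_trans (cauchy_schwarz _ _) _; rewrite rdistC.
have h1 : rnorm (op_inv M' phi0) <= B / g.
  by apply: le_trans (op_inv_le _ (copC hM)) _; rewrite ler_wpM2r// invr_ge0 ltW.
have h2 : rnorm u <= B / (1 - cn z).
  by apply: le_trans (op_inv_le _ hU) _; rewrite ler_wpM2r// invr_ge0 ltW.
have h3 : rnorm (M u - (u - z *: U u)) <= e3 * (P + b + 1) * (B / (1 - cn z)).
  apply: le_trans (deform_err n u (Z1 Zz)) _; apply: ler_pM => //.
  - by rewrite mulr_ge0 ?(ltW (eps_gt0 _))// addr_ge0.
  - exact: rnorm_ge0.
  - apply: ler_pM; rewrite ?(ltW (eps_gt0 _)) ?addr_ge0//; first exact: hN3.
    by have := hP n; lra.
apply: le_trans (ler_pM (rnorm_ge0 _) (rnorm_ge0 _) h1 h3) _.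
rewrite le_eqVlt; apply/orP; left; apply/eqP; rewrite /e3; field.
by rewrite !gt_eqF.
Qed.

(** At fixed [k] the inverses are bounded by [1 / (a * eps k)] on all of [Z], including its points
    on the circle. *)
Let Fk_lip k : (k0 <= k)%N -> exists2 K, 0 <= K & forall z z', Z z -> Z z' ->
  cn (Fk k z - Fk k z') <= K * cn (z - z').
Proof.
move=> kk.
have [P hP] := summable_bounded sp.
have P0 : 0 <= P := le_trans (p0 0%N) (hP 0%N).
pose c := a * eps k; have c0 : 0 < c by rewrite mulr_gt0.
pose K1 := eps k * P + 1 + eps k * b.
have K10 : 0 <= K1 by rewrite !addr_ge0 ?mulr_ge0 ?(ltW (eps_gt0 _)).
pose K := (rnorm (phi k) / c) * (K1 * (rnorm (phi k) / c)).
have pc : 0 <= rnorm (phi k) / c by rewrite divr_ge0 ?rnorm_ge0// ltW.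
exists K; first by rewrite /K mulr_ge0// mulr_ge0.
move=> z z' Zz Zz'.
have [M1 h1] := deform_cop a0 adjV adjT bU' bV bT (coe Zz) kk (Iend k).
have [M2 h2] := deform_cop a0 adjV adjT bU' bV bT (coe Zz') kk (Iend k).
rewrite -cnN opprB (resolvent_diff _ h1 h2).
set u := op_inv (deform z _ _ _) _.
apply: le_trans (cauchy_schwarz _ _) _.
have -> : K * cn (z - z') = (rnorm (phi k) / c) * (K1 * (rnorm (phi k) / c) * cn (z - z')).
  by rewrite /K !mulrA.
apply: ler_pM; rewrite ?rnorm_ge0//.
  exact: op_inv_le (copC h2).
have -> : deform z (V k) (T k) (eps k) u - deform z' (V k) (T k) (eps k) u =
   - (z - z') *: ((V k u - U u) + U u - (eps k)%:C *: T k u).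
  by rewrite /deform; hring.
rewrite rnormZ cnN mulrC ler_wpM2r ?cn_ge0//.
apply: le_trans (_ : K1 * rnorm u <= _); last by rewrite ler_wpM2l//; exact: op_inv_le h1.
apply: le_trans (rnormB _ _) _; rewrite /K1 mulrDl; apply: lerD; last first.
  by rewrite rnormZ cnR (gtr0_norm (eps_gt0 _)) -mulrA ler_wpM2l ?bT// ltW.
apply: le_trans (rnormD _ _) _; rewrite mulrDl; apply: lerD; last exact: bU.
apply: le_trans (bV _ _) _; rewrite ler_wpM2r ?rnorm_ge0// ler_wpM2l ?(ltW (eps_gt0 _))//.
Qed.

(** The point is the order of the quantifiers: all constants precede [z]. A tail of [C * r] below
    1/2 serves both the smallness hypothesis of [dyadic_step] and [gronwall]. *)
Let chain : exists m Y C (r : nat -> R), [/\ (k0 <= m)%N, 0 <= C, 0 <= Y, summable_seq r &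
  forall z, Z z -> (forall n, (m <= n)%N -> cn (Fk n z) <= Y) /\
    forall n n', (m <= n)%N -> (n <= n')%N ->
      cn (Fk n' z - Fk n z) <= C * \sum_(n <= k < n') r k].
Proof.
have [P hP] := summable_bounded sp.
pose r k := p k + p k.+1 + q k + eps k + Num.sqrt (eps k) *
  (rnorm (W (4^-1 ^+ k) (phi k) - phi k) / 4^-1 ^+ k) +
  rnorm (phi k.+1 - phi k) / Num.sqrt (eps k).
have sr : summable_seq r.
  apply: summable_seqD sphi2; apply: summable_seqD sphi1.
  apply: summable_seqD summable_geometric; apply: summable_seqD sq.
  by apply: summable_seqD => //; apply: summable_seqS.
have P0 : 0 <= P := le_trans (p0 0%N) (hP 0%N).
pose C := step_const a b P.
have C0 : 0 <= C.
  have ai : 0 <= a^-1 by rewrite invr_ge0 ltW.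
  have u1 : 0 <= 2 * b * (b + P) / a ^+ 2.
    by rewrite !mulr_ge0 ?invr_ge0 ?sqr_ge0// addr_ge0.
  have u2 : 0 <= (1 + b / a) * Num.sqrt (2 / a).
    by rewrite mulr_ge0 ?sqrtr_ge0// addr_ge0// mulr_ge0.
  have u3 := sqrtr_ge0 (2 / a).
  by rewrite /C /step_const; lra.
have sCr := summable_seqZ C0 sr.
have h20 : 0 < 2^-1 :> R by rewrite invr_gt0.
have [m hm] := summable_tail sCr h20.
pose m' := maxn m k0.
have mm : (m <= m')%N by rewrite leq_maxl.
have km : (k0 <= m')%N by rewrite leq_maxr.
(* The starting energy is bounded by the coercivity constant [a * eps m'] at the fixed index [m'],
   hence uniformly in [z]. *)
pose Y0 := 1 + rnorm (phi m') ^+ 2 / (a * eps m').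
have Y00 : 0 <= Y0 by rewrite /Y0 addr_ge0// divr_ge0 ?sqr_ge0// mulr_ge0 ?(ltW a0)// ltW.
exists m', (2 * Y0), (C * (2 * Y0)), r; split => //.
- by rewrite mulr_ge0// mulr_ge0.
- by rewrite mulr_ge0.
move=> z Zz.
have step k : (m' <= k)%N -> cn (Fk k.+1 z - Fk k z) <= C * r k * (1 + cn (Fk k z)).
  move=> mk.
  apply: (dyadic_step (U := U) (P := P)) => //.
  - exact: Z1.
  - exact: sq.1.
  - by move=> n e kn; apply: coe => //; apply: leq_trans kn; apply: leq_trans mk.
  apply: le_trans (_ : 2^-1 <= _); last by rewrite invf_le1// ler1n.
  by have := hm k k.+1 (leq_trans mm mk); rewrite big_nat1.
have gr n : (m' <= n)%N -> 1 + cn (Fk n z) <= 2 * (1 + cn (Fk m' z)).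
  apply: (@gronwall _ (fun n => 1 + cn (Fk n z)) (fun k => C * r k)) => //.
  - exact: sCr.1.
  - by rewrite addr_ge0// cn_ge0.
  - by move=> n'; apply: hm.
  - move=> k mk; have := step k mk; have := cnD (Fk k.+1 z - Fk k z) (Fk k z).
    by rewrite subrK; lra.
have FY : 1 + cn (Fk m' z) <= Y0.
  rewrite lerD2l /Fk /energy; apply: le_trans (cauchy_schwarz _ _) _.
  have [M1 h1] := deform_cop a0 adjV adjT bU' bV bT (coe Zz) km (Iend m').
  by rewrite expr2 -mulrA ler_wpM2l ?rnorm_ge0//; exact: op_inv_le h1.
split=> [n mn|n n' mn nn'].
  by have := gr n mn; lra.
elim: n' nn' => [|n' IH].
  by rewrite leqn0 => /eqP ->; rewrite subrr cn0 big_geq// mulr0.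
rewrite leq_eqVlt => /orP[/eqP ->|]; first by rewrite subrr cn0 big_geq// mulr0.
rewrite ltnS => nn'; rewrite big_nat_recr//= mulrDr.
have -> : Fk n'.+1 z - Fk n z = (Fk n' z - Fk n z) + (Fk n'.+1 z - Fk n' z) by ring.
apply: le_trans (cnD _ _) _; apply: lerD; first exact: IH.
have mn' := leq_trans mn nn'.
apply: le_trans (step _ mn') _.
have -> : C * (2 * Y0) * r n' = C * r n' * (2 * Y0) by ring.
rewrite ler_wpM2l ?sCr.1//; have := gr n' mn'; lra.
Qed.

(** For large fixed [k], [Fk k] is Lipschitz in [z] and uniformly close to the limit by [chain];
    this gives uniform continuity although [Fk_cvg] degenerates as [cn z] tends to 1. *)
Lemma limiting_absorption_diag :
  (exists Y, forall z, Z z -> cn z < 1 -> cn (inner phi0 (resolventU z phi0)) <= Y) /\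
  forall e, 0 < e -> exists2 d, 0 < d & forall z z', Z z -> Z z' -> cn z < 1 -> cn z' < 1 ->
    cn (z - z') < d ->
    cn (inner phi0 (resolventU z phi0) - inner phi0 (resolventU z' phi0)) <= e.
Proof.
have [m [Y [C [r [km C0 Y0 sr hm]]]]] := chain.
split.
  exists (Y + 1) => z Zz z1; have [N hN] := Fk_cvg Zz z1 ltr01.
  pose n := maxn m N.
  have h1 := hN n (leq_maxr _ _); rewrite -cnN opprB in h1.
  have := (hm z Zz).1 n (leq_maxl _ _).
  have := cnD (inner phi0 (resolventU z phi0) - Fk n z) (Fk n z); rewrite subrK; lra.
move=> e e0.
have Cp : 0 < C + 1 by lra.
have e6 : 0 < e / 6 / (C + 1) by rewrite !divr_gt0.
have [N hN] := summable_tail sr e6.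
pose k := maxn N m.
have kk : (k0 <= k)%N by rewrite (leq_trans km)// leq_maxr.
have app z : Z z -> cn z < 1 -> cn (inner phi0 (resolventU z phi0) - Fk k z) <= e / 3.
  move=> Zz z1; have e60 : 0 < e / 6 by rewrite divr_gt0.
  have [N' hN'] := Fk_cvg Zz z1 e60.
  pose n := maxn k N'.
  have h1 := hN' n (leq_maxr _ _).
  have h2 := (hm z Zz).2 k n (leq_maxr _ _) (leq_maxl _ _).
  have h3 := hN k n (leq_maxl _ _).
  have h4 : C * \sum_(k <= i < n) r i <= e / 6.
    apply: le_trans (_ : (C + 1) * (e / 6 / (C + 1)) <= _).
      by apply: ler_pM => //; [apply: sumr_ge0 => i _; apply: sr.1|lra].
    by rewrite mulrC divfK// gt_eqF.
  have -> : inner phi0 (resolventU z phi0) - Fk k z =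
    (Fk n z - Fk k z) - (Fk n z - inner phi0 (resolventU z phi0)) by ring.
  apply: le_trans (cnD _ _) _; rewrite cnN; lra.
have [K K0 hK] := Fk_lip kk.
have K1 : 0 < K + 1 by lra.
exists (e / 3 / (K + 1)); first by rewrite !divr_gt0.
move=> z z' Zz Zz' z1 z1' zz.
have h1 := app z Zz z1; have h2 := app z' Zz' z1'.
have h3 : cn (Fk k z - Fk k z') <= e / 3.
  apply: le_trans (hK _ _ Zz Zz') _.
  move: zz; rewrite ltr_pdivlMr// => zz; apply: ltW; apply: le_lt_trans zz.
  by rewrite mulrC ler_wpM2l ?cn_ge0//; lra.
have -> : inner phi0 (resolventU z phi0) - inner phi0 (resolventU z' phi0) =
   (inner phi0 (resolventU z phi0) - Fk k z) - (inner phi0 (resolventU z' phi0) - Fk k z')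
   + (Fk k z - Fk k z') by ring.
apply: le_trans (cnD _ _) _; apply: le_trans (lerD (cnD _ _) (lexx _)) _; rewrite cnN; lra.
Qed.

End LimitingAbsorption.

(** * Unitary groups, C^{1,1} regularity and interpolation *)

Section HypothesesTranslation.
Context {R : realType} {H : hilbertType R}.
Implicit Types (x y : H).

(** [adj U] is chosen with default [0]. Were there no adjoint, [adj U \o U = id] would make [H]
    trivial, where the claim holds anyway; this bypasses the Riesz theorem. *)
Lemma unitary_adjp (U : H -> H) : unitary U -> adjp U (adj U).
Proof.
move=> [_ UV _]; have [hB|hN] := pselect (exists B, adjp U B).
  exact: (xgetPex (P := [set B | adjp U B]) _ hB).
have adj0 : adj U = fun=> 0.
  by apply: xgetPN => B hB; apply: hN; exists B.
have z x : x = 0 by rewrite -[LHS]/(id x) -UV adj0.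
by move=> x y; rewrite (z x) !inner0l (z y) inner0r.
Qed.

Lemma unitary_iso (U : H -> H) x : unitary U -> rnorm (U x) = rnorm x.
Proof.
move=> uU; apply/eqP; rewrite -(@eqrXn2 _ 2)// ?rnorm_ge0//.
rewrite -!re_rnorm /re -(unitary_adjp uU); case: uU => _ h _.
by rewrite -[adj U (U x)]/((adj U \o U) x) h.
Qed.

Variables (A : partial_op H) (W : R -> H -> H).
Hypothesis WA : unitary_group A W.

Lemma unitary_group_ugroup : ugroup W.
Proof.
case: WA => uW W0 WD _ _; split => // t.
have e : adj (W t) = W (- t); last by rewrite -e; apply: unitary_adjp.
apply/funext => x; have [_ h _] := uW t.
have -> : x = W t (W (- t) x) by rewrite -[RHS]/((W t \o W (- t)) x) -WD subrr W0.
rewrite -[LHS]/((adj (W t) \o W t) (W (- t) x)) h/=.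
by rewrite -[W t _]/((W t \o W (- t)) x) -WD subrr W0.
Qed.

Let gW := unitary_group_ugroup.

Lemma generator_lim x : dom A x -> forall e, 0 < e -> exists2 d, 0 < d &
  forall t, `|t| < d -> rnorm (W t x - x - ('i%C * t%:C) *: A x) <= e * `|t|.
Proof.
case: WA => _ W0 _ _ gen Dx e e0.
have /(_ (conj Dx erefl)) := (gen x (A x)).1.
move=> /cvg_rnorm/(_ e e0); rewrite near_withinE => /nbhs_ballP[d d0 hd].
exists d => // t td.
have [->|t0] := eqVneq t 0.
  by rewrite W0/= subrr mulr0 scale0r subrr rnorm0 normr0 mulr0.
have tb : ball (0 : R) d t by rewrite /ball/= sub0r normrN.
have h := hd t tb t0.
have -> : W t x - x - ('i%C * t%:C) *: A x = t%:C *: ((t^-1)%:C *: (W t x - x) - (0 +i* 1) *: A x).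
  rewrite scalerBr !scalerA -rmorphM/= mulfV// scale1r; congr (_ - _ *: _).
  by rewrite mulrC.
by rewrite rnormZ cnR mulrC ler_wpM2r// ltW.
Qed.

Lemma dom_group s x : dom A x -> dom A (W s x) /\ A (W s x) = W s (A x).
Proof.
case: WA => _ _ WD _ gen Dx; apply/(gen _ _).2.
have /(_ (conj Dx erefl)) := (gen x (A x)).1.
move=> /cvg_rnorm h; apply/cvg_rnorm => e /h; apply: filterS => t.
have lW := group_linear gW s; rewrite -[X in _ -> X < _](group_iso gW (- s)).
have lW' := group_linear gW (- s).
rewrite (lopB lW') !(lopZ lW') (lopB lW') !(groupK gW).
have -> : W (- s) (W t (W s x)) = W t x; last by [].
by rewrite -[W t (W s x)]/((W t \o W s) x) -WD addrC WD/= (groupK gW).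
Qed.

Lemma group_lip t x : dom A x -> rnorm (W t x - x) <= `|t| * rnorm (A x).
Proof.
move=> Dx; have [->|t0] := eqVneq t 0.
  by case: WA => _ -> _ _ _; rewrite subrr rnorm0 normr0 mul0r.
have tp : 0 < `|t| by rewrite normr_gt0.
rewrite -ler_pdivrMl//; apply/ler_addgt0Pr => e e0.
have [d d0 hd] := generator_lim Dx e0.
(* [t] is cut into [n] steps shorter than [d]. As the group is isometric, the increments of the
   steps have equal norms and add up. *)
pose n := (Num.truncn (`|t| / d)).+1.
have n0 : 0 < n%:R :> R by rewrite ltr0n.
have hn : `|t| / d < n%:R by apply: truncnS_gt.
pose h := t / n%:R.
have hh : `|h| < d.
  by rewrite /h normrM normfV (gtr0_norm n0) ltr_pdivrMr// mulrC -ltr_pdivrMr.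
have hb : rnorm (W h x - x) <= `|h| * (rnorm (A x) + e).
  have := hd h hh.
  have := rnormD (W h x - x - ('i%C * h%:C) *: A x) (('i%C * h%:C) *: A x).
  by rewrite subrK rnormZ cnM cn_i mul1r cnR mulrDr; lra.
have it i : rnorm (W (i%:R * h) x - x) <= i%:R * (`|h| * (rnorm (A x) + e)).
  elim: i => [|i IH].
    by rewrite !mul0r; case: WA => _ -> _ _ _; rewrite subrr rnorm0.
  have -> : W (i.+1%:R * h) x - x = W (i%:R * h) (W h x - x) + (W (i%:R * h) x - x).
    rewrite (lopB (group_linear gW _)) addrA subrK -(@natr1 R) mulrDl mul1r.
    by case: WA => _ _ -> _ _.
  apply: le_trans (rnormD _ _) _; rewrite (group_iso gW) -(@natr1 R) mulrDl mul1r addrC.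
  exact: lerD.
have := it n; have -> : n%:R * h = t by rewrite /h mulrC divfK// gt_eqF.
have -> : n%:R * (`|h| * (rnorm (A x) + e)) = `|t| * (rnorm (A x) + e).
  by rewrite /h normrM normfV (gtr0_norm n0); field; rewrite gt_eqF.
by rewrite ler_pdivrMl.
Qed.

Hypothesis denseA : dense (dom A).

Lemma dense_approx x e : 0 < e -> exists2 y, dom A y & rnorm (y - x) < e.
Proof.
move=> e0; have e0C : 0 < e%:C by rewrite ltcR.
have [|y [yb Dy]] := denseA _ (ball_open x e%:C); first by exists x; apply: ballxx.
by exists y => //; move: yb; rewrite -ball_normE/= norm_rnorm ltcR rdistC.
Qed.

Lemma le_small (a b C : R) : 0 <= C -> (forall e, 0 < e -> e <= 1 -> a <= b + C * e) -> a <= b.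
Proof.
move=> C0 h; apply/ler_addgt0Pr => e e0.
have C1 : 0 < C + 1 by lra.
pose e' := Num.min 1 (e / (C + 1)).
have e'0 : 0 < e' by rewrite lt_min ltr01 divr_gt0.
have e'1 : e' <= 1 by rewrite ge_min lexx.
apply: le_trans (h e' e'0 e'1) _; rewrite lerD2l.
have h2 : e' * (C + 1) <= e by rewrite -ler_pdivlMr// ge_min lexx orbT.
lra.
Qed.

(** The a priori bound [M0] pays for the approximation of vectors by [dom A], and disappears in the
    limit. *)
Lemma bnd_dense (B : H -> H) M M0 : linear B -> bnd M0 B -> 0 <= M ->
  (forall x y, dom A x -> dom A y -> cn (inner x (B y)) <= M * rnorm x * rnorm y) ->
  bnd M B.
Proof.
move=> linB bB M_ge0 h.
have h1 y : dom A y -> rnorm (B y) <= M * rnorm y.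
  move=> Dy; set r := rnorm (B y); have r0 : 0 <= r := rnorm_ge0 _.
  have [->|rn] := eqVneq r 0; first by rewrite mulr_ge0 ?rnorm_ge0.
  have rp : 0 < r by rewrite lt_def rn.
  rewrite -(ler_pM2r rp).
  apply: (@le_small _ _ (M * rnorm y + r)); first by rewrite addr_ge0// mulr_ge0 ?rnorm_ge0.
  move=> e e0 e1; have [x Dx xe] := dense_approx (B y) e0.
  have -> : r * r = re x (B y) - re (x - B y) (B y).
    by rewrite reBl opprB addrC subrK re_rnorm expr2.
  have b1 : re x (B y) <= M * rnorm x * rnorm y by apply: le_trans (Re_le_cn _) (h _ _ Dx Dy).
  have b2 : - re (x - B y) (B y) <= e * r.
    rewrite -reNl; apply: le_trans (re_le _ _) _.
    by rewrite rnormN ler_wpM2r// ltW.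
  have b3 : rnorm x <= r + e.
    by have := rnormD (x - B y) (B y); rewrite subrK -/r; lra.
  have b4 : M * rnorm x * rnorm y <= M * (r + e) * rnorm y.
    by rewrite ler_wpM2r ?rnorm_ge0// ler_wpM2l.
  lra.
move=> y; apply: (@le_small _ _ (M + `|M0|)); first by rewrite addr_ge0.
move=> e e0 e1; have [x Dx xe] := dense_approx y e0.
have -> : B y = B x - B (x - y) by rewrite (lopB linB) opprB addrC subrK.
apply: le_trans (rnormB _ _) _; apply: le_trans (lerD (h1 x Dx) (bB _)) _.
have b1 : rnorm x <= rnorm y + e by have := rnormD (x - y) y; rewrite subrK; lra.
have b2 : M * rnorm x <= M * (rnorm y + e) by rewrite ler_wpM2l.
have b3 : M0 * rnorm (x - y) <= `|M0| * e.
  apply: le_trans (_ : `|M0| * rnorm (x - y) <= _).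
    by rewrite ler_wpM2r ?rnorm_ge0 ?ler_norm.
  by rewrite ler_wpM2l// ltW.
lra.
Qed.

Variables (U Us T : H -> H) (b : R).
Hypotheses (adjU : adjp U Us) (bU : bnd 1 U) (adT : is_ad A U T) (bT : bnd b T).
Hypothesis b0 : 0 <= b.

Let linU : linear U := adjp_linear adjU.
Let linT : linear T. Proof. by case: adT => -[]. Qed.

(** A derivative of [t |-> inner x (conj_op W U t y)], uniform in [t]: the group preserves norms and
    commutes with [A], so [d] depends on [x] and [y] only. The uniformity is what [conj_lip] sums
    over. *)
Lemma orbit_diff x y e : dom A x -> dom A y -> 0 < e -> exists2 d, 0 < d &
  forall t h, `|h| < d ->
  cn (inner x (conj_op W U (t + h) y) - inner x (conj_op W U t y)
      - ('i%C * h%:C) * inner (W (- t) x) (T (W (- t) y))) <= e * `|h|.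
Proof.
move=> Dx Dy e0.
pose nx := rnorm x; pose ny := rnorm y; pose ax := rnorm (A x); pose ay := rnorm (A y).
have nx0 : 0 <= nx := rnorm_ge0 _. have ny0 : 0 <= ny := rnorm_ge0 _.
have ax0 : 0 <= ax := rnorm_ge0 _. have ay0 : 0 <= ay := rnorm_ge0 _.
pose e1 := e / 2 / (nx + ny + 1).
have np : 0 < nx + ny + 1 by lra.
have e10 : 0 < e1 by rewrite !divr_gt0.
have [d1 d10 hd1] := generator_lim Dx e10.
have [d2 d20 hd2] := generator_lim Dy e10.
pose d3 := e / 2 / (ax * ay + 1).
have ap : 0 < ax * ay + 1 by rewrite ltr_wpDl// mulr_ge0.
have d30 : 0 < d3 by rewrite !divr_gt0.
exists (Num.min d1 (Num.min d2 d3)); first by rewrite !lt_min d10 d20 d30.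
move=> t h; rewrite !lt_min => /and3P[h1 h2 h3].
pose x' := W (- t) x; pose y' := W (- t) y.
have [Dx' Ax'] := dom_group (- t) Dx; have [Dy' Ay'] := dom_group (- t) Dy.
pose dx := W (- h) x' - x'; pose dy := W (- h) y' - y'.
pose rx := dx + ('i%C * h%:C) *: A x'; pose ry := dy + ('i%C * h%:C) *: A y'.
have rest (z : H) d : (forall t0, `|t0| < d -> rnorm (W t0 z - z - ('i%C * t0%:C) *: A z) <= e1 * `|t0|) ->
    dom A z -> `|h| < d ->
    rnorm (W (- h) (W (- t) z) - W (- t) z + ('i%C * h%:C) *: A (W (- t) z)) <= e1 * `|h|.
  move=> hz Dz hh; have := hz (- h); rewrite normrN => /(_ hh).
  rewrite -(group_iso gW (- t)); have lW := group_linear gW (- t).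
  rewrite !(lopB lW) (lopZ lW); have [_ <-] := dom_group (- t) Dz.
  have -> : W (- t) (W (- h) z) = W (- h) (W (- t) z).
    by case: gW => _ WD _; rewrite -[LHS]/((W (- t) \o W (- h)) z) -WD addrC WD.
  by rewrite rmorphN/= mulrN scaleNr opprK.
have brx : rnorm rx <= e1 * `|h| := rest x d1 hd1 Dx h1.
have bry : rnorm ry <= e1 * `|h| := rest y d2 hd2 Dy h2.
have bdx : rnorm dx <= `|h| * ax.
  by apply: le_trans (group_lip _ Dx') _; rewrite normrN Ax' (group_iso gW).
have bdy : rnorm dy <= `|h| * ay.
  by apply: le_trans (group_lip _ Dy') _; rewrite normrN Ay' (group_iso gW).
have Wd z : W (- (t + h)) z = W (- h) (W (- t) z).
  by case: gW => _ WD _; rewrite opprD addrC WD.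
have cE s : inner x (conj_op W U s y) = inner (W (- s) x) (U (W (- s) y)).
  by rewrite /conj_op; case: gW => _ _ ->.
rewrite !cE !Wd -/x' -/y'.
have -> : inner x' (T y') = inner (A x') (U y') - inner x' (U (A y')).
  by case: adT => _ ->.
have -> : W (- h) x' = x' + (rx - ('i%C * h%:C) *: A x') by rewrite /rx addrK /dx addrC subrK.
have -> : W (- h) y' = y' + dy by rewrite /dy addrC subrK.
(* The first-order terms cancel. There remain two Taylor remainders and a product of two increments,
   which is of order [h^2]. *)
have -> : inner (x' + (rx - ('i%C * h%:C) *: A x')) (U (y' + dy)) - inner x' (U y')
   - 'i%C * h%:C * (inner (A x') (U y') - inner x' (U (A y'))) =
   inner rx (U y') + inner x' (U ry) + inner dx (U dy).
  have -> : rx - ('i%C * h%:C) *: A x' = dx by rewrite /rx addrK.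
  rewrite /ry /rx !(lopD linU, lopZ linU, innerDl, innerDr, innerZl, innerZr).
  have -> : conjc ('i%C * h%:C) = - ('i%C * h%:C) :> R[i].
    by apply/eqP; rewrite eq_complex/=; apply/andP; split; apply/eqP; ring.
  ring.
apply: le_trans (cnD _ _) _; apply: le_trans (lerD (cnD _ _) (lexx _)) _.
have U1 z : rnorm (U z) <= rnorm z by have := bU z; rewrite mul1r.
have c1 : cn (inner rx (U y')) <= e1 * `|h| * ny.
  apply: le_trans (cauchy_schwarz _ _) _; apply: ler_pM; rewrite ?rnorm_ge0//.
  by apply: le_trans (U1 _) _; rewrite /y' (group_iso gW).
have c2 : cn (inner x' (U ry)) <= nx * (e1 * `|h|).
  apply: le_trans (cauchy_schwarz _ _) _; apply: ler_pM; rewrite ?rnorm_ge0//.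
    by rewrite /x' (group_iso gW).
  exact: le_trans (U1 _) _.
have c3 : cn (inner dx (U dy)) <= `|h| * ax * (`|h| * ay).
  apply: le_trans (cauchy_schwarz _ _) _; apply: ler_pM; rewrite ?rnorm_ge0//.
  exact: le_trans (U1 _) _.
have hp : 0 <= `|h| by [].
have c4 : `|h| * (ax * ay + 1) <= e / 2 by rewrite -ler_pdivlMr// ltW.
have c5 : `|h| * ax * (`|h| * ay) <= e / 2 * `|h|.
  have -> : `|h| * ax * (`|h| * ay) = `|h| * (ax * ay) * `|h| by ring.
  by rewrite ler_wpM2r//; lra.
have c6 : e1 * (nx + ny + 1) = e / 2 by rewrite /e1 divfK// gt_eqF.
have c7 : e1 * (nx + ny) * `|h| <= e / 2 * `|h|.
  by rewrite ler_wpM2r// -c6 ler_wpM2l ?(ltW e10)//; lra.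
lra.
Qed.

Lemma conj_lip t : bnd (b * `|t|) (fun x => conj_op W U t x - U x).
Proof.
have adjC := adjp_conj gW t adjU.
have adjD := adjpB adjC adjU.
have bC : bnd (1 + 1) (fun x => conj_op W U t x - U x).
  by apply: bndB => //; apply: conj_bnd.
apply: bnd_dense (adjp_linear adjD) bC _ _; first by rewrite mulr_ge0.
move=> x y Dx Dy; rewrite innerBr.
have [t0|t0] := eqVneq t 0.
  rewrite t0 (conj_op0 gW) subrr cn0 normr0 mulr0 !mul0r//.
pose L := b * rnorm x * rnorm y.
have -> : b * `|t| * rnorm x * rnorm y = `|t| * L by rewrite /L; ring.
apply: (@le_small _ _ `|t|) => // e e0 e1.
have [d d0 hd] := orbit_diff Dx Dy e0.
pose n := (Num.truncn (`|t| / d)).+1.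
have n0 : 0 < n%:R :> R by rewrite ltr0n.
have hn : `|t| / d < n%:R by apply: truncnS_gt.
pose h := t / n%:R.
have hh : `|h| < d.
  by rewrite /h normrM normfV (gtr0_norm n0) ltr_pdivrMr// mulrC -ltr_pdivrMr.
pose g s := inner x (conj_op W U s y).
have st s : cn (g (s + h) - g s) <= `|h| * (L + e).
  have := hd s h hh; rewrite -/(g _) -/(g _).
  set X := _ * inner _ _ => h1.
  have h2 : cn X <= `|h| * L.
    rewrite /X cnM cnM cn_i mul1r cnR ler_wpM2l//.
    apply: le_trans (cauchy_schwarz _ _) _; rewrite (group_iso gW) /L.
    have -> : b * rnorm x * rnorm y = rnorm x * (b * rnorm y) by ring.
    rewrite ler_wpM2l ?rnorm_ge0//.
    by apply: le_trans (bT _) _; rewrite (group_iso gW).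
  by have := cnD (g (s + h) - g s - X) X; rewrite subrK mulrDr; lra.
have it i : cn (g (i%:R * h) - g 0) <= i%:R * (`|h| * (L + e)).
  elim: i => [|i IH]; first by rewrite !mul0r subrr cn0.
  have -> : g (i.+1%:R * h) - g 0 = (g (i%:R * h + h) - g (i%:R * h)) + (g (i%:R * h) - g 0).
    by rewrite -(@natr1 R) mulrDl mul1r; ring.
  apply: le_trans (cnD _ _) _; rewrite -(@natr1 R) mulrDl mul1r addrC.
  exact: lerD.
have := it n; have -> : n%:R * h = t by rewrite /h mulrC divfK// gt_eqF.
rewrite /g (conj_op0 gW) => h1; apply: le_trans h1 _.
rewrite le_eqVlt; apply/orP; left; apply/eqP.
by rewrite /h normrM normfV (gtr0_norm n0); field; rewrite gt_eqF.
Qed.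

Variable p : nat -> R.
Hypotheses (zyg : zygmund W U p) (sp : summable_seq p).

Lemma Sdiff_weak x y e : dom A x -> dom A y -> 0 < e -> exists N, forall k, (N <= k)%N ->
  cn (inner x (Sdiff W U k y) - inner x (T y)) <= e.
Proof.
move=> Dx Dy e0; have [d d0 hd] := orbit_diff Dx Dy e0.
have d20 : 0 < d / 2 by rewrite divr_gt0.
have [N hN] := summable_cvg0 summable_geometric d20.
exists N => k Nk; pose t : R := 2^-1 ^+ k.
have t0 : 0 < t by rewrite exprn_gt0// invr_gt0.
have td : t < d by have := hN k Nk; rewrite -/t; lra.
have h1 := hd 0 t; have h2 := hd 0 (- t).
rewrite normrN (gtr0_norm t0) !add0r oppr0 !(conj_op0 gW) in h1 h2.
have W0 : W 0 = id by case: gW.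
rewrite !W0/= in h1 h2; have {}h1 := h1 td; have {}h2 := h2 td.
have tk : t * 2 ^+ k = 1 by rewrite /t -exprMn mulVf ?expr1n// pnatr_eq0.
have -> : inner x (Sdiff W U k y) - inner x (T y) = (- 'i%C * (2^-1 * 2 ^+ k)%:C) *
  ((inner x (conj_op W U t y) - inner x (U y) - 'i%C * t%:C * inner x (T y)) -
   (inner x (conj_op W U (- t) y) - inner x (U y) - 'i%C * (- t)%:C * inner x (T y))).
  rewrite /Sdiff innerZr innerBr -/t.
  have jj : 'i%C * 'i%C = -1 :> R[i] by rewrite -expr2 sqr_i.
  rewrite !rmorphM/= rmorphN/=.
  have -> : (2^-1)%:C = 2^-1 :> R[i] by rewrite fmorphV/= rmorph_nat.
  move: jj; set j := 'i%C => jj.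
  set X := inner x (conj_op _ _ t y); set Y := inner x (conj_op _ _ _ y); set Z := inner x (T y).
  set tt := t%:C; set k2 := (2 ^+ k)%:C; set u := inner x (U y).
  transitivity (- j * (2^-1 * k2) * (X - Y) + (j * j) * (tt * k2) * Z); last by field.
  by rewrite jj /tt /k2 -!rmorphM/= tk; ring.
rewrite cnM cnM cnN cn_i mul1r cnR ger0_norm ?mulr_ge0 ?invr_ge0 ?exprn_ge0//.
apply: le_trans (_ : 2^-1 * 2 ^+ k * (e * t + e * t) <= _).
  rewrite ler_wpM2l ?mulr_ge0 ?invr_ge0 ?exprn_ge0//.
  by apply: le_trans (cnD _ _) _; rewrite cnN; apply: lerD.
have -> : 2^-1 * 2 ^+ k * (e * t + e * t) = (t * 2 ^+ k) * e by field.
by rewrite tk mul1r.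
Qed.

(** The steps of [Sdiff] are summable in norm, and [Sdiff_weak] identifies the limit with [T] on the
    dense domain; the weak limit thus becomes a norm estimate. *)
Lemma Sdiff_near k e : 0 <= e -> (forall n, \sum_(k <= j < n) p j.+1 <= e) ->
  bnd e (fun x => Sdiff W U k x - T x).
Proof.
move=> e0 he.
have tel n : (k <= n)%N -> bnd e (fun x => Sdiff W U k x - Sdiff W U n x).
  move=> kn; apply: (@bndW _ _ (\sum_(k <= j < n) p j.+1)) => //.
  elim: n kn => [|n IH].
    by rewrite leqn0 => /eqP -> x; rewrite big_geq// subrr rnorm0 mul0r.
  rewrite leq_eqVlt => /orP[/eqP <- x|]; first by rewrite big_geq// subrr rnorm0 mul0r.
  rewrite ltnS => kn x; rewrite big_nat_recr//=.
  have -> : Sdiff W U k x - Sdiff W U n.+1 x =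
    (Sdiff W U k x - Sdiff W U n x) - (Sdiff W U n.+1 x - Sdiff W U n x) by hring.
  apply: le_trans (rnormB _ _) _; rewrite mulrDl; apply: lerD; first exact: IH.
  exact: (Sdiff_step gW zyg).
have [S' hS] := Sdiff_adjp gW adjU k.
have bS : bnd (2^-1 * 2 ^+ k * (1 + 1)) (Sdiff W U k).
  move=> x; rewrite /Sdiff rnormZ cnM cnN cn_i mul1r cnR ger0_norm ?mulr_ge0 ?invr_ge0 ?exprn_ge0//.
  rewrite -[leRHS]mulrA ler_wpM2l ?mulr_ge0 ?invr_ge0 ?exprn_ge0//.
  apply: le_trans (rnormB _ _) _; rewrite mulrDl.
  by apply: lerD; apply: (conj_bnd gW).
apply: (@bnd_dense _ _ (2^-1 * 2 ^+ k * (1 + 1) + b)) => //.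
- by move=> c x y; rewrite (adjp_linear hS) linT; hring.
- exact: bndB.
move=> x y Dx Dy; apply: (@le_small _ _ 1) => // e' e'0 _; rewrite mul1r.
have [N hN] := Sdiff_weak Dx Dy e'0; pose n := maxn N k.
have := hN n (leq_maxl _ _) => h1.
have -> : inner x (Sdiff W U k y - T y) = inner x (Sdiff W U k y - Sdiff W U n y) +
   (inner x (Sdiff W U n y) - inner x (T y)) by rewrite !innerBr; ring.
apply: le_trans (cnD _ _) _; apply: lerD => //.
apply: le_trans (cauchy_schwarz _ _) _.
have -> : e * rnorm x * rnorm y = rnorm x * (e * rnorm y) by ring.
rewrite ler_wpM2l ?rnorm_ge0//; exact: tel (leq_maxr _ _) y.
Qed.

Lemma Tavg_lim e : 0 < e -> exists N, forall k, (N <= k)%N ->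
  bnd e (fun x => Tavg W U k x - T x).
Proof.
move=> e0; have e60 : 0 < e / 6 by rewrite divr_gt0.
have [N1 hN1] := summable_tail (summable_seqS sp) e60.
have [N2 hN2] := summable_cvg0 sp e60.
exists (maxn N1 N2) => k; rewrite geq_max => /andP[k1 k2] x.
have h1 : bnd (e / 6) (fun x => Sdiff W U k x - T x).
  by apply: Sdiff_near => [|n]; [exact: ltW|exact: hN1].
have -> : Tavg W U k x - T x = (Tavg W U k x - Sdiff W U k x) + (Sdiff W U k x - T x) by hring.
apply: le_trans (rnormD _ _) _.
apply: le_trans (lerD (Tavg_Sdiff gW zyg k x) (h1 x)) _.
rewrite -mulrDl ler_wpM2r ?rnorm_ge0//; have := hN2 k k2; lra.
Qed.

(** The one-sided quotient differs from the central one by half a second difference over the step,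
    which is [O(p k)]. The virial theorem uses this one-sided form. *)
Lemma Wdiff_lim e : 0 < e -> exists N, forall k, (N <= k)%N ->
  bnd e (fun x => Wdiff W U (2^-1 ^+ k) x - T x).
Proof.
move=> e0; have e60 : 0 < e / 6 by rewrite divr_gt0.
have [N1 hN1] := summable_tail (summable_seqS sp) e60.
have [N2 hN2] := summable_cvg0 sp e60.
exists (maxn N1 N2) => k; rewrite geq_max => /andP[k1 k2] x.
have h1 : bnd (e / 6) (fun x => Sdiff W U k x - T x).
  by apply: Sdiff_near => [|n]; [exact: ltW|exact: hN1].
pose t : R := 2^-1 ^+ k.
have t0 : 0 < t by rewrite exprn_gt0// invr_gt0.
have tk : t * 2 ^+ k = 1 by rewrite /t -exprMn mulVf ?expr1n// pnatr_eq0.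
have h2 : rnorm (Wdiff W U t x - Sdiff W U k x) <= p k * rnorm x.
  have -> : Wdiff W U t x - Sdiff W U k x = (- 'i%C * (2^-1 * 2 ^+ k)%:C) *:
     (conj_op W U t x + conj_op W U (- t) x - 2 *: U x).
    rewrite /Wdiff /Sdiff -/t.
    have -> : ('i%C * t%:C)^-1 = - 'i%C * (2 ^+ k)%:C :> R[i].
      have tn : ('i%C * t%:C : R[i]) != 0.
        by rewrite mulf_neq0// eq_complex/= ?oner_eq0 ?andbF// gt_eqF.
      apply: (mulfI tn); rewrite mulfV// mulrACA mulrN -expr2 sqr_i opprK mul1r.
      by rewrite -rmorphM/= tk.
    rewrite rmorphM/=; have -> : (2^-1)%:C = 2^-1 :> R[i] by rewrite fmorphV/= rmorph_nat.
    have -> : (2 : R[i]) *: U x = U x + U x by rewrite scaler_nat mulr2n.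
    by apply: inner_ext => z; rewrite !(innerDr, innerNr, innerZr); field.
  rewrite rnormZ cnM cnN cn_i mul1r cnR ger0_norm ?mulr_ge0 ?invr_ge0 ?exprn_ge0//.
  apply: le_trans (ler_wpM2l _ (zyg (k := k) _ _)) _.
  - by rewrite mulr_ge0 ?invr_ge0 ?exprn_ge0.
  - by rewrite ger0_norm ?(ltW t0).
  rewrite -/t [leLHS](_ : _ = (t * 2 ^+ k) * (p k * rnorm x) / 2); last by field.
  rewrite tk mul1r ler_piMr ?invf_le1//; last by lra.
  by rewrite mulr_ge0 ?rnorm_ge0//; apply: sp.1.
have -> : Wdiff W U t x - T x = (Wdiff W U t x - Sdiff W U k x) + (Sdiff W U k x - T x) by hring.
apply: le_trans (rnormD _ _) _; apply: le_trans (lerD h2 (h1 x)) _.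
rewrite -mulrDl ler_wpM2r ?rnorm_ge0//; have := hN2 k k2; lra.
Qed.

End HypothesesTranslation.

(** * From the C^{1,1} integral to a summable dyadic modulus *)

Section ZygmundIntegral.
Context {R : realType}.
Variables (w : R -> R) (L : R).
Hypothesis w0 : forall t, 0 <= w t.
Hypothesis wL : forall s t, w t <= w s + L * `|t - s|.
Hypothesis w00 : w 0 = 0.
Hypothesis w2 : forall s t, 2 * w t <= 2 * w s + w (t + s) + w (t - s).
Let mu := @lebesgue_measure R.

Lemma lipschitz_continuous_real : continuous w.
Proof.
move=> s; apply/cvgrPdist_lt => e e0.
have L1 : 0 < `|L| + 1 by rewrite ltr_wpDl.
near=> t.
have st : `|s - t| < e / (`|L| + 1).
  by near: t; apply: cvgr_dist_lt => //; rewrite divr_gt0.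
have h1 := wL s t; have h2 := wL t s.
rewrite distrC in h1.
have h3 : L * `|s - t| <= `|L| * `|s - t| by rewrite ler_wpM2r// ler_norm.
move: st; rewrite ltr_pdivlMr// mulrDr mulr1 mulrC => st.
have d0 : 0 <= `|s - t| by [].
by rewrite ltr_norml; apply/andP; split; lra.
Unshelve. all: by end_near. Qed.

Let wC := lipschitz_continuous_real.

Let intw (a b : R) : mu.-integrable `[a, b] (EFin \o w).
Proof.
apply: continuous_compact_integrable; first exact: segment_compact.
exact: continuous_subspaceT.
Qed.

Let Phi (x : R) : R := (\int[mu]_(s in `[0, x]) w s)%R.

Let dPhi (x : R) : 0 < x -> is_derive x 1 Phi (w x).
Proof.
move=> x0; have xx : x < x + 1 by rewrite ltrDl.
have := @continuous_FTC1 R w (BLeft 0) x (x + 1) xx (intw 0 (x + 1)).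
rewrite /= lte_fin => /(_ x0 (@wC x)) [dF F'].
by rewrite -F' derive1E; exact/derivableP.
Qed.

Let PhiB (a b : R) : 0 <= a -> a <= b -> Phi b - Phi a = (\int[mu]_(s in `]a, b]) w s)%R.
Proof.
move=> a0 ab; rewrite /Phi.
by apply: Rintegral_itvB; rewrite ?bnd_simp.
Qed.

(** Integrating [w2] over [s] between [t / 4] and [t / 2] bounds a value of [w] by its mean nearby;
    in this way a hypothesis on an integral controls [w] pointwise. *)
Lemma second_difference_average (t : R) : 0 < t ->
  w t * t <= 8 * (\int[mu]_(s in `](t / 4)%R, (3 * t / 2)%R]) w s)%R.
Proof.
move=> t0.
(* [Hf] is a primitive of the right-hand side of [w2] as a function of [s], so the mean value
   theorem bounds its increment from below by [2 * w t * (t / 4)]. *)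
pose Hf : R -> R := 2 \*: Phi + (Phi \o (cst t + id)) - (Phi \o (cst t - id)).
have dH s : 0 < s < t -> is_derive s 1 Hf (2 * w s + w (t + s) + w (t - s)).
  move=> /andP[s0 st].
  have d1 := dPhi s0.
  have d2 : is_derive ((cst t + id) s) 1 Phi (w (t + s)) by apply: dPhi; rewrite addr_gt0.
  have d3 : is_derive ((cst t - id) s) 1 Phi (w (t - s)).
    by apply: dPhi; rewrite subr_gt0.
  apply: is_derive_eq; rewrite add0r sub0r mulr1 mulrN1 opprK//.
have t4 : t / 4 < t / 2 by lra.
have [||c cab hc] := MVT t4 (df := fun s => 2 * w s + w (t + s) + w (t - s)) (f := Hf).
- by move=> s; rewrite in_itv/= => /andP[s1 s2]; apply: dH; apply/andP; split; lra.
- apply: derivable_within_continuous => s; rewrite in_itv/= => /andP[s1 s2].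
  have /dH/@ex_derive// : 0 < s < t by apply/andP; split; lra.
have H1 : 2 * w t * (t / 4) <= Hf (t / 2) - Hf (t / 4).
  by rewrite hc (_ : t / 2 - t / 4 = t / 4) ?ler_wpM2r ?w2//; lra.
have mono a b : 0 <= a -> a <= b -> Phi a <= Phi b.
  by move=> a0 ab; rewrite -subr_ge0 PhiB// Rintegral_ge0.
have -> : (\int[mu]_(s in `](t / 4)%R, (3 * t / 2)%R]) w s)%R = Phi (3 * t / 2) - Phi (t / 4).
  by rewrite PhiB//; lra.
have HE s : Hf s = 2 * Phi s + Phi (t + s) - Phi (t - s) by [].
move: H1; rewrite !HE.
have -> : t + t / 2 = 3 * t / 2 by field.
have -> : t - t / 2 = t / 2 by field.
have m1 := mono (t / 4) (t / 2); have m2 := mono (t / 2) (t - t / 4).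
have m3 := mono (t - t / 4) (t + t / 4); have m4 := mono (t + t / 4) (3 * t / 2).
have {}m1 : Phi (t / 4) <= Phi (t / 2) by apply: m1; lra.
have {}m2 : Phi (t / 2) <= Phi (t - t / 4) by apply: m2; lra.
have {}m3 : Phi (t - t / 4) <= Phi (t + t / 4) by apply: m3; lra.
have {}m4 : Phi (t + t / 4) <= Phi (3 * t / 2) by apply: m4; lra.
lra.
Qed.

Let h t := w t / t ^+ 2.

Lemma measurable_weight (a b : R) : 0 <= a ->
  measurable_fun `]a, b] (EFin \o h).
Proof.
move=> a0; apply/measurable_EFinP.
have mh : measurable_fun `](0 : R), +oo[ h; last first.
  apply: measurable_funS mh => //.
  by move=> x /=; rewrite !in_itv/= andbT => /andP[+ _]; apply: le_lt_trans.
apply: open_continuous_measurable_fun => // x; rewrite inE/= in_itv/= andbT => x0.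
rewrite /h; apply: cvgM; first exact: (@wC x).
apply: cvgV; first by rewrite expf_neq0// gt_eqF.
exact: exprn_continuous.
Qed.

Let h0 t : (0 <= (h t)%:E)%E. Proof. by rewrite lee_fin divr_ge0 ?sqr_ge0. Qed.

Lemma weight_bound (a b : R) : 0 <= a -> a <= b ->
  ((\int[mu]_(s in `]a, b]) w s)%:E <= (b ^+ 2)%:E * \int[mu]_(s in `]a, b]) (h s)%:E)%E.
Proof.
move=> a0 ab; rewrite /Rintegral fineK; last first.
  apply: integrable_fin_num => //; apply: integrableS (intw a b) => //.
  by apply: subset_itv; rewrite bnd_simp.
rewrite -ge0_integralZl//; last 2 first.
- exact: measurable_weight.
- by rewrite lee_fin sqr_ge0.
apply: ge0_le_integral => //.
- by move=> x _; rewrite lee_fin.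
- by apply/measurable_EFinP; apply: measurable_funTS; apply: continuous_measurable_fun.
- apply: measurable_funeM; exact: measurable_weight.
move=> x /=; rewrite in_itv/= => /andP[ax xb].
have x0 : 0 < x := le_lt_trans a0 ax.
rewrite -EFinM lee_fin /h mulrCA ler_peMr// ler_pdivlMr ?exprn_gt0// mul1r.
by rewrite lerXn2r ?nnegrE ?(ltW x0)// (le_trans (ltW x0)).
Qed.

Hypothesis hI : (\int[mu]_(t in `]0%R, 1%R]) (h t)%:E < +oo)%E.
Let eps k : R := 2^-1 ^+ k.
Let J k : \bar R := (\int[mu]_(t in `](eps k.+1), (eps k)]) (h t)%:E)%E.

Let eps_gt0 k : 0 < eps k. Proof. by rewrite exprn_gt0// invr_gt0. Qed.
Let epsS k : eps k.+1 = eps k / 2. Proof. by rewrite /eps exprS mulrC. Qed.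
Let eps_le k n : (k <= n)%N -> eps n <= eps k.
Proof. by move=> kn; rewrite /eps ler_wiXn2l// ?invr_ge0// invf_le1// ler1n. Qed.

Let Jsplit k n : (k <= n)%N ->
  (\int[mu]_(t in `](eps n), (eps k)]) (h t)%:E = \sum_(k <= i < n) J i)%E.
Proof.
elim: n => [|n IH].
  by rewrite leqn0 => /eqP ->; rewrite big_geq// set_itvoc0// integral_set0.
rewrite leq_eqVlt => /orP[/eqP <-|]; first by rewrite big_geq// set_itvoc0// integral_set0.
rewrite ltnS => kn; rewrite big_nat_recr//= -IH// addeC /J.
have -> : `](eps n.+1), (eps k)]%classic = `](eps n.+1), (eps n)] `|` `](eps n), (eps k)].
  by rewrite -(@itv_bndbnd_setU _ _ _ (BRight (eps n)))//= bnd_simp eps_le.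
rewrite ge0_integral_setU//.
- rewrite -(@itv_bndbnd_setU _ _ _ (BRight (eps n)))//= ?bnd_simp ?eps_le//.
  by apply: measurable_weight; rewrite ltW.
- apply/disj_setPS => x [/=]; rewrite !in_itv/= => /andP[_ xn] /andP[nx _].
  by have := lt_le_trans nx xn; rewrite ltxx.
Qed.

Let I := fine (\int[mu]_(t in `]0%R, 1%R]) (h t)%:E)%E.

Let Jle k n : (k <= n)%N -> (\sum_(k <= i < n) J i <= I%:E)%E.
Proof.
move=> kn; rewrite -Jsplit// /I fineK; last first.
  by rewrite ge0_fin_numE// integral_ge0.
apply: ge0_subset_integral => //; first exact: measurable_weight.
apply: subset_itv; rewrite bnd_simp ?(ltW (eps_gt0 _))//.
by have := @eps_le 0 k (leq0n _); rewrite /eps expr0.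
Qed.

Let Jfin k : J k \is a fin_num.
Proof.
rewrite ge0_fin_numE; last by apply: integral_ge0.
by have := @Jle k k.+1 (leqnSn k); rewrite big_nat1 => /le_lt_trans; apply; rewrite ltry.
Qed.

Let j k := fine (J k).

Let j_ge0 k : 0 <= j k. Proof. by apply: fine_ge0; apply: integral_ge0. Qed.

Let jE k n : (\sum_(k <= i < n) J i = (\sum_(k <= i < n) j i)%:E)%E.
Proof. by rewrite -sumEFin; apply: eq_bigr => i _; rewrite /j fineK. Qed.

Let sumj : summable_seq j.
Proof.
split; first exact: j_ge0.
exists I => n; rewrite -(big_mkord xpredT) -lee_fin -jE; exact: Jle.
Qed.

(** For [t] in the block [k'.+1], the window from [t / 4] to [3 * t / 2] lies in the blocks [k'] to
    [k'.+3], and [18 = 8 * (3/2)^2]. For [k = 0] the window may leave the unit interval, and the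
    Lipschitz bound is used instead. *)
Let c k := if k is k'.+1 then 18 * (j k' + j k'.+1 + j k'.+2 + j k'.+3) else L.

Let L0 : 0 <= L.
Proof. by have := wL 0 1; rewrite w00 add0r subr0 normr1 mulr1; apply: le_trans. Qed.

Let wc k t : eps k.+1 <= t <= eps k -> w t <= eps k * c k.
Proof.
move=> /andP[t1 t2].
have t0 : 0 < t by apply: lt_le_trans t1.
case: k t1 t2 => [|k] t1 t2.
  rewrite {1}/eps expr0 mul1r /c; have := wL 0 t; rewrite w00 add0r subr0 gtr0_norm// => h1.
  by apply: le_trans h1 _; rewrite -[leRHS]mulr1 ler_wpM2l//; move: t2; rewrite /eps expr0.
have e1 : eps k = 2 * eps k.+1 by rewrite epsS mulrC divfK.
have e2 : eps k.+2 = eps k.+1 / 2 by rewrite epsS.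
have e4 : eps k.+4 = eps k.+1 / 8 by rewrite !epsS; field.
have h1 := second_difference_average t0.
have h2 : (\int[mu]_(s in `](t / 4)%R, (3 * t / 2)%R]) w s)%R <=
     (3 * t / 2) ^+ 2 * (j k + j k.+1 + j k.+2 + j k.+3).
  rewrite -lee_fin; apply: le_trans (weight_bound _ _) _; [lra|lra|].
  rewrite (EFinM (_ ^+ 2) (_ + _)); apply: lee_wpmul2l; first by rewrite lee_fin sqr_ge0.
  have -> : (j k + j k.+1 + j k.+2 + j k.+3)%:E = (\sum_(k <= i < k.+4) J i)%E.
    by rewrite jE /index_iota -[k.+4]/(4 + k)%N addnK /= !big_cons big_nil addr0 !addrA.
  rewrite -Jsplit; last by rewrite -[k.+4]/(4 + k)%N leq_addl.
  apply: ge0_subset_integral => //; first by apply: measurable_weight; rewrite ltW.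
  by apply: subset_itv; rewrite bnd_simp ?e4 ?e1; lra.
set S := j k + _ + _ + _ in h2 *.
have S0 : 0 <= S by rewrite !addr_ge0.
have h3 : w t * t <= t * (18 * t * S).
  apply: le_trans h1 _; apply: le_trans (ler_wpM2l _ h2) _ => //.
  by rewrite le_eqVlt; apply/orP; left; apply/eqP; field.
have h4 : w t <= 18 * t * S by rewrite mulrC ler_pM2l in h3.
apply: le_trans h4 _; rewrite /c -/S.
have -> : eps k.+1 * (18 * S) = 18 * eps k.+1 * S by ring.
by rewrite ler_wpM2r// ler_wpM2l.
Qed.

Let sumc : summable_seq c.
Proof.
pose c' k := (if k is _.+1 then 0 else L) + 36 * (j k.-1 + j k + j k.+1 + j k.+2).
apply: (@summable_seq_le _ _ c'); last first.
  case=> [|k] /=; rewrite /c' /= ?lexx ?L0 /=.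
    by rewrite lerDl mulr_ge0// !addr_ge0.
  rewrite add0r mulr_ge0 ?addr_ge0//= ler_wpM2r ?addr_ge0//.
  by rewrite ler_nat.
have sp : summable_seq (fun k => j k.-1).
  split; first by move=> k.
  have [j0 [S hS]] := sumj; have S0 : 0 <= S by have := hS 0%N; rewrite big_ord0.
  exists (j 0%N + S); case=> [|n]; first by rewrite big_ord0 addr_ge0.
  by rewrite big_ord_recl/= lerD2l; apply: hS.
apply: summable_seqD.
  split; first by case.
  by exists L; case=> [|n]; rewrite ?big_ord0// big_ord_recl/= big1 ?addr0.
apply: summable_seqZ => //.
have s1 := summable_seqS sumj; have s2 := summable_seqS s1.
by do 2 (apply: summable_seqD => //); apply: summable_seqD.
Qed.

(** The bounds on single blocks must become bounds on all of [[0, eps k]]. The suprema divided by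
    [eps k] satisfy [p k <= c k + p k.+1 / 2], and the factor 1/2 lets the partial sums absorb the
    last term. *)
Lemma zygmund_integral : exists p : nat -> R, summable_seq p /\
  forall k t, 0 <= t <= eps k -> w t <= eps k * p k.
Proof.
pose A k := [set w t | t in [set t | 0 <= t <= eps k]].
have wLe k t : 0 <= t <= eps k -> w t <= L * eps k.
  move=> /andP[t0 tk]; have := wL 0 t; rewrite w00 add0r subr0 ger0_norm// => h1.
  by apply: le_trans h1 _; rewrite ler_wpM2l.
have supA k : has_sup (A k).
  split; first by exists (w 0), 0 => //=; rewrite lexx ltW.
  by exists (L * eps k) => _ [t /= ht <-]; apply: wLe.
pose s k := sup (A k).
have ws k t : 0 <= t <= eps k -> w t <= s k.
  by move=> ht; apply: ub_le_sup; [case: (supA k)|exists t].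
have s0 k : 0 <= s k by apply: le_trans (ws k 0 _) => //; rewrite lexx ltW.
have sL k : s k <= L * eps k.
  by apply: ge_sup; [case: (supA k)|move=> _ [t /= ht <-]; apply: wLe].
have sc k : s k <= eps k * c k + s k.+1.
  apply: ge_sup; first by case: (supA k).
  move=> _ [t /= /andP[t0 tk] <-].
  have [tk1|tk1] := leP t (eps k.+1).
    apply: le_trans (ws k.+1 t _) _; first by rewrite t0.
    by rewrite lerDr mulr_ge0 ?(ltW (eps_gt0 _))//; apply: sumc.1.
  apply: le_trans (@wc k t _) _; first by rewrite tk (ltW tk1).
  by rewrite lerDl.
pose p k := s k / eps k.
have p0 k : 0 <= p k by rewrite divr_ge0// ltW.
have pc k : p k <= c k + p k.+1 / 2.
  rewrite /p ler_pdivrMr// mulrDl epsS; apply: le_trans (sc k) _.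
  rewrite mulrC le_eqVlt; apply/orP; left; apply/eqP; field.
  by rewrite gt_eqF.
have pL k : p k <= L by rewrite /p ler_pdivrMr.
exists p; split; last first.
  by move=> k t ht; rewrite /p mulrC divfK ?gt_eqF//; apply: ws.
split=> //; have [c0 [S hS]] := sumc; exists (2 * S + L) => n.
have h1 : \sum_(k < n) p k <= \sum_(k < n) c k + (\sum_(k < n) p k.+1) / 2.
  by rewrite mulr_suml -big_split/=; apply: ler_sum => k _.
have h2 : \sum_(k < n) p k.+1 <= \sum_(k < n) p k + p n.
  have : \sum_(k < n.+1) p k = p 0%N + \sum_(k < n) p k.+1 by rewrite big_ord_recl.
  by rewrite big_ord_recr/= => ->; rewrite lerDr.
have := hS n; have := pL n; lra.
Qed.

End ZygmundIntegral.

Section OperatorNorm.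
Context {R : realType} {H : hilbertType R}.
Implicit Types (B : H -> H).

Lemma unit_ballE (x : H) : (`|x| <= 1) = (rnorm x <= 1).
Proof. by rewrite norm_rnorm -lecR. Qed.

Lemma opnorm_le B M : 0 <= M -> bnd M B -> opnorm B <= M.
Proof.
move=> M0 hB; rewrite /opnorm; apply: ge_sup.
  by exists (rnorm (B 0)), 0 => //=; rewrite normr0.
move=> _ [x /= + <-]; rewrite unit_ballE => x1.
by apply: le_trans (hB x) _; rewrite ler_piMr.
Qed.

Lemma opnorm_bnd B M : 0 <= M -> linear B -> bnd M B -> bnd (opnorm B) B.
Proof.
move=> M0 linB hB x.
have sB : has_sup [set rnorm (B x) | x in [set x : H | `|x| <= 1]].
  split; first by exists (rnorm (B 0)), 0 => //=; rewrite normr0.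
  exists M => _ [y /= + <-]; rewrite unit_ballE => y1.
  by apply: le_trans (hB y) _; rewrite ler_piMr.
have [x0|x0] := eqVneq (rnorm x) 0.
  by rewrite (rnorm_eq0 x0) (lop0 linB) !rnorm0 mulr0.
have xp : 0 < rnorm x by rewrite lt_def x0 rnorm_ge0.
pose y := ((rnorm x)^-1)%:C *: x.
have y1 : rnorm y = 1 by rewrite rnormZ cnR ger0_norm ?invr_ge0 ?rnorm_ge0// mulVf.
have : rnorm (B y) <= opnorm B.
  by apply: ub_le_sup; [case: sB|exists y => //=; rewrite unit_ballE y1].
by rewrite (lopZ linB) rnormZ cnR ger0_norm ?invr_ge0 ?rnorm_ge0// ler_pdivrMl// mulrC.
Qed.

Lemma opnorm_ge0 B : 0 <= opnorm B.
Proof.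
rewrite /opnorm; have [hs|/sup_out ->//] :=
  pselect (has_sup [set rnorm (B x) | x in [set x : H | `|x| <= 1]]).
apply: le_trans (rnorm_ge0 (B 0)) _; apply: ub_le_sup; first by case: hs.
by exists 0 => //=; rewrite normr0.
Qed.

End OperatorNorm.

Section Regularity.
Context {R : realType} {H : hilbertType R}.
Variables (A : partial_op H) (W : R -> H -> H) (U T : H -> H) (b : R).
Hypothesis WA : unitary_group A W.
Hypothesis denseA : dense (dom A).
Hypothesis uU : unitary U.
Hypotheses (adT : is_ad A U T) (bT : bnd b T) (b0 : 0 <= b).

Let gW := unitary_group_ugroup WA.
Let adjU := unitary_adjp uU.
Let bU : bnd 1 U. Proof. by move=> x; rewrite (unitary_iso x uU) mul1r. Qed.
Let D t x := W t (U (W (- t) x)) + W (- t) (U (W t x)) - 2 *: U x.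
Let w t := opnorm (D t).

Let DE t : D t = fun x => conj_op W U t x + conj_op W U (- t) x - 2 *: U x.
Proof. by apply/funext => x; rewrite /D /conj_op opprK. Qed.

Let linD t : linear (D t).
Proof.
have := adjpB (adjpD (adjp_conj gW t adjU) (adjp_conj gW (- t) adjU)) (adjpZ 2 adjU).
by rewrite -DE => /adjp_linear.
Qed.

Let bD t : bnd 4 (D t).
Proof.
rewrite DE; have -> : 4 = (1 + 1) + cn (2 : R[i]) * 1 :> R.
  by rewrite -(rmorph_nat (real_complex R)) cnR ger0_norm//; ring.
by apply: bndB; [apply: bndD; apply: (conj_bnd gW)|apply: bndZ].
Qed.

Let wD t : bnd (w t) (D t). Proof. exact: opnorm_bnd (linD t) (bD t). Qed.

Let w_ge0 t : 0 <= w t. Proof. exact: opnorm_ge0. Qed.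

Let conjB t s : bnd (b * `|t - s|) (fun x => conj_op W U t x - conj_op W U s x).
Proof.
move=> x; have -> : conj_op W U t x - conj_op W U s x =
   W s (conj_op W U (t - s) (W (- s) x) - U (W (- s) x)).
  rewrite (lopB (group_linear gW s)); congr (_ - _).
  rewrite -[RHS]/(conj_op W (conj_op W U (t - s)) s x) (conj_opD gW).
  by rewrite addrC subrK.
rewrite (group_iso gW) -(group_iso gW (- s) x).
exact: (conj_lip WA denseA adjU bU adT bT b0).
Qed.

Lemma in_C11_zygmund :
  (\int[lebesgue_measure]_(t in `]0%R, 1%R]) (opnorm (D t) / t ^+ 2)%:E < +oo)%E ->
  exists p, summable_seq p /\ zygmund W U p.
Proof.
move=> hI.
have wL s t : w t <= w s + 2 * b * `|t - s|.
  apply: opnorm_le; first by rewrite addr_ge0 ?mulr_ge0.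
  move=> x; have -> : D t x = D s x + ((conj_op W U t x - conj_op W U s x) +
     (conj_op W U (- t) x - conj_op W U (- s) x)) by rewrite !DE; hring.
  apply: le_trans (rnormD _ _) _; rewrite mulrDl; apply: lerD; first exact: wD.
  apply: le_trans (rnormD _ _) _.
  have h1 := conjB t s x; have h2 := conjB (- t) (- s) x.
  by rewrite -opprD normrN in h2; lra.
have w00 : w 0 = 0.
  apply/eqP; rewrite eq_le w_ge0 andbT; apply: opnorm_le => // x.
  by rewrite DE oppr0 (conj_op0 gW) mul0r -mulr2n -scaler_nat subrr rnorm0.
have w2 s t : 2 * w t <= 2 * w s + w (t + s) + w (t - s).
  have -> : 2 * w s + w (t + s) + w (t - s) = 2 * (w s + (w (t + s) + w (t - s)) / 2) by field.
  rewrite ler_pM2l//; apply: opnorm_le; first by rewrite addr_ge0 ?divr_ge0 ?addr_ge0.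
  move=> x.
  have h1 := wD (t + s) x; have h2 := wD (t - s) x.
  have h3 : rnorm (W t (D s (W (- t) x))) <= w s * rnorm x.
    by rewrite (group_iso gW) -(group_iso gW (- t) x); apply: wD.
  have h4 : rnorm (W (- t) (D s (W t x))) <= w s * rnorm x.
    by rewrite (group_iso gW) -(group_iso gW t x); apply: wD.
  (* The source of [w2]: conjugating [D s] by [W t] and by [W (- t)] produces exactly the excess of
     [D (t + s) + D (t - s)] over [2 D t]. *)
  have e : 2 *: D t x = (D (t + s) x + D (t - s) x)
     - (W t (D s (W (- t) x)) + W (- t) (D s (W t x))).
    have l1 := group_linear gW t; have l2 := group_linear gW (- t).
    rewrite !DE !(lopB l1) !(lopD l1) !(lopZ l1) !(lopB l2) !(lopD l2) !(lopZ l2).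
    have f1 r : W t (conj_op W U r (W (- t) x)) = conj_op W U (t + r) x.
      by rewrite -(conj_opD gW).
    have f2 r : W (- t) (conj_op W U r (W t x)) = conj_op W U (- t + r) x.
      by rewrite -(conj_opD gW) /conj_op opprK.
    have f3 : W t (U (W (- t) x)) = conj_op W U t x by [].
    have f4 : W (- t) (U (W t x)) = conj_op W U (- t) x by rewrite /conj_op opprK.
    rewrite !f1 !f2 f3 f4 opprD opprB (addrC s (- t)).
    have -> : (2 : R[i]) *: (conj_op W U t x + conj_op W U (- t) x - 2 *: U x) =
      2 *: conj_op W U t x + 2 *: conj_op W U (- t) x - 4 *: U x by hring.
    by rewrite (addrC (- t) s); hring.
  have : 2 * rnorm (D t x) <= (w (t + s) + w (t - s) + 2 * w s) * rnorm x.
    have -> : 2 * rnorm (D t x) = rnorm (2 *: D t x).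
      by rewrite rnormZ -(rmorph_nat (real_complex R)) cnR ger0_norm.
    rewrite e; apply: le_trans (rnormB _ _) _.
    have := rnormD (D (t + s) x) (D (t - s) x).
    have := rnormD (W t (D s (W (- t) x))) (W (- t) (D s (W t x))).
    lra.
  lra.
have [p [sp hp]] := zygmund_integral w_ge0 wL w00 w2 hI.
exists p; split => // k t x tk.
have wN s : w (- s) = w s.
  by rewrite /w !DE; congr opnorm; apply/funext => y; rewrite opprK (addrC (conj_op _ _ (- s) y)).
rewrite -[leLHS]/(rnorm ((fun x => conj_op W U t x + conj_op W U (- t) x - 2 *: U x) x)) -DE.
apply: le_trans (wD _ _) _; rewrite ler_wpM2r ?rnorm_ge0//.
have [t0|t0] := leP 0 t; first by apply: hp; rewrite t0 -(ger0_norm t0).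
by rewrite -wN; apply: hp; rewrite oppr_ge0 (ltW t0)/= -(ltr0_norm t0).
Qed.

End Regularity.

(** * The interpolation space in dyadic form *)

Section Interpolation.
Context {R : realType} {H : hilbertType R}.
Variables (A : partial_op H).
Hypothesis linA : linear_partial_op A.
Let sg k : R := Num.sqrt (2^-1 ^+ k).

(* Discrete form of membership in the space (D(A), H)_{1/2,1}. *)
Definition dyadic_interp (x : H) := exists phi : nat -> H,
  [/\ forall k, dom A (phi k), summable_seq (fun k => sg k * rnorm (A (phi k))) &
      summable_seq (fun k => rnorm (phi k - x) / sg k)].

Let sg_gt0 k : 0 < sg k.
Proof. by rewrite sqrtr_gt0 exprn_gt0// invr_gt0. Qed.

Lemma sum_sg : summable_seq sg.
Proof.
have h : summable_seq (fun k => Num.sqrt (2^-1 : R) ^+ k).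
  apply: summable_geo; rewrite sqrtr_ge0/= -[ltRHS]sqrtr1 ltr_sqrt// invf_lt1// ltr1n//.
apply: summable_seq_le h _ => k; rewrite ltW//=.
rewrite /sg le_eqVlt; apply/orP; left; apply/eqP; elim: k => [|k IH].
  by rewrite !expr0 sqrtr1.
by rewrite !exprS sqrtrM ?invr_ge0// IH.
Qed.

Lemma dyadic_interp_dom x : dom A x -> dyadic_interp x.
Proof.
move=> Dx; exists (fun=> x); split => //.
  have := summable_seqZ (rnorm_ge0 (A x)) sum_sg.
  by move/summable_seq_le; apply => k; rewrite mulrC mulr_ge0 ?rnorm_ge0/= ?(ltW (sg_gt0 _)).
split; first by move=> k; rewrite subrr rnorm0 mul0r.
by exists 0 => n; rewrite big1// => k _; rewrite subrr rnorm0 mul0r.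
Qed.

Lemma dyadic_interp_comb (c : R[i]) x y : dyadic_interp x -> dyadic_interp y ->
  dyadic_interp (c *: x + y).
Proof.
move=> [phi [D1 s1 t1]] [psi [D2 s2 t2]].
have [_ lA] := linA.
exists (fun k => c *: phi k + psi k); split.
- by move=> k; case: (lA c _ _ (D1 k) (D2 k)).
- apply: summable_seq_le (summable_seqD (summable_seqZ (cn_ge0 c) s1) s2) _ => k.
  rewrite mulr_ge0 ?rnorm_ge0 ?(ltW (sg_gt0 _))//=.
  have [_ ->] := lA c _ _ (D1 k) (D2 k).
  rewrite mulrCA -mulrDr ler_wpM2l ?(ltW (sg_gt0 _))//.
  by apply: le_trans (rnormD _ _) _; rewrite rnormZ.
apply: summable_seq_le (summable_seqD (summable_seqZ (cn_ge0 c) t1) t2) _ => k.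
rewrite mulr_ge0 ?rnorm_ge0 ?invr_ge0 ?(ltW (sg_gt0 _))//=.
rewrite mulrA -mulrDl ler_wpM2r ?invr_ge0 ?(ltW (sg_gt0 _))//.
have -> : c *: phi k + psi k - (c *: x + y) = c *: (phi k - x) + (psi k - y) by hring.
by apply: le_trans (rnormD _ _) _; rewrite rnormZ.
Qed.

Lemma graph_norm_ge0 x : 0 <= graph_norm A x. Proof. exact: sqrtr_ge0. Qed.

Lemma graph_norm_ge x : rnorm (A x) <= graph_norm A x.
Proof.
rewrite /graph_norm -[leLHS](ger0_norm (rnorm_ge0 _)) -sqrtr_sqr ler_sqrt//.
  by rewrite lerDr sqr_ge0.
by rewrite addr_ge0 ?sqr_ge0.
Qed.

Section KFunctional.
Variable x : H.
Let K t := K_functional A t x.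
Let S t := [set graph_norm A y + t * rnorm (x - y) | y in dom A].

Let hasS (t : R) : 0 <= t -> has_inf (S t).
Proof.
move=> t0; split; first by case: linA => D0 _; exists (graph_norm A 0 + t * rnorm (x - 0)), 0.
by exists 0 => _ [y _ <-]; rewrite addr_ge0 ?graph_norm_ge0 ?mulr_ge0 ?rnorm_ge0.
Qed.

Let K_ge0 (t : R) : 0 <= t -> 0 <= K t.
Proof.
move=> t0; apply: lb_le_inf; first by case: (hasS t0).
by move=> _ [y _ <-]; rewrite addr_ge0 ?graph_norm_ge0 ?mulr_ge0 ?rnorm_ge0.
Qed.

Let K_le (t : R) y : 0 <= t -> dom A y -> K t <= graph_norm A y + t * rnorm (x - y).
Proof. by move=> t0 Dy; apply: ge_inf; [case: (hasS t0)|exists y]. Qed.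

Let K_mono (s t : R) : 0 <= s -> s <= t -> K s <= K t.
Proof.
move=> s0 st; apply: lb_le_inf; first by case: (hasS (le_trans s0 st)).
move=> _ [y Dy <-]; apply: le_trans (K_le s0 Dy) _.
by rewrite lerD2l ler_wpM2r ?rnorm_ge0.
Qed.

Let K_lip (s t : R) : 0 < s -> s <= t -> K t <= K s + (t - s) * rnorm x.
Proof.
move=> s0 st; have t0 : 0 <= t by rewrite (le_trans (ltW s0)).
have Ks : K s <= s * rnorm x.
  have [D0 lA] := linA; apply: le_trans (K_le (ltW s0) D0) _.
  have A0 : A 0 = 0.
    have [_] := lA (-1) 0 0 D0 D0; rewrite scaler0 addr0 => ->.
    by rewrite scaleN1r addNr.
  by rewrite subr0 /graph_norm A0 rnorm0 expr0n/= addr0 sqrtr0 add0r.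
(* As [t / s >= 1], multiplying a candidate for [K s] by [t / s] dominates the corresponding
   candidate for [K t]. With monotonicity this gives continuity, hence measurability of the
   integrand. *)
have h : K t <= t / s * K s.
  rewrite -ler_pdivrMl ?divr_gt0//; last exact: lt_le_trans st.
  apply: lb_le_inf; first by case: (hasS (ltW s0)).
  move=> _ [y Dy <-]; rewrite ler_pdivrMl ?divr_gt0//; last exact: lt_le_trans st.
  apply: le_trans (K_le t0 Dy) _; rewrite mulrDr; apply: lerD.
    by rewrite ler_peMl ?graph_norm_ge0// ler_pdivlMr// mul1r.
  by rewrite mulrA divfK// gt_eqF.
apply: le_trans h _.
have -> : t / s * K s = K s + (t - s) * (K s / s) by field; rewrite gt_eqF.
by rewrite lerD2l ler_wpM2l ?subr_ge0// ler_pdivrMr// mulrC.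
Qed.

Let K_cont (t : R) : 0 < t -> {for t, continuous K}.
Proof.
move=> t0; apply/cvgrPdist_lt => e e0.
have x1 : 0 < rnorm x + 1 by rewrite ltr_wpDl ?rnorm_ge0.
near=> s.
have s0 : 0 < s by near: s; apply: lt_nbhsr => //; exact: nbhs_gt.
have st : `|t - s| < e / (rnorm x + 1).
  by near: s; apply: cvgr_dist_lt => //; rewrite divr_gt0.
move: st; rewrite ltr_pdivlMr// mulrDr mulr1 => st.
have [ts|ts] := leP t s.
  have h1 := K_lip t0 ts; have h2 := K_mono (ltW t0) ts.
  rewrite ler0_norm ?subr_le0//; rewrite ler0_norm ?subr_le0// in st; lra.
have h1 := K_lip s0 (ltW ts); have h2 := K_mono (ltW s0) (ltW ts).
rewrite ger0_norm ?subr_ge0//; rewrite ger0_norm ?subr_ge0// in st; last exact: ltW; lra.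
Unshelve. all: by end_near. Qed.

Let g (t : R) := t `^ (- 2^-1) * K t / t.

Let mg : measurable_fun `](0 : R), +oo[ g.
Proof.
apply: open_continuous_measurable_fun => // t; rewrite inE/= in_itv/= andbT => t0.
apply: cvgM; last by apply: cvgV => //; rewrite gt_eqF.
apply: cvgM; last exact: (K_cont t0).
have dp : derivable (fun a : R => a `^ (- 2^-1)) t 1.
  by apply: derivable_powR; rewrite in_itv/= andbT.
by move: dp => /derivable1_diffP/differentiable_continuous.
Qed.

Let g_ge0 (t : R) : 0 < t -> 0 <= g t.
Proof. by move=> t0; rewrite !mulr_ge0 ?powR_ge0 ?invr_ge0 ?K_ge0 ?ltW. Qed.

Lemma interpolation_dyadic_sum : interpolation1 A (2^-1) x ->
  summable_seq (fun k => sg k * K (2 ^+ k)).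
Proof.
rewrite /interpolation1/= => hI.
pose mu := @lebesgue_measure R.
split; first by move=> k; rewrite mulr_ge0 ?(ltW (sg_gt0 _))// K_ge0// exprn_ge0.
pose I := fine (\int[mu]_(t in `]0%R, +oo[) (g t)%:E)%E.
have gI : (\int[mu]_(t in `]0%R, +oo[) (g t)%:E)%E = I%:E.
  rewrite /I fineK// ge0_fin_numE//; apply: integral_ge0 => t/=.
  by rewrite in_itv/= andbT => t0; rewrite lee_fin g_ge0.
have mgE (a : R) (b : itv_bound R) : 0 <= a -> measurable_fun [set` Interval (BRight a) b] (EFin \o g).
  move=> a0; apply/measurable_EFinP; apply: measurable_funS mg => //.
  by move=> t /=; rewrite !in_itv/= andbT => /andP[+ _]; apply: le_lt_trans.
have gE0 (a : R) (b : itv_bound R) (t : R) : 0 <= a -> [set` Interval (BRight a) b] t -> (0 <= (g t)%:E)%E.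
  move=> a0 /=; rewrite in_itv/= => /andP[+ _] => at0.
  by rewrite lee_fin g_ge0// (le_lt_trans a0).
(* On []2^k, 2^(k+1)]] the integrand is at least [sg k.+1 * K (2^k) / 2^(k+1)], over a length [2^k];
   the product is [c * (sg k * K (2^k))]. *)
pose c := Num.sqrt (2^-1 : R) / 2.
have c0 : 0 < c by rewrite divr_gt0// sqrtr_gt0 invr_gt0.
exists (I / c) => n.
have piece k : ((c * (sg k * K (2 ^+ k)))%R%:E <=
    \int[mu]_(t in `](2 ^+ k)%R, (2 ^+ k.+1)%R]) (g t)%:E)%E.
  pose a : R := 2 ^+ k; have a0 : 0 < a by rewrite exprn_gt0.
  have a2 : 2 ^+ k.+1 = 2 * a by rewrite exprS.
  pose m := sg k.+1 * K a / (2 * a).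
  have m0 : 0 <= m by rewrite !mulr_ge0 ?(ltW (sg_gt0 _)) ?K_ge0 ?invr_ge0 ?mulr_ge0 ?(ltW a0).
  have -> : c * (sg k * K (2 ^+ k)) = m * a.
    have -> : c = sg k.+1 / sg k / 2.
      rewrite /c /sg exprS sqrtrM ?invr_ge0//; field.
      by rewrite gt_eqF// -/(sg k).
    rewrite -/a /m; field; rewrite !gt_eqF//; exact: sg_gt0.
  have -> : (m * a)%:E = (\int[mu]_(t in `](2 ^+ k)%R, (2 ^+ k.+1)%R]) (cst m%:E t))%E.
    rewrite integral_cst//= lebesgue_measure_itv/= lte_fin a2 ifT; last by rewrite -/a; lra.
    by rewrite -EFinB -/a -EFinM; congr (_ %:E); ring.
  apply: ge0_le_integral => //.
  - by apply: mgE; rewrite ltW.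
  move=> t /=; rewrite in_itv/= a2 -/a => /andP[at0 ta]; rewrite lee_fin.
  have t0 : 0 < t := lt_trans a0 at0.
  rewrite /g /m; apply: ler_pM.
  - by rewrite mulr_ge0 ?(ltW (sg_gt0 _)) ?K_ge0 ?(ltW a0).
  - by rewrite invr_ge0 mulr_ge0// ltW.
  - apply: ler_pM; rewrite ?(ltW (sg_gt0 _)) ?K_ge0 ?(ltW a0)//; last by rewrite K_mono// ltW.
    rewrite powRN powR12_sqrt ?(ltW t0)// /sg exprVn sqrtrV ?exprn_ge0//.
    by rewrite lef_pV2 ?posrE ?sqrtr_gt0 ?exprn_gt0// ler_sqrt ?exprn_ge0// a2.
  - by rewrite lef_pV2 ?posrE ?mulr_gt0.
have tot : ((\sum_(k < n) c * (sg k * K (2 ^+ k)))%R%:E <=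
    \int[mu]_(t in `]1%R, (2 ^+ n)%R]) (g t)%:E)%E.
  elim: n => [|n IH].
    by rewrite big_ord0 expr0 set_itvoc0// integral_set0.
  rewrite big_ord_recr/= EFinD.
  have n1 : 1 <= 2 ^+ n :> R by rewrite exprn_ege1// ler1n.
  have n2 : 2 ^+ n <= 2 ^+ n.+1 :> R by rewrite exprS ler_peMl ?exprn_ge0// ler1n.
  have -> : `](1 : R), (2 ^+ n.+1)]%classic = `]1, (2 ^+ n)] `|` `](2 ^+ n), (2 ^+ n.+1)].
    by rewrite -(@itv_bndbnd_setU _ _ _ (BRight (2 ^+ n : R)))//= bnd_simp.
  rewrite ge0_integral_setU//; last 3 first.
  - rewrite -(@itv_bndbnd_setU _ _ _ (BRight (2 ^+ n : R)))//= ?bnd_simp//.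
    exact: mgE.
  - move=> t; rewrite -(@itv_bndbnd_setU _ _ _ (BRight (2 ^+ n : R)))//= ?bnd_simp//.
    exact: gE0.
  - apply/disj_setPS => t [/=]; rewrite !in_itv/= => /andP[_ xn] /andP[nx _].
    by have := lt_le_trans nx xn; rewrite ltxx.
  by apply: leeD => //; apply: piece.
rewrite ler_pdivlMr// mulrC mulr_sumr -lee_fin -gI; apply: le_trans tot _.
apply: ge0_subset_integral => //.
- exact: mgE.
- by move=> t; apply: gE0.
- by apply: subset_itv; rewrite bnd_simp.
Qed.

(** Near-minimizers of the K-functional at [2^k] serve as approximants. The slack 1 is harmless
    because [sg] is summable, and [sg k ^+ 2 = 2^-k] converts the weight [2^k] of the K-functional
    into the required one. *)
Lemma interpolation_dyadic : interpolation1 A (2^-1) x -> dyadic_interp x.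
Proof.
move=> /interpolation_dyadic_sum sK.
have ch k : exists y, dom A y /\ graph_norm A y + 2 ^+ k * rnorm (x - y) < K (2 ^+ k) + 1.
  have [_ [y Dy <-] hy] := inf_adherent ltr01 (hasS (exprn_ge0 k (ler0n R 2))).
  by exists y.
pose phi k := projT1 (cid (ch k)).
have Dphi k : dom A (phi k) by rewrite /phi; case: cid => y [].
have hphi k : graph_norm A (phi k) + 2 ^+ k * rnorm (x - phi k) < K (2 ^+ k) + 1.
  by rewrite /phi; case: cid => y [].
have sK1 := summable_seqD sK sum_sg.
exists phi; split => //.
  apply: summable_seq_le sK1 _ => k; rewrite mulr_ge0 ?rnorm_ge0 ?(ltW (sg_gt0 _))//=.
  rewrite -[X in _ + X]mulr1 -mulrDr ler_wpM2l ?(ltW (sg_gt0 _))//.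
  apply: le_trans (graph_norm_ge _) _; apply: le_trans (ltW (hphi k)).
  by rewrite lerDl mulr_ge0 ?rnorm_ge0 ?exprn_ge0.
apply: summable_seq_le sK1 _ => k; rewrite mulr_ge0 ?rnorm_ge0 ?invr_ge0 ?(ltW (sg_gt0 _))//=.
rewrite ler_pdivrMr//.
have -> : (sg k * K (2 ^+ k) + sg k) * sg k = sg k ^+ 2 * (K (2 ^+ k) + 1) by ring.
rewrite sqr_sqrtr ?exprn_ge0 ?invr_ge0// -ler_pdivrMl ?exprn_gt0 ?invr_gt0// exprVn invrK rdistC.
by apply: le_trans (ltW (hphi k)); rewrite lerDr graph_norm_ge0.
Qed.

End KFunctional.
End Interpolation.

(** * Spectral measures *)

Section Torus.
Context {R : realType}.

Definition torus_ball (l : R[i]) (r : R) : set (borel_torus R) :=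
  [set t : torus R | cn (set_val t - l) < r].

Lemma cn_torus (t : torus R) : cn (set_val t) = 1.
Proof. by have := set_valP t; rewrite /circle_set/= /cn => ->. Qed.

Lemma torus_open_pre (B : set R[i]^o) : open B -> open (set_val @^-1` B : set (torus R)).
Proof. by move=> oB; exists B. Qed.

Lemma open_cn (l : R[i]) (r : R) : open ([set z | cn (z - l) < r] : set R[i]^o).
Proof.
rewrite openE => z /= zr; apply/nbhs_cn; exists (r - cn (z - l)); first by rewrite subr_gt0.
move=> y yz /=; have := cnD (y - z) (z - l); rewrite addrA subrK; lra.
Qed.

Lemma open_measurable_torus (A : set (torus R)) : open A -> measurable (A : set (borel_torus R)).
Proof. by move=> oA; apply: sub_sigma_algebra. Qed.

Lemma torus_ball_measurable l r : measurable (torus_ball l r).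
Proof.
have h : open (torus_ball l r : set (torus R)) := torus_open_pre (@open_cn l r).
exact: open_measurable_torus h.
Qed.

Lemma torus_open_ball (A : set (torus R)) t : open A -> A t ->
  exists2 r : R, 0 < r & torus_ball (set_val t) r `<=` A.
Proof.
move=> [B oB <-] /= Bt; have := open_nbhs_nbhs (conj oB Bt).
by move=> /nbhs_cn[r r0 h]; exists r => // s /= hs; apply: h.
Qed.

Let part_measurable (f : R[i] -> R) : (forall a b, `|f a - f b| <= cn (a - b)) ->
  measurable_fun setT (fun t : borel_torus R => f (set_val t)).
Proof.
move=> hf; apply: (measurability _ (RGenOpens.measurableE R)).
move=> _ [_ [a [b ->] <-]]; rewrite setTI; apply: open_measurable_torus.
rewrite (_ : _ @^-1` _ = set_val @^-1` [set z | a < f z < b]); last first.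
  by apply/seteqP; split=> t /=; rewrite in_itv.
apply: torus_open_pre; rewrite openE => z /= /andP[az zb].
apply/nbhs_cn; exists (Num.min (f z - a) (b - f z)).
  by rewrite lt_min !subr_gt0 az.
move=> y; rewrite lt_min => /andP[h1 h2]; have := hf y z; rewrite ler_norml => /andP[h3 h4].
by apply/andP; split; lra.
Qed.

Lemma measurable_Re_torus : measurable_fun setT (fun t : borel_torus R => complex.Re (set_val t)).
Proof.
apply: (part_measurable (f := @complex.Re R)) => a b.
by apply: le_trans (cn_Re _); case: a; case: b.
Qed.

Lemma measurable_Im_torus : measurable_fun setT (fun t : borel_torus R => complex.Im (set_val t)).
Proof.
apply: (part_measurable (f := @complex.Im R)) => a b.
rewrite -(@ler_pXn2r _ 2)// ?nnegrE ?cn_ge0// cn_sqr real_normK ?num_real//.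
by case: a => ? ?; case: b => ? ? /=; rewrite lerDr sqr_ge0.
Qed.

(** On the circle this square is affine in the real and imaginary parts of [t], so its integral
    follows from the first moments given by [spectral_family]. *)
Lemma cn_1sub (z : R[i]) (t : torus R) : cn (1 - z * set_val t) ^+ 2 =
  1 + cn z ^+ 2 - 2 * (complex.Re z * complex.Re (set_val t) - complex.Im z * complex.Im (set_val t)).
Proof.
have := cn_sqr (set_val t : R[i]); rewrite cn_torus expr1n.
rewrite !cn_sqr; case: (set_val t) => c d; case: z => a b /= h.
have -> : (0 - (a * d + b * c)) ^+ 2 = (a * d + b * c) ^+ 2 by ring.
have : (1 - (a * c - b * d)) ^+ 2 + (a * d + b * c) ^+ 2 =
   1 + (a ^+ 2 + b ^+ 2) * (c ^+ 2 + d ^+ 2) - 2 * (a * c - b * d) by ring.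
by rewrite -h mulr1.
Qed.

End Torus.

Section ProjectionValuedMeasure.
Context {R : realType} {H : hilbertType R}.
Variable E : set (borel_torus R) -> H -> H.
Hypothesis HP : projection_valued_measure E.
Implicit Types (x y : H) (D : set (borel_torus R)).

Lemma pvm_adj D : measurable D -> adjp (E D) (E D).
Proof. by case: HP => h _ _ _ /h[_ _ +] x y; apply. Qed.

Lemma pvm_linear D : measurable D -> linear (E D).
Proof. by move=> mD; apply: adjp_linear (pvm_adj mD). Qed.

Lemma pvm_idem D x : measurable D -> E D (E D x) = E D x.
Proof. by case: HP => h _ _ _ /h[_ + _] => e; rewrite -[LHS]/((E D \o E D) x) e. Qed.

Lemma pvm_setI D D' x : measurable D -> measurable D' -> E (D `&` D') x = E D (E D' x).
Proof. by case: HP => _ _ h _ mD mD'; rewrite h. Qed.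

Lemma pvm_setT x : E setT x = x.
Proof. by case: HP => _ ->. Qed.

Lemma pvm_re D x : measurable D -> re x (E D x) = rnorm (E D x) ^+ 2.
Proof. by move=> mD; rewrite -re_rnorm /re (pvm_adj mD) pvm_idem. Qed.

Lemma pvm_le D x : measurable D -> rnorm (E D x) <= rnorm x.
Proof.
move=> mD; have := re_le x (E D x); rewrite pvm_re// expr2.
have [->|x0] := eqVneq (rnorm (E D x)) 0; first by rewrite rnorm_ge0.
by rewrite ler_pM2r// lt_def x0 rnorm_ge0.
Qed.

Lemma pvm_set0 x : E set0 x = 0.
Proof.
case: HP => _ _ _ /(_ (fun=> set0)) h; 
have tr : trivIset setT (fun _ : nat => set0 : set (borel_torus R)) by move=> i j _ _ [t []].
have {}h := h (fun=> measurable0) tr x.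
rewrite bigcup0// in h; apply: rnorm_eq0; apply/eqP; rewrite eq_le rnorm_ge0 andbT.
apply/ler_addgt0Pl => e e0; rewrite addr0.
have /cvg_rnorm/(_ (e / 2)) := h; rewrite divr_gt0// => /(_ isT) [N _ hN].
(* Consecutive partial sums of the constant series differ by [E set0 x], which must therefore be
   small. *)
have h1 := hN N (leqnn N); have h2 := hN N.+1 (leqnSn N).
rewrite /= big_nat_recr//= in h2; rewrite /= in h1.
set S := \sum_(0 <= _ < N) _ in h1 h2.
have -> : E set0 x = (S + E set0 x - E set0 x) - (S - E set0 x) by hring.
by apply: le_trans (rnormB _ _) _; lra.
Qed.

Lemma pvm_setU D D' x : measurable D -> measurable D' -> D `&` D' = set0 ->
  E (D `|` D') x = E D x + E D' x.
Proof.
move=> mD mD' DD; case: HP => _ _ _ /(_ (bigcup2 D D')) h.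
have mF n : measurable (bigcup2 D D' n).
  by case: n => [|[|n]]; [exact: mD|exact: mD'|exact: measurable0].
have tF : trivIset setT (bigcup2 D D') by rewrite -trivIset_bigcup2.
have := h mF tF x; rewrite bigcup2E => /cvg_rnorm {}h.
apply/eqP; rewrite -subr_eq0; apply/eqP/rnorm_eq0/eqP; rewrite eq_le rnorm_ge0 andbT.
apply/ler_addgt0Pl => e e0; rewrite addr0.
have [N _ hN] := h e e0; have := hN N.+2 (leq_trans (leqnSn _) (leqnSn _)).
rewrite /= big_ltn// big_ltn// big_nat_cond big1 => [|[|[|k]]]//; last first.
  by rewrite pvm_set0.
by rewrite addr0 rdistC => /ltW.
Qed.

Lemma pvm_setC D x : measurable D -> x = E D x + E (~` D) x.
Proof.
by move=> mD; rewrite -pvm_setU ?setICr// ?setUv ?pvm_setT//; exact: measurableC.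
Qed.

Lemma pvm_pythagoras D x : measurable D ->
  rnorm x ^+ 2 = rnorm (E D x) ^+ 2 + rnorm (E (~` D) x) ^+ 2.
Proof.
move=> mD; rewrite {1}(pvm_setC x mD) rnormD_sqr.
have -> : re (E D x) (E (~` D) x) = 0.
  rewrite /re (pvm_adj mD) -pvm_setI//; last exact: measurableC.
  by rewrite setICr pvm_set0 inner0r.
by rewrite mulr0 addr0.
Qed.

Lemma spectral_measureE x D : measurable D -> spectral_measure E x D = (rnorm (E D x) ^+ 2)%:E.
Proof. by move=> mD; rewrite /spectral_measure -pvm_re. Qed.

(* spectral_measure takes meaningless values on the sets that are not Borel;
   they are replaced by 0 so as to obtain a measure. *)
Definition pvm_mass x D : \bar R :=
  if `[< measurable D >] then spectral_measure E x D else 0%E.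

Let mu0 x : pvm_mass x set0 = 0%E.
Proof.
by rewrite /pvm_mass ifT ?spectral_measureE// ?pvm_set0 ?rnorm0 ?expr0n//; apply/asboolP.
Qed.

Let mu_ge0 x D : (0 <= pvm_mass x D)%E.
Proof.
by rewrite /pvm_mass; case: asboolP => // mD; rewrite spectral_measureE// lee_fin sqr_ge0.
Qed.

Lemma pvm_massE x D : measurable D -> pvm_mass x D = (rnorm (E D x) ^+ 2)%:E.
Proof. by move=> mD; rewrite /pvm_mass ifT ?spectral_measureE//; apply/asboolP. Qed.

Let mu_sigma x : semi_sigma_additive (pvm_mass x).
Proof.
move=> F mF tF mUF; rewrite pvm_massE//.
have -> : (fun n => (\sum_(0 <= i < n) pvm_mass x (F i))%E) =
    (fun n => (re x (\sum_(0 <= i < n) E (F i) x))%:E).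
  apply/funext => n; rewrite /re inner_sumr.
  have -> (c : seq nat) : complex.Re (\sum_(i <- c) inner x (E (F i) x)) =
      \sum_(i <- c) re x (E (F i) x).
    elim: c => [|i c IH]; first by rewrite !big_nil.
    by rewrite !big_cons -IH /re; case: (inner x _) => ? ?; case: (\sum_(j <- c) _).
  by rewrite -sumEFin; apply: eq_bigr => i _; rewrite pvm_massE// pvm_re.
apply: cvg_EFin; first exact: nearW.
rewrite -(pvm_re _ mUF).
case: HP => _ _ _ /(_ F mF tF x) /cvg_rnorm h.
apply/cvgrPdist_lt => e e0.
have x1 : 0 < rnorm x + 1 by rewrite ltr_wpDl ?rnorm_ge0.
have := h (e / (rnorm x + 1)); rewrite divr_gt0// => /(_ isT).
apply: filterS => n /=; rewrite ltr_pdivlMr// => hn.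
rewrite -reBr; apply: le_lt_trans (cn_Re _) _; apply: le_lt_trans (cauchy_schwarz _ _) _.
apply: le_lt_trans hn; rewrite rdistC mulrC ler_wpM2l ?rnorm_ge0//; lra.
Qed.

HB.instance Definition _ x :=
  isMeasure.Build _ _ _ (pvm_mass x) (mu0 x) (@mu_ge0 x) (@mu_sigma x).

Definition scalar_measure x : {measure set (borel_torus R) -> \bar R} := pvm_mass x.

Lemma scalar_measureE x D : measurable D -> scalar_measure x D = (rnorm (E D x) ^+ 2)%:E.
Proof. exact: pvm_massE. Qed.

Import HBNNSimple.
(** [spectral_measure E x] is a bare set function, but its integral only involves preimages under
    measurable simple functions, where it agrees with the measure. *)
Lemma pvm_integral x (f : borel_torus R -> \bar R) :
  (\int[spectral_measure E x]_t f t = \int[scalar_measure x]_t f t)%E.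
Proof.
have e (h : {nnsfun borel_torus R >-> R}) :
    sintegral (spectral_measure E x) h =
    sintegral (scalar_measure x) h.
  apply: eq_fsbigr => r _; congr (_ * _)%E.
  by rewrite scalar_measureE -?spectral_measureE//; exact: measurable_funPTI.
by rewrite /integral; congr (_ - _)%E; congr ereal_sup; apply/seteqP; split => _ [h hg <-];
  exists h => //; rewrite e.
Qed.

Lemma pvm_cover x (N : set (borel_torus R)) (F : nat -> set (borel_torus R)) (c : nat -> R) S :
  measurable N -> (forall n, measurable (F n)) -> N `<=` \bigcup_n F n ->
  (forall n, rnorm (E (F n) x) ^+ 2 <= c n) -> (forall n, \sum_(k < n) c k <= S) ->
  rnorm (E N x) ^+ 2 <= S.
Proof.
move=> mN mF NF hc hS; rewrite -lee_fin -scalar_measureE//.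
have h : (scalar_measure x N <= \sum_(0 <= n <oo) scalar_measure x (F n))%E :=
  measure_sigma_subadditive _ mF mN NF.
apply: le_trans h _.
apply: lime_le; first by apply: is_cvg_nneseries.
apply: nearW => n; apply: le_trans (_ : ((\sum_(k < n) c k)%:E <= _)%E); last by rewrite lee_fin.
rewrite big_mkord -sumEFin; apply: lee_sum => i _.
by rewrite scalar_measureE// lee_fin.
Qed.

Lemma pvm_decreasing x (F : nat -> set (borel_torus R)) :
  (forall n, measurable (F n)) -> (forall n m, (n <= m)%N -> F m `<=` F n) ->
  E (\bigcap_n F n) x = 0 ->
  forall e, 0 < e -> exists N, forall n, (N <= n)%N -> rnorm (E (F n) x) ^+ 2 < e.
Proof.
move=> mF dF F0 e e0.
have mI : measurable (\bigcap_n F n) by exact: bigcapT_measurable.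
have ni : nonincreasing_seq F by move=> n m nm; apply/subsetPset; apply: dF.
have fin : (scalar_measure x (F 0%N) < +oo)%E by rewrite scalar_measureE ?ltry.
have : scalar_measure x (F n) @[n --> \oo] --> scalar_measure x (\bigcap_n F n) :=
  nonincreasing_cvg_mu fin mF mI ni.
rewrite scalar_measureE// F0 rnorm0 expr0n/= (_ : (fun n => _) = EFin \o (fun n => rnorm (E (F n) x) ^+ 2)).
  move=> /fine_cvg /= /cvgrPdist_lt/(_ e e0)[N _ hN].
  exists N => n Nn; have := hN n Nn; rewrite /= sub0r normrN; apply: le_lt_trans.
  exact: ler_norm.
by apply/funext => n /=; rewrite scalar_measureE.
Qed.

End ProjectionValuedMeasure.

Section SpectralFamily.
Context {R : realType} {H : hilbertType R}.
Variables (U : H -> H) (E : set (borel_torus R) -> H -> H).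
Hypotheses (unitaryU : unitary U) (HE : spectral_family U E).
Implicit Types (x y : H) (D : set (borel_torus R)) (t : torus R).

Let HP : projection_valued_measure E := HE.1.
Let mu := scalar_measure HP.

Let U_lin : linear U.
Proof. by case: unitaryU => -[]. Qed.

Lemma bounded_integrable_torus x (f : borel_torus R -> R) M :
  measurable_fun setT f -> (forall t, `|f t| <= M) -> (mu x).-integrable setT (EFin \o f).
Proof.
move=> mf hM; apply: measurable_bounded_integrable => //.
  by rewrite /mu scalar_measureE// ltry.
exists M; split; first exact: num_real.
by move=> K MK t _ /=; apply: le_trans (hM t) (ltW MK).
Qed.

Lemma measurable_cn_1sub (z : R[i]) :
  measurable_fun setT (fun t : borel_torus R => cn (1 - z * set_val t) ^+ 2).
Proof.
rewrite (_ : (fun _ => _) = (fun t : borel_torus R => 1 + cn z ^+ 2 - 2 *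
  (complex.Re z * complex.Re (set_val t) - complex.Im z * complex.Im (set_val t)))); last first.
  by apply/funext => t; rewrite cn_1sub.
apply: measurable_funB; first exact: measurable_cst.
apply: measurable_funM; first exact: measurable_cst.
apply: measurable_funB; apply: measurable_funM; first exact: measurable_cst.
- exact: measurable_Re_torus.
- exact: measurable_cst.
- exact: measurable_Im_torus.
Qed.

(** The only functional calculus in the proof. Expanding the square by unitarity leaves
    [inner x (U x)], which [spectral_family] expresses by the first moments. *)
Lemma quadratic_integral x (z : R[i]) :
  (\int[mu x]_t (cn (1 - z * set_val t) ^+ 2)%:E = (rnorm (x - z *: U x) ^+ 2)%:E)%E.
Proof.
pose f (t : borel_torus R) := complex.Re (set_val t).
pose g (t : borel_torus R) := complex.Im (set_val t).
have fi : (mu x).-integrable setT (EFin \o f).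
  apply: (@bounded_integrable_torus x f 1); first exact: measurable_Re_torus.
  move=> t; apply: le_trans (cn_Re _) _; first by rewrite cn_torus.
have gi : (mu x).-integrable setT (EFin \o g).
  apply: (@bounded_integrable_torus x g 1); first exact: measurable_Im_torus.
  move=> t; rewrite -(@ler_pXn2r _ 2)// ?nnegrE// -(cn_torus t) cn_sqr real_normK ?num_real//.
  by rewrite lerDr sqr_ge0.
pose c := 1 + cn z ^+ 2.
have ci : (mu x).-integrable setT (EFin \o cst c).
  by apply: (@bounded_integrable_torus x (cst c) `|c|) => //; exact: measurable_cst.
have ai r h : (mu x).-integrable setT (EFin \o h) ->
    (mu x).-integrable setT (EFin \o (fun t => r * h t)).
  by move=> hi; have := @integrableZl _ _ _ (mu x) _ measurableT r _ hi.
have -> : (fun t : torus R => (cn (1 - z * set_val t) ^+ 2)%:E) =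
    EFin \o (fun t => cst c t + ((- 2 * complex.Re z) * f t + (2 * complex.Im z) * g t)).
  by apply/funext => t /=; rewrite cn_1sub /f /g /c; congr EFin; ring.
have di := @integrableD _ _ _ (mu x) setT measurableT _ _ (ai (- 2 * complex.Re z) f fi)
  (ai (2 * complex.Im z) g gi).
rewrite -[LHS]fineK; last first.
  by apply: integrable_fin_num => //; exact: (@integrableD _ _ _ (mu x) setT measurableT _ _ ci di).
congr EFin; rewrite -[LHS]/(\int[mu x]_t
  (cst c t + ((- 2 * complex.Re z) * f t + (2 * complex.Im z) * g t))).
rewrite (@RintegralD _ _ _ (mu x) setT (cst c) _ measurableT ci di).
rewrite (@RintegralD _ _ _ (mu x) setT _ _ measurableT (ai _ f fi) (ai _ g gi)).
rewrite (@RintegralZl _ _ _ (mu x) setT f _ measurableT fi).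
rewrite (@RintegralZl _ _ _ (mu x) setT g _ measurableT gi).
rewrite Rintegral_cst// /mu scalar_measureE//= -/mu.
have := HE.2 x; rewrite !(pvm_integral HP) -/(Rintegral _ _ f) -/(Rintegral _ _ g) => h.
rewrite rnormB_sqr rnormZ /re innerZr h (unitary_iso x unitaryU) (pvm_setT HP) /c exprMn -/mu.
move: (Rintegral _ _ _) (Rintegral _ _ _) => p q.
clear; move: (cn z) => e; case: z => a b /=; ring.
Qed.

Let qm (z : R[i]) (D : set (borel_torus R)) :
  measurable_fun D (fun t : borel_torus R => (cn (1 - z * set_val t) ^+ 2)%:E).
Proof.
apply/measurable_EFinP; apply: (@measurable_funS _ _ _ _ setT) => //.
exact: measurable_cn_1sub.
Qed.

Lemma spectral_lower_bound D x (z : R[i]) (d : R) : measurable D -> 0 <= d ->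
  (forall t, D t -> d <= cn (1 - z * set_val t)) ->
  d * rnorm (E D x) <= rnorm (E D x - z *: U (E D x)).
Proof.
move=> mD d0 hd; rewrite -(@ler_pXn2r _ 2)// ?nnegrE ?rnorm_ge0 ?mulr_ge0 ?rnorm_ge0//.
rewrite -lee_fin -quadratic_integral exprMn.
have -> : ((d ^+ 2 * rnorm (E D x) ^+ 2)%:E = \int[mu (E D x)]_(t in D) (d ^+ 2)%:E)%E.
  by rewrite integral_cst// /mu scalar_measureE// (pvm_idem HP).
apply: le_trans (_ : (_ <= \int[mu (E D x)]_(t in D) (cn (1 - z * set_val t) ^+ 2)%:E)%E) _.
  apply: ge0_le_integral => //.
  - by move=> t _; rewrite lee_fin sqr_ge0.
  - by move=> t Dt; rewrite lee_fin ler_pXn2r ?nnegrE ?cn_ge0 ?hd.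
apply: ge0_subset_integral => //.
by move=> t _; rewrite lee_fin sqr_ge0.
Qed.

Lemma spectral_upper_bound D x (z : R[i]) (k : R) : measurable D -> 0 <= k ->
  (forall t, D t -> cn (1 - z * set_val t) <= k) ->
  rnorm (E D x - z *: U (E D x)) <= k * rnorm (E D x).
Proof.
move=> mD k0 hk; rewrite -(@ler_pXn2r _ 2)// ?nnegrE ?rnorm_ge0 ?mulr_ge0 ?rnorm_ge0//.
rewrite -lee_fin -quadratic_integral exprMn.
have mC : measurable (~` D) := measurableC mD.
rewrite (@ge0_negligible_integral _ _ _ (mu (E D x)) setT (~` D))//; last 2 first.
- by move=> t _; rewrite lee_fin sqr_ge0.
- by rewrite /mu scalar_measureE// -(pvm_setI HP)// setICl (pvm_set0 HP) rnorm0 expr0n.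
rewrite setTD setCK.
have -> : ((k ^+ 2 * rnorm (E D x) ^+ 2)%:E = \int[mu (E D x)]_(t in D) (k ^+ 2)%:E)%E.
  by rewrite integral_cst// /mu scalar_measureE// (pvm_idem HP).
apply: ge0_le_integral => //.
- by move=> t _; rewrite lee_fin sqr_ge0.
- by move=> t Dt; rewrite lee_fin ler_pXn2r ?nnegrE ?cn_ge0 ?hk.
Qed.

(** The measure of [a + b] is the sum of those of [a] and [b], because [D] separates them; comparing
    the three quadratic integrals kills the cross term. *)
Lemma spectral_orthogonal D a b (z : R[i]) : measurable D -> E D a = a -> E D b = 0 ->
  re (a - z *: U a) (b - z *: U b) = 0.
Proof.
move=> mD ea eb; have mC := measurableC mD.
have EDl := pvm_linear HP mD.
have := quadratic_integral (a + b) z.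
rewrite (@eq_measure_integral _ _ _ setT (measure_add (mu a) (mu b))); last first.
  move=> F mF _; rewrite /measure_add/= /msum !big_ord_recl big_ord0/= adde0.
  rewrite /mu !scalar_measureE// -EFinD; congr EFin.
  rewrite (pvm_pythagoras HP (E F (a + b)) mD).
  have c1 y : E D (E F y) = E F (E D y) by rewrite -!(pvm_setI HP) 1?setIC.
  have c2 y : E (~` D) (E F y) = E F (E (~` D) y) by rewrite -!(pvm_setI HP) 1?setIC.
  have eb' : E (~` D) b = b by rewrite [RHS](pvm_setC HP b mD) eb add0r.
  have ea' : E (~` D) a = 0 by rewrite -ea -(pvm_setI HP)// setICl (pvm_set0 HP).
  rewrite c1 c2 (lopD EDl) (lopD (pvm_linear HP mC)) ea eb ea' eb'.
  by rewrite addr0 add0r.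
rewrite ge0_integral_measure_add//; last by move=> t _; rewrite lee_fin sqr_ge0.
rewrite !quadratic_integral -EFinD => -[].
have -> : a + b - z *: U (a + b) = (a - z *: U a) + (b - z *: U b).
  by rewrite (lopD U_lin); hring.
rewrite (rnormD_sqr (a - z *: U a)); lra.
Qed.

(** [spectral_orthogonal] relates [inner a (U b)] to [inner (U a) b]; letting [z] and a scalar in
    front of [b] run through [1] and ['i] separates the two. *)
Lemma spectral_cross D a b : measurable D -> E D a = a -> E D b = 0 -> inner a (U b) = 0.
Proof.
move=> mD ea eb; have EDl := pvm_linear HP mD.
have ab : inner a b = 0 by rewrite -ea (pvm_adj HP mD) eb inner0r.
have h (c z : R[i]) : complex.Re (z * c * inner a (U b)) + complex.Re (conjc z * c * inner (U a) b) = 0.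
  have ecb : E D (c *: b) = 0 by rewrite (lopZ EDl) eb scaler0.
  have := spectral_orthogonal z mD ea ecb.
  rewrite /re !(innerBl, innerBr, innerZl, innerZr, lopZ U_lin).
  have -> : inner (U a) (U b) = 0.
    by rewrite -(unitary_adjp unitaryU) [adj U (U a)](_ : _ = a) ?ab//;
      case: unitaryU => _ h _; rewrite -[LHS]/((adj U \o U) a) h.
  rewrite ab !mulr0 !(sub0r, subr0, oppr0, add0r).
  move=> h0; apply: oppr_inj; rewrite oppr0 -[RHS]h0; clear ecb h0.
  case: (inner a (U b)) => p q; case: (inner (U a) b) => p' q'.
  case: c => ? ?; case: z => ? ? /=.
  ring.
have h1 := h 1 1; have h2 := h 1 'i%C; have h3 := h 'i%C 1; have h4 := h 'i%C 'i%C.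
move: h1 h2 h3 h4; case: (inner a (U b)) => p q; case: (inner (U a) b) => p' q' /=.
rewrite !(mul0r,mul1r,mulr0,subr0,sub0r,addr0,add0r,oppr0,mulN1r,mulrN1,opprK).
by move=> *; apply/eqP; rewrite eq_complex /=; apply/andP; split; apply/eqP; lra.
Qed.

(** [spectral_family] speaks of diagonal matrix elements only, so commutation has to be derived: by
    [spectral_cross], [U] maps the range of [E D] and that of its complement into themselves. *)
Lemma spectral_commute D x : measurable D -> E D (U x) = U (E D x).
Proof.
move=> mD; have mC := measurableC mD.
have vanish F y : measurable F -> E F (U (E (~` F) y)) = 0.
  move=> mF; have mCF := measurableC mF.
  apply: rnorm_eq0; apply/eqP; rewrite -sqrf_eq0 -re_rnorm /re (pvm_adj HP mF) (pvm_idem HP)//.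
  rewrite -(pvm_adj HP mF) (@spectral_cross F)//; first by rewrite (pvm_idem HP).
  by rewrite -(pvm_setI HP)// setICr (pvm_set0 HP).
rewrite {1}(pvm_setC HP x mD) (lopD U_lin) (lopD (pvm_linear HP mD)) vanish// addr0.
rewrite [RHS](pvm_setC HP _ mD) -[in X in _ + E _ (U X)](setCK D) vanish ?addr0//.
Qed.

Lemma torus_mulC t : (set_val t : R[i]) * conjc (set_val t) = 1.
Proof.
have := cn_sqr (set_val t : R[i]); rewrite cn_torus expr1n.
case: (set_val t) => p q /= h; apply/eqP; rewrite eq_complex /=.
by apply/andP; split; apply/eqP; [rewrite h|]; ring.
Qed.

Lemma cn_torus_dist (s t : torus R) : cn (1 - conjc (set_val s) * set_val t) = cn (set_val t - set_val s).
Proof.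
rewrite -[LHS]mul1r -(cn_torus s) -cnM mulrBr mulr1 mulrA torus_mulC mul1r.
by rewrite -cnN opprB.
Qed.

Lemma bigcap_torus_ball t : \bigcap_n torus_ball (set_val t) n.+1%:R^-1 = [set t].
Proof.
apply/seteqP; split => [s /= h | s -> n _]; last first.
  by rewrite /torus_ball/= subrr cn0 invr_gt0 ltr0n.
apply: val_inj; apply/eqP; rewrite -subr_eq0; apply/eqP/cn_eq0/eqP; rewrite eq_le cn_ge0 andbT.
apply/ler_addgt0Pl => e e0; rewrite addr0.
have [n ne] := ltr_add_invr e0; rewrite add0r in ne.
by have := h n I; rewrite /torus_ball/= => /ltW h1; apply: le_trans h1 (ltW ne).
Qed.

Lemma measurable_torus1 t : measurable ([set t] : set (borel_torus R)).
Proof.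
by rewrite -bigcap_torus_ball; apply: bigcapT_measurable => n; exact: torus_ball_measurable.
Qed.

Lemma spectral_atom t x : U (E [set t] x) = (set_val t : R[i]) *: E [set t] x.
Proof.
have mt := measurable_torus1 t.
have h : rnorm (E [set t] x - conjc (set_val t) *: U (E [set t] x)) <= 0 * rnorm (E [set t] x).
  apply: spectral_upper_bound => // s ->.
  by rewrite cn_torus_dist subrr cn0.
have /rnorm_eq0/eqP : rnorm (E [set t] x - conjc (set_val t) *: U (E [set t] x)) = 0.
  by apply/eqP; rewrite eq_le rnorm_ge0 andbT -[leRHS](mul0r (rnorm (E [set t] x))).
by rewrite subr_eq0 => /eqP {2}->; rewrite scalerA torus_mulC scale1r.
Qed.

(** The part of [x] outside the ball is again an eigenvector by [spectral_commute], while
    [spectral_lower_bound] keeps [1 - conjc t U] away from [0] there. *)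
Lemma eigenvector_localized t r x : 0 < r ->
  U x = (set_val t : R[i]) *: x -> E (torus_ball (set_val t) r) x = x.
Proof.
move=> r0 Ux; have mB := torus_ball_measurable (set_val t) r.
have mC := measurableC mB.
have h : r * rnorm (E (~` torus_ball (set_val t) r) x) <=
    rnorm (E (~` torus_ball (set_val t) r) x - conjc (set_val t) *: U (E (~` torus_ball (set_val t) r) x)).
  apply: spectral_lower_bound => //; first exact: ltW.
  by move=> s; rewrite cn_torus_dist /torus_ball/= leNgt => /negP.
rewrite -spectral_commute// Ux (lopZ (pvm_linear HP mC)) scalerA [conjc _ * _]mulrC torus_mulC scale1r in h.
rewrite subrr rnorm0 pmulr_rle0// in h.
rewrite [RHS](pvm_setC HP x mB) (_ : E (~` _) x = 0) ?addr0//.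
by apply: rnorm_eq0; apply/eqP; rewrite eq_le rnorm_ge0 h.
Qed.

Lemma eigenvector_spectral (Theta : set (torus R)) t x : open Theta -> Theta t ->
  U x = (set_val t : R[i]) *: x -> E Theta x = x.
Proof.
move=> oT Tt Ux; have [r r0 h] := torus_open_ball oT Tt.
have mT : measurable (Theta : set (borel_torus R)) := open_measurable_torus oT.
have e := eigenvector_localized r0 Ux.
by rewrite -{1}e -(pvm_setI HP)//; [rewrite (setIidr h) e | exact: torus_ball_measurable].
Qed.

End SpectralFamily.

(** * Local coercivity from the strict Mourre estimate *)

Section LocalCoercivity.
Context {R : realType} {H : hilbertType R}.
Variables (U T : H -> H) (E : set (borel_torus R) -> H -> H).
Hypotheses (unitaryU : unitary U) (HE : spectral_family U E).
Variables (b c r : R) (l : torus R).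
Hypotheses (linT : linear T) (bT : bnd b T) (b0 : 0 <= b) (c0 : 0 < c) (r0 : 0 < r).
Let P := E (torus_ball (set_val l) r).
Hypothesis strict : forall x, c * rnorm (P x) ^+ 2 <= re (U (P x)) (T (P x)).

Let HP : projection_valued_measure E := HE.1.
Let mB := torus_ball_measurable (set_val l) r.
Let U_lin : linear U.
Proof. by case: unitaryU => -[]. Qed.

(** The centre is the conjugate of [l] because on the circle [1 - z l] vanishes at [z = conjc l]. *)
Definition local_disk (l : torus R) (r : R) (z : R[i]) :=
  cn z <= 1 /\ cn (z - conjc (set_val l)) <= r / 2.

Lemma far_part_bound z u : cn (z - conjc (set_val l)) <= r / 2 ->
  r / 2 * rnorm (u - P u) <= rnorm (u - z *: U u).
Proof.
move=> zl; have mC := measurableC mB.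
have -> : u - P u = E (~` torus_ball (set_val l) r) u.
  by rewrite {1}(pvm_setC HP u mB) addrC addKr.
apply: le_trans (_ : _ <= rnorm (E (~` torus_ball (set_val l) r) (u - z *: U u))) _; last first.
  exact: pvm_le HP _ _ mC.
rewrite (lopB (pvm_linear HP mC)) (lopZ (pvm_linear HP mC)) (spectral_commute unitaryU HE)//.
apply: (spectral_lower_bound unitaryU HE) => //; first by rewrite divr_ge0// ltW.
move=> t; rewrite /torus_ball/= => /negP; rewrite -leNgt -cn_torus_dist => h.
have -> : 1 - z * set_val t = (1 - conjc (set_val l) * set_val t) - (z - conjc (set_val l)) * set_val t.
  by ring.
have := cnD (1 - z * set_val t) ((z - conjc (set_val l)) * set_val t).
rewrite cnM cn_torus mulr1.
have -> : 1 - z * set_val t + (z - conjc (set_val l)) * set_val t = 1 - conjc (set_val l) * set_val t.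
  by ring.
have -> : 1 - conjc (set_val l) * set_val t - (z - conjc (set_val l)) * set_val t = 1 - z * set_val t.
  by ring.
lra.
Qed.

(** Replacing [P u] by [u] creates cross terms linear in the far part [u - P u]; half of the
    constant [c] is spent on them by the inequality of the arithmetic and geometric means. *)
Lemma global_lower_bound u :
  c / 2 * rnorm u ^+ 2 - (c + 2 * b ^+ 2 / c) * rnorm (u - P u) ^+ 2 <= re (U u) (T u).
Proof.
have pyt : rnorm u ^+ 2 = rnorm (P u) ^+ 2 + rnorm (u - P u) ^+ 2.
  rewrite (pvm_pythagoras HP u mB); congr (_ + rnorm _ ^+ 2).
  by rewrite {2}(pvm_setC HP u mB) addrC addKr.
have pu : rnorm (P u) <= rnorm u := pvm_le HP u mB.
have s := strict u.
have e : re (U u) (T u) = re (U (P u)) (T (P u)) + re (U (u - P u)) (T u) + re (U (P u)) (T (u - P u)).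
  by rewrite (lopB U_lin) (lopB linT) !(reBl, reBr); ring.
have h1 : - re (U (u - P u)) (T u) <= b * rnorm (u - P u) * rnorm u.
  rewrite -reNl; apply: le_trans (re_le _ _) _; rewrite rnormN unitary_iso//.
  by rewrite mulrAC [leRHS]mulrC ler_wpM2l ?rnorm_ge0.
have h2 : - re (U (P u)) (T (u - P u)) <= b * rnorm (u - P u) * rnorm u.
  rewrite -reNl; apply: le_trans (re_le _ _) _; rewrite rnormN unitary_iso// mulrC.
  by apply: ler_pM; rewrite ?rnorm_ge0.
have h3 : 2 * (b * rnorm (u - P u) * rnorm u) <=
    c / 2 * rnorm u ^+ 2 + (2 * b ^+ 2 / c) * rnorm (u - P u) ^+ 2.
  have : 0 <= (c * rnorm u - 2 * b * rnorm (u - P u)) ^+ 2 / (2 * c).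
    by rewrite divr_ge0 ?sqr_ge0// mulr_ge0// ltW.
  have -> : (c * rnorm u - 2 * b * rnorm (u - P u)) ^+ 2 / (2 * c) =
    c / 2 * rnorm u ^+ 2 + (2 * b ^+ 2 / c) * rnorm (u - P u) ^+ 2 - 2 * (b * rnorm (u - P u) * rnorm u).
    by field; rewrite gt_eqF.
  by rewrite subr_ge0.
rewrite e; move: s h1 h2 h3; rewrite pyt; lra.
Qed.

(** With [f] the image of [u] and [cn z <= 1], expanding [|u - f|^2 <= |U u - e T u|^2] gives [2 re
    u f >= |f|^2 + 2 e re (U u) (T u) - e^2 |T u|^2]. The term [|f|^2] is what pays for the far part
    of [u], so no loss occurs on the circle. *)
Lemma strict_coercive : exists2 e0, 0 < e0 & forall z, local_disk l r z ->
  forall e, 0 <= e <= e0 -> coercive (c / 4 * e) (deform z U T e).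
Proof.
(* [h4] bounds the far part with the factor [8 / r^2]; the condition [e * K <= 1] brings [e * C1]
   times this factor below 1/2. The second bound on [e] ensures [e * b^2 <= c / 4]. *)
pose C1 := c + 2 * b ^+ 2 / c; pose K := 16 * C1 / r ^+ 2.
have C10 : 0 < C1 by rewrite ltr_wpDr// divr_ge0 ?mulr_ge0 ?sqr_ge0// ltW.
have K0 : 0 < K by rewrite divr_gt0 ?mulr_gt0// exprn_gt0.
have b1 : 0 < 4 * (b ^+ 2 + 1) by rewrite mulr_gt0// ltr_wpDl ?sqr_ge0.
exists (Num.min K^-1 (c / (4 * (b ^+ 2 + 1)))); first by rewrite lt_min invr_gt0 K0 divr_gt0.
move=> z [z1 zl] e; rewrite le_min ler_pdivlMr// => /andP[e0 /andP[eK eb]] u.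
have {}eK : e * K <= 1 by rewrite -(@ler_pM2r _ K)// mulVf ?gt_eqF// in eK.
pose f := deform z U T e u; rewrite -/f.
have zv : z *: (U u - e%:C *: T u) = u - f by rewrite /f /deform; hring.
have h1 : rnorm (u - f) ^+ 2 <= rnorm (U u - e%:C *: T u) ^+ 2.
  rewrite -zv rnormZ ler_pXn2r ?nnegrE ?mulr_ge0 ?rnorm_ge0 ?cn_ge0//.
  by rewrite -[leRHS]mul1r ler_wpM2r ?rnorm_ge0.
rewrite (rnormB_sqr u f) (rnormB_sqr (U u)) rnormZ reZr cnR ger0_norm// (unitary_iso u unitaryU) in h1.
have h2 : (e * rnorm (T u)) ^+ 2 <= e ^+ 2 * b ^+ 2 * rnorm u ^+ 2.
  by rewrite -!exprMn ler_pXn2r ?nnegrE ?mulr_ge0 ?rnorm_ge0// -mulrA ler_wpM2l.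
have h3 := global_lower_bound u; rewrite -/C1 in h3.
have h4 : rnorm (u - P u) ^+ 2 <= 8 / r ^+ 2 * (rnorm f ^+ 2 + e ^+ 2 * b ^+ 2 * rnorm u ^+ 2).
  have : rnorm (u - z *: U u) <= rnorm f + e * (b * rnorm u).
    have -> : u - z *: U u = f - z *: (e%:C *: T u) by rewrite /f /deform; hring.
    apply: le_trans (rnormB _ _) _; rewrite lerD2l !rnormZ cnR ger0_norm//.
    rewrite -[leRHS]mul1r; apply: ler_pM; rewrite ?cn_ge0 ?mulr_ge0 ?rnorm_ge0//.
    by rewrite ler_wpM2l.
  move/(le_trans (far_part_bound u zl)) => h.
  have : (r / 2 * rnorm (u - P u)) ^+ 2 <= (rnorm f + e * (b * rnorm u)) ^+ 2.
    by rewrite ler_pXn2r ?nnegrE// ?mulr_ge0 ?addr_ge0 ?mulr_ge0 ?rnorm_ge0 ?invr_ge0// ltW.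
  move: (sqr_ge0 (rnorm f - e * (b * rnorm u))) => s1 s2.
  have r2 : 0 < r ^+ 2 by rewrite exprn_gt0.
  have -> : 8 / r ^+ 2 * (rnorm f ^+ 2 + e ^+ 2 * b ^+ 2 * rnorm u ^+ 2) =
     8 * (rnorm f ^+ 2 + (e * (b * rnorm u)) ^+ 2) / r ^+ 2 by ring.
  rewrite ler_pdivlMr//.
  have -> : rnorm (u - P u) ^+ 2 * r ^+ 2 = 4 * (r / 2 * rnorm (u - P u)) ^+ 2 by field.
  move: s1 s2; move: (rnorm f) (e * _) (r / 2 * _) => x y w; rewrite sqrrB sqrrD; lra.
have h5 : e * C1 * rnorm (u - P u) ^+ 2 <= 2^-1 * (rnorm f ^+ 2 + e ^+ 2 * b ^+ 2 * rnorm u ^+ 2).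
  rewrite -[leRHS]mul1r.
  apply: le_trans (_ : e * K * (2^-1 * (rnorm f ^+ 2 + e ^+ 2 * b ^+ 2 * rnorm u ^+ 2)) <= _).
    have -> : e * K * (2^-1 * (rnorm f ^+ 2 + e ^+ 2 * b ^+ 2 * rnorm u ^+ 2)) =
      e * C1 * (8 / r ^+ 2 * (rnorm f ^+ 2 + e ^+ 2 * b ^+ 2 * rnorm u ^+ 2)).
      by rewrite /K; field; rewrite gt_eqF.
    by rewrite ler_wpM2l// mulr_ge0// ltW.
  rewrite ler_wpM2r// mulr_ge0 ?invr_ge0// addr_ge0 ?sqr_ge0//.
  by do 2 (rewrite mulr_ge0 ?sqr_ge0//).
have h6 : e * (c / 2 * rnorm u ^+ 2 - C1 * rnorm (u - P u) ^+ 2) <= e * re (U u) (T u).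
  by rewrite ler_wpM2l.
have h7 : e * rnorm u ^+ 2 * (e * (b ^+ 2)) <= e * rnorm u ^+ 2 * (c / 4).
  apply: ler_wpM2l; first by rewrite mulr_ge0 ?sqr_ge0.
  have : 0 <= e * 4 by rewrite mulr_ge0.
  move: eb; rewrite mulrDr mulr1 mulrDr; lra.
have e1 : e ^+ 2 * b ^+ 2 * rnorm u ^+ 2 = e * rnorm u ^+ 2 * (e * (b ^+ 2)) by ring.
have e2 : e * (c / 2 * rnorm u ^+ 2 - C1 * rnorm (u - P u) ^+ 2) =
  c / 2 * (e * rnorm u ^+ 2) - e * C1 * rnorm (u - P u) ^+ 2 by ring.
rewrite {}e2 in h6; rewrite !{}e1 in h2 h5.
have -> : c / 4 * e * rnorm u ^+ 2 = c / 4 * (e * rnorm u ^+ 2) by ring.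
have e3 : e * rnorm u ^+ 2 * (c / 4) = c / 4 * (e * rnorm u ^+ 2) by ring.
rewrite {}e3 in h7; move: h1 h2 h5 h6 h7.
lra.
Qed.

Variables (V S : nat -> H -> H) (p : nat -> R).
Hypotheses (sp : summable_seq p)
  (bV : forall k, bnd (2^-1 ^+ k * p k) (fun x => V k x - U x))
  (limS : forall e, 0 < e -> exists N, forall k, (N <= k)%N -> bnd e (fun x => S k x - T x)).

(** Passing to [V n] and [S n] costs [2^-n * p n] and [e] times a small quantity; the restriction
    [e >= 2^-(n+1)] makes the former small relative to [e] as well. *)
Lemma deform_coercive : exists k0, forall z, local_disk l r z ->
  forall n e, (k0 <= n)%N -> 2^-1 ^+ n.+1 <= e <= 2^-1 ^+ n ->
  coercive (c / 8 * e) (deform z (V n) (S n) e).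
Proof.
have [e0 e00 he] := strict_coercive.
have c32 : 0 < c / 32 by rewrite divr_gt0.
have [N1 h1] := summable_cvg0 sp c32; have [N2 h2] := limS c32.
have [N3 h3] := summable_cvg0 summable_geometric e00.
exists (maxn N1 (maxn N2 N3)) => z Zz n e; rewrite !geq_max => /and3P[n1 n2 n3] /andP[en1 en2] u.
have e1 : 0 <= e by apply: le_trans en1; rewrite exprn_ge0// invr_ge0.
have := he z Zz e _ u; rewrite e1 (le_trans en2 (h3 n n3)) => /(_ isT) h.
have -> : deform z (V n) (S n) e u = deform z U T e u -
    z *: (V n u - U u - e%:C *: (S n u - T u)) by rewrite /deform; hring.
rewrite reBr.
have : re u (z *: (V n u - U u - e%:C *: (S n u - T u))) <= c / 8 * e * rnorm u ^+ 2.
  apply: le_trans (re_le _ _) _; rewrite expr2 [leRHS]mulrA mulrC ler_wpM2r ?rnorm_ge0//.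
  rewrite rnormZ -[leRHS]mul1r; apply: ler_pM; rewrite ?cn_ge0 ?rnorm_ge0//; first by case: Zz.
  apply: le_trans (rnormB _ _) _; rewrite rnormZ cnR ger0_norm//.
  have k1 : rnorm (V n u - U u) <= 2 * e * (c / 32) * rnorm u.
    apply: le_trans (bV n u) _; rewrite ler_wpM2r ?rnorm_ge0//.
    apply: ler_pM; rewrite ?exprn_ge0 ?invr_ge0 ?sp.1 ?h1//.
    by move: en1; rewrite exprS; lra.
  have k2 : e * rnorm (S n u - T u) <= e * (c / 32 * rnorm u) by rewrite ler_wpM2l// h2.
  move: k1 k2; have -> : c / 8 * e * rnorm u = 4 * (e * (c / 32 * rnorm u)) by field.
  have -> : 2 * e * (c / 32) * rnorm u = 2 * (e * (c / 32 * rnorm u)) by ring.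
  have : 0 <= e * (c / 32 * rnorm u) by rewrite !mulr_ge0 ?rnorm_ge0// ltW.
  lra.
move: h; have -> : c / 4 * e * rnorm u ^+ 2 = 2 * (c / 8 * e * rnorm u ^+ 2) by field.
lra.
Qed.

End LocalCoercivity.

Section UniformBoundaryValues.
Context {R : realType}.
Variable Z : R[i] -> Prop.
Implicit Types f g : R[i] -> R[i].

Definition boundary_uniform f :=
  (exists Y, forall z, Z z -> cn z < 1 -> cn (f z) <= Y) /\
  forall e, 0 < e -> exists2 d, 0 < d & forall z z', Z z -> Z z' -> cn z < 1 -> cn z' < 1 ->
    cn (z - z') < d -> cn (f z - f z') <= e.

Lemma boundary_uniform_comb c f g : boundary_uniform f -> boundary_uniform g ->
  boundary_uniform (fun z => c * f z + g z).
Proof.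
move=> [[Y hY] uf] [[Y' hY'] ug]; split.
  exists (cn c * Y + Y') => z Zz z1; apply: le_trans (cnD _ _) _.
  by rewrite cnM lerD ?hY'// ler_wpM2l ?cn_ge0 ?hY.
move=> e e0; have c1 : 0 < 2 * (cn c + 1) by rewrite mulr_gt0// ltr_wpDl ?cn_ge0.
have [d d0 hd] := uf (e / (2 * (cn c + 1))) (divr_gt0 e0 c1).
have [d' d0' hd'] := ug (e / 2) (divr_gt0 e0 (ltr0Sn R 1)).
exists (Num.min d d'); first by rewrite lt_min d0.
move=> z z' Zz Zz' z1 z1'; rewrite lt_min => /andP[h1 h2].
have -> : c * f z + g z - (c * f z' + g z') = c * (f z - f z') + (g z - g z') by ring.
apply: le_trans (cnD _ _) _; rewrite cnM.
have k1 := hd z z' Zz Zz' z1 z1' h1; have k2 := hd' z z' Zz Zz' z1 z1' h2.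
have : cn c * cn (f z - f z') <= e / 2.
  apply: le_trans (_ : (cn c + 1) * (e / (2 * (cn c + 1))) <= _).
    by apply: ler_pM; rewrite ?cn_ge0//; lra.
  by rewrite le_eqVlt; apply/orP; left; apply/eqP; field; rewrite gt_eqF// ltr_wpDl ?cn_ge0.
lra.
Qed.

Lemma boundary_uniform_ext f g : (forall z, cn z < 1 -> f z = g z) ->
  boundary_uniform f -> boundary_uniform g.
Proof.
move=> fg [[Y hY] uf]; split; first by exists Y => z Zz z1; rewrite -fg ?hY.
move=> e /uf[d d0 hd]; exists d => // z z' ? ? ? ? ?; rewrite -!fg//; exact: hd.
Qed.

End UniformBoundaryValues.

(** * Boundary values for vectors of the interpolation space *)

Section LimitingAbsorptionPrinciple.
Context {R : realType} {H : hilbertType R}.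
Variables (A : partial_op H) (W : R -> H -> H) (U T : H -> H).
Variables (E : set (borel_torus R) -> H -> H) (b : R) (p : nat -> R).
Hypotheses (linA : linear_partial_op A) (denseA : dense (dom A)) (WA : unitary_group A W).
Hypotheses (unitaryU : unitary U) (HE : spectral_family U E).
Hypotheses (adT : is_ad A U T) (bT : bnd b T) (b0 : 0 <= b).
Hypotheses (zyg : zygmund W U p) (sp : summable_seq p).

Definition strict_at (l : torus R) r := exists2 c, 0 < c &
  forall x, c * rnorm (E (torus_ball (set_val l) r) x) ^+ 2 <=
    re (U (E (torus_ball (set_val l) r) x)) (T (E (torus_ball (set_val l) r) x)).

Let gW := unitary_group_ugroup WA.
Let adjU := unitary_adjp unitaryU.
Let bU : bnd 1 U.
Proof. by move=> x; rewrite unitary_iso// mul1r. Qed.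
Let linT : linear T. Proof. by case: adT => -[]. Qed.
Let half k : 0 <= (2^-1 : R) ^+ k <= 1.
Proof. by rewrite exprn_ge0 ?invr_ge0// exprn_ile1 ?invr_ge0// invf_le1// ler1n. Qed.

Lemma Tavg_bounded : exists2 b', 0 <= b' & forall k, bnd b' (Tavg W U k).
Proof.
have [p0 [S hS]] := sp; have [P hP] := summable_bounded sp.
have S0 : 0 <= S by have := hS 0%N; rewrite big_ord0.
have P0 : 0 <= P := le_trans (p0 0%N) (hP 0%N).
exists (3 * P + (S + b)); first by rewrite !addr_ge0 ?mulr_ge0.
move=> k x.
have -> : Tavg W U k x = (Tavg W U k x - Sdiff W U k x) + ((Sdiff W U k x - T x) + T x) by hring.
rewrite mulrDl; apply: le_trans (rnormD _ _) _; apply: lerD.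
  apply: le_trans (Tavg_Sdiff gW zyg k x) _.
  by rewrite ler_wpM2r ?rnorm_ge0// ler_wpM2l.
rewrite mulrDl; apply: le_trans (rnormD _ _) _; apply: lerD; last exact: bT.
apply: (Sdiff_near WA denseA adjU bU adT bT zyg) => // n.
have [kn|nk] := leqP k n; last by rewrite big_geq// ltnW.
apply: le_trans (hS n.+1); rewrite big_ord_recl/= -(big_mkord predT (fun i => p i.+1)).
rewrite (big_cat_nat (leq0n k) kn)/= ler_wpDl// ler_wpDl//; first exact: sumr_ge0.
Qed.

Lemma lap_diag l r phi : 0 < r -> strict_at l r -> dyadic_interp A phi ->
  boundary_uniform (local_disk l r) (fun z => inner phi (resolventU U z phi)).
Proof.
move=> r0 [c c0 hc] [f [Df s1 s2]].
have [b' b'0 bT'] := Tavg_bounded.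
have [k0 hk0] := deform_coercive unitaryU HE linT bT b0 c0 r0 hc sp (Uavg_near gW zyg)
  (Tavg_lim WA denseA adjU bU adT bT zyg sp).
have c8 : 0 < c / 8 by rewrite divr_gt0.
(* [T_(k+1) - T_k] passes through the central quotients: [3 * p k] and [3 * p k.+1] from
   [Tavg_Sdiff], and one more [p k.+1] from [Sdiff_step]. *)
have sq : summable_seq (fun k => 3 * p k + 4 * p k.+1).
  by apply: summable_seqD; [apply: summable_seqZ | apply: summable_seqZ; [|exact: summable_seqS]].
have sg0 k : 0 < Num.sqrt ((2^-1 : R) ^+ k) by rewrite sqrtr_gt0 exprn_gt0// invr_gt0.
apply: (@limiting_absorption_diag _ _ W U (adj U) (Uavg W U) (Tavg W U) p
  (fun k => 3 * p k + 4 * p k.+1) (c / 8) b' (local_disk l r) k0 _ _ _ _ _ _ _ _ _ _ _ _ _ _ _ _ f) => //.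
- by move=> z [].
- exact: Uavg_adjp gW adjU.
- exact: Tavg_adjp gW adjU.
- exact: Uavg_near gW zyg.
- exact: Wdiff_Uavg gW.
- move=> k x.
  have -> : Tavg W U k.+1 x - Tavg W U k x = (Tavg W U k.+1 x - Sdiff W U k.+1 x) +
     (Sdiff W U k.+1 x - Sdiff W U k x) - (Tavg W U k x - Sdiff W U k x) by hring.
  apply: le_trans (rnormB _ _) _.
  have := rnormD (Tavg W U k.+1 x - Sdiff W U k.+1 x) (Sdiff W U k.+1 x - Sdiff W U k x).
  have := Tavg_Sdiff gW zyg k x; have := Tavg_Sdiff gW zyg k.+1 x; have := Sdiff_step gW zyg k x.
  rewrite mulrDl; lra.
- exact: Wdiff_Tavg gW zyg.
(* By [group_lip] the difference quotient of the orbit is at most [rnorm (A (f k))], whose weighted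
   sum is part of [dyadic_interp]. *)
- apply: summable_seq_le s1 _ => k.
  rewrite mulr_ge0 ?(ltW (sg0 _)) ?divr_ge0 ?rnorm_ge0 ?exprn_ge0 ?invr_ge0//=.
  have e4 : 0 < (4^-1 : R) ^+ k by rewrite exprn_gt0// invr_gt0.
  rewrite ler_wpM2l ?(ltW (sg0 _))// ler_pdivrMr// mulrC.
  by have := group_lip WA (4^-1 ^+ k) (Df k); rewrite ger0_norm// ltW.
- apply: summable_seq_le (summable_seqD s2 (summable_seqS s2)) _ => k.
  rewrite divr_ge0 ?rnorm_ge0 ?(ltW (sg0 _))//=.
  have -> : f k.+1 - f k = (f k.+1 - phi) - (f k - phi) by hring.
  apply: le_trans (_ : (rnorm (f k.+1 - phi) + rnorm (f k - phi)) / Num.sqrt (2^-1 ^+ k) <= _).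
    by rewrite ler_wpM2r ?invr_ge0 ?(ltW (sg0 _))// rnormB.
  rewrite mulrDl addrC lerD2l ler_wpM2l ?rnorm_ge0// lef_pV2 ?posrE//.
  apply: ler_wsqrtr; have /andP[h _] := half k.
  rewrite exprS -[leRHS]mul1r ler_wpM2r//.
  by rewrite invf_le1// ler1n.
- move=> e e0; have [N hN] := summable_cvg0 s2 e0; exists N => n Nn.
  apply: le_trans (hN n Nn); rewrite ler_pdivlMr// -[leRHS]mulr1 ler_wpM2l ?rnorm_ge0//.
  by have /andP[_ h] := half n; rewrite -[leRHS]sqrtr1; apply: ler_wsqrtr.
Qed.

Lemma lap l r phi psi : 0 < r -> strict_at l r -> dyadic_interp A phi -> dyadic_interp A psi ->
  boundary_uniform (local_disk l r) (fun z => inner phi (resolventU U z psi)).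
Proof.
move=> r0 sl aphi apsi.
pose D c z := inner (c *: psi + phi) (resolventU U z (c *: psi + phi)).
have hD c : boundary_uniform (local_disk l r) (D c).
  by apply: lap_diag => //; exact: dyadic_interp_comb.
have h0 : boundary_uniform (local_disk l r) (fun=> 0 : R[i]).
  by split; [exists 0 => *; rewrite cn0 | move=> e e0; exists 1 => // *; rewrite subrr cn0 ltW].
(* Polarization over the fourth roots of unity: [D c] has the weight [conjc c / 4], which isolates
   the part of [D c] that is linear in [c]. *)
apply: boundary_uniform_ext (boundary_uniform_comb 4^-1 (hD 1) (boundary_uniform_comb (- 4^-1) (hD (-1))
  (boundary_uniform_comb (- 'i%C / 4) (hD 'i%C)
  (boundary_uniform_comb ('i%C / 4) (hD (- 'i%C)) h0)))) => z z1.
have lR := op_inv_linear (one_sub_cop adjU bU z1); rewrite -/(resolventU U z) in lR.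
rewrite /D !(lopD lR) !(lopZ lR) !(innerDl, innerDr, innerNl, innerNr, innerZl, innerZr).
have conji : conjc ('i%C : R[i]) = - 'i%C by apply/eqP; rewrite eq_complex/= oppr0 !eqxx.
have jj : ('i%C : R[i]) * 'i%C = -1 by rewrite -expr2 sqr_i.
have cN (a : R[i]) : conjc (- a) = - conjc a by case: a.
rewrite !cN !conji conjc1.
move: conji jj; set j : R[i] := 'i%C => conji jj.
move: (inner phi _) (inner phi _) (inner psi _) (inner psi _) => q1 q2 q3 q4.
by field: jj.
Qed.

End LimitingAbsorptionPrinciple.

(** * Virial theorem and eigenvalues *)

Section Orthonormal.
Context {R : realType} {H : hilbertType R}.
Implicit Types (x y : H) (e : nat -> H).

Definition orthonormal_upto (n : nat) e := forall i j, (i < n)%N -> (j < n)%N ->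
  inner (e i) (e j) = (i == j)%:R.

Lemma bessel n e y : orthonormal_upto n e ->
  \sum_(k < n) cn (inner (e k) y) ^+ 2 <= rnorm y ^+ 2.
Proof.
move=> oe; pose v := \sum_(k < n) inner (e k) y *: e k.
have h i : (i < n)%N -> inner (e i) v = inner (e i) y.
  move=> i_n; rewrite inner_sumr (bigD1 (Ordinal i_n))//= innerZr oe// eqxx mulr1.
  rewrite big1 ?addr0// => j ji; rewrite innerZr oe// [_ == _](_ : _ = false) ?mulr0//.
  by apply/negbTE; apply: contraNneq ji => h; apply/eqP/val_inj.
have vv : re v v = \sum_(k < n) cn (inner (e k) y) ^+ 2.
  rewrite /re {1}/v inner_suml (eq_bigr (fun k : 'I_n => (cn (inner (e k) y) ^+ 2)%:C)).
    by rewrite -rmorph_sum.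
  move=> k _; rewrite innerZl h//; move: (inner _ _) => a.
  by rewrite cn_sqr; case: a => p q /=; apply/eqP; rewrite eq_complex /=; apply/andP; split; apply/eqP; ring.
have vy : re v y = re v v.
  rewrite /re /v !inner_suml; congr complex.Re; apply: eq_bigr => k _.
  by rewrite !innerZl -/v h.
have := sqr_ge0 (rnorm (y - v)); rewrite rnormB_sqr reC vy -[rnorm v ^+ 2]re_rnorm vv; lra.
Qed.

Lemma orthonormal_sequence (G : set H) : G `<=` [set x | rnorm x = 1] ->
  (forall n e, (forall i, (i < n)%N -> G (e i)) -> orthonormal_upto n e ->
    exists2 y, G y & forall i, (i < n)%N -> inner (e i) y = 0) ->
  exists2 e : nat -> H, (forall i, G (e i)) & forall n, orthonormal_upto n e.
Proof.
move=> G1 ext.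
pose pick n e := xget 0 [set y | G y /\ forall i, (i < n)%N -> inner (e i) y = 0].
(* [F n] has its first [n] values settled and is [0] beyond; later stages keep them, and the
   diagonal [e] is the required sequence. *)
pose F := fix F n : nat -> H := if n is n'.+1 then
  fun i => if i == n' then pick n' (F n') else F n' i else fun=> 0.
have G1' y : G y -> inner y y = 1.
  move=> /G1 /= y1; rewrite inner_rnorm y1; by rewrite expr1n.
have hF n : (forall i, (i < n)%N -> G (F n i)) /\ orthonormal_upto n (F n).
  elim: n => [|n [IH1 IH2]]; first by split=> [i|i j].
  have [y Gy hy] := ext n _ IH1 IH2.
  have [p1 p2] : G (pick n (F n)) /\ forall i, (i < n)%N -> inner (F n i) (pick n (F n)) = 0.
    exact: (xgetPex (P := [set y | G y /\ forall i, (i < n)%N -> inner (F n i) y = 0]) _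
      (ex_intro _ y (conj Gy hy))).
  split=> [i|i j]; rewrite ltnS leq_eqVlt /= => /orP[/eqP ->|ni].
  - by rewrite eqxx.
  - by rewrite ltn_eqF//; apply: IH1.
  - rewrite ltnS leq_eqVlt eqxx => /orP[/eqP ->|nj]; first by rewrite eqxx G1'.
    by rewrite (ltn_eqF nj) gtn_eqF// innerC p2// conjc0.
  - rewrite ltnS leq_eqVlt (ltn_eqF ni) => /orP[/eqP ->|nj]; first by rewrite eqxx p2// ltn_eqF.
    by rewrite (ltn_eqF nj) IH2.
pose e n := F n.+1 n.
have Fe n i : (i < n)%N -> F n i = e i.
  elim: n => // n IH; rewrite ltnS leq_eqVlt => /orP[/eqP ->//|ni].
  by rewrite /= ltn_eqF// IH.
exists e => [i|n i j i_n j_n]; first by rewrite -(Fe i.+1)//; apply: (hF i.+1).1.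
by rewrite -(Fe n i)// -(Fe n j)//; apply: (hF n).2.
Qed.

Lemma not_finite_dim_orthogonal (V : set H) n e : ~ finite_dim V -> orthonormal_upto n e ->
  (forall i, (i < n)%N -> V (e i)) ->
  (forall (a : R[i]) x y, V x -> V y -> V (a *: x + y)) ->
  exists2 y, V y & rnorm y = 1 /\ forall i, (i < n)%N -> inner (e i) y = 0.
Proof.
move=> nV oe Ve linV.
have [v Vv hv] : exists2 v, V v & forall c : 'I_n -> R[i], v <> \sum_(i < n) c i *: e i.
  apply: contrapT => h; apply: nV; exists n, (fun i => e i) => x Vx.
  by apply: contrapT => h'; apply: h; exists x => // c xc; apply: h'; exists c.
pose w := v - \sum_(i < n) inner (e i) v *: e i.
have w0 : 0 < rnorm w.
  rewrite lt_def rnorm_ge0 andbT; apply/eqP => /rnorm_eq0/eqP; rewrite subr_eq0 => /eqP.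
  exact: hv.
have Vw : V w.
  have : forall m, (m <= n)%N -> V (v - \sum_(i < m) inner (e i) v *: e i).
    elim=> [|m IH] mn; first by rewrite big_ord0 subr0.
    rewrite big_ord_recr/= opprD addrA addrC -scaleNr.
    by apply: linV; [exact: Ve | exact: IH (ltnW mn)].
  exact.
have V0 : V 0 by have := linV (-1) v v Vv Vv; rewrite scaleN1r addNr.
exists ((rnorm w)^-1%:C *: w); first by rewrite -[_ *: w]addr0; exact: linV.
split; first by rewrite rnormZ cnR ger0_norm ?invr_ge0 ?rnorm_ge0// mulVf ?gt_eqF.
move=> i i_n; rewrite innerZr [inner _ w](_ : _ = 0) ?mulr0//.
rewrite /w innerDr innerNr inner_sumr (bigD1 (Ordinal i_n))//= innerZr oe// eqxx mulr1.
rewrite big1 ?addr0 ?subrr// => j ji; rewrite innerZr oe// [_ == _](_ : _ = false) ?mulr0//.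
by apply/negbTE; apply: contraNneq ji => h; apply/eqP/val_inj.
Qed.

Lemma compact_op_cluster (K : H -> H) (x : nat -> H) : compact_op K ->
  (forall n, rnorm (x n) <= 1) ->
  exists y, forall (e : R) N, 0 < e -> exists2 n, (N <= n)%N & rnorm (K (x n) - y) < e.
Proof.
move=> [_ cK] x1; rewrite precompactE in cK.
have [|y [_ hy]] := cK ((fun n => K (x n)) @ \oo) _.
  apply: (@nearW _ \oo) => n; apply: subset_closure; exists (x n) => //.
  by rewrite /= unit_ballE.
exists y => e N e0; have := hy [set K (x n) | n in [set n | (N <= n)%N]] [set y' | rnorm (y' - y) < e].
case.
- by exists N => // n /= Nn; exists n.
- by apply/nbhs_rnorm; exists e.
- by move=> _ [[n Nn <-] h]; exists n.
Qed.

End Orthonormal.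

Section Virial.
Context {R : realType} {H : hilbertType R}.
Variables (A : partial_op H) (W : R -> H -> H) (U T : H -> H).
Variables (E : set (borel_torus R) -> H -> H) (b : R) (p : nat -> R).
Hypotheses (denseA : dense (dom A)) (WA : unitary_group A W).
Hypotheses (unitaryU : unitary U) (HE : spectral_family U E).
Hypotheses (adT : is_ad A U T) (bT : bnd b T) (b0 : 0 <= b).
Hypotheses (zyg : zygmund W U p) (sp : summable_seq p).

Let HP : projection_valued_measure E := HE.1.
Let gW := unitary_group_ugroup WA.
Let adjU := unitary_adjp unitaryU.
Let linU : linear U. Proof. exact: adjp_linear adjU. Qed.
Let linT : linear T. Proof. by case: adT => -[]. Qed.
Let bU : bnd 1 U.
Proof. by move=> x; rewrite unitary_iso// mul1r. Qed.

Let isoU x y : inner (U x) (U y) = inner x y.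
Proof. by rewrite -adjU; case: unitaryU => _ h _; rewrite -[adj U _]/((adj U \o U) x) h. Qed.

Lemma eigenvalue_norm l x : x != 0 -> U x = l *: x -> cn l = 1.
Proof.
move=> x0 Ux; apply: (@mulIf _ (rnorm x)); last by rewrite -rnormZ -Ux unitary_iso// mul1r.
by apply: contra_neq x0; exact: rnorm_eq0.
Qed.

Lemma unit_mulC (l : R[i]) : cn l = 1 -> conjc l * l = 1.
Proof.
move=> l1; have := cn_sqr l; rewrite l1 expr1n; case: l {l1} => u v /= h.
by apply/eqP; rewrite eq_complex /=; apply/andP; split; apply/eqP; [rewrite h|]; ring.
Qed.

Lemma eigenvectors_orthogonal l m x y : U x = l *: x -> U y = m *: y -> l <> m ->
  inner x y = 0.
Proof.
move=> Ux Uy lm; have [->|x0] := eqVneq x 0; first by rewrite inner0l.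
have := isoU x y; rewrite Ux Uy innerZl innerZr mulrA.
have l1 := unit_mulC (eigenvalue_norm x0 Ux).
move/eqP; rewrite -subr_eq0 -[X in _ - X]mul1r -mulrBl mulf_eq0 => /orP[|/eqP//].
rewrite subr_eq0 => /eqP h; case: lm; apply: (@mulfI _ (conjc l)); last by rewrite l1 h.
by apply/eqP => l0; move: l1; rewrite l0 mul0r => /eqP; rewrite eq_sym oner_eq0.
Qed.

(* The commutator of U with the bounded difference quotients of W, which are
   Wdiff W U t (W t x), has vanishing expectation in an eigenvector of U. *)
Lemma virial l x : U x = l *: x -> re (U x) (T x) = 0.
Proof.
move=> Ux; have [->|x0] := eqVneq x 0; first by rewrite (lop0 linU) /re inner0l.
have l1 := unit_mulC (eigenvalue_norm x0 Ux).
have zero t : inner (U x) (Wdiff W U t (W t x)) = 0.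
  rewrite /Wdiff innerZr innerBr /conj_op (groupK gW) isoU Ux innerZl.
  have -> : W t (l *: x) = l *: W t x by rewrite (lopZ (group_linear gW t)).
  by rewrite innerZr mulrA l1 mul1r subrr mulr0.
have near0 : forall e : R, 0 < e -> cn (inner (U x) (T x)) <= e * (rnorm x ^+ 2 + b * rnorm x).
  move=> e e0; have [N hN] := Wdiff_lim WA denseA adjU bU adT bT zyg sp e0.
  have [_ W0 _ Wc _] := WA.
  have := Wc x 0; rewrite /prop_for /continuous_at W0 => /cvg_rnorm/(_ e e0).
  move=> /nbhs_ballP[d /= d0 hd].
  have [M hM] := summable_cvg0 (@summable_geometric R) (divr_gt0 d0 (ltr0Sn R 1)).
  pose k := maxn N M.
  have h1 := hN k (leq_maxl _ _) (W (2^-1 ^+ k) x); rewrite (group_iso gW) in h1.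
  have h2 : rnorm (W (2^-1 ^+ k) x - x) < e.
    apply: hd; rewrite /ball/= sub0r normrN ger0_norm ?exprn_ge0 ?invr_ge0//.
    apply: le_lt_trans (hM k (leq_maxr _ _)) _; lra.
  (* [T x] is compared with the quotient at [W t x], where the expectation vanishes; the
     displacement [W t x - x] is small by strong continuity. *)
  have -> : T x = - (Wdiff W U (2^-1 ^+ k) (W (2^-1 ^+ k) x) - T (W (2^-1 ^+ k) x))
    + Wdiff W U (2^-1 ^+ k) (W (2^-1 ^+ k) x) - T (W (2^-1 ^+ k) x - x).
    by rewrite (lopB linT); hring.
  rewrite innerBr innerDr innerNr zero addr0; apply: le_trans (cnD _ _) _; rewrite !cnN.
  have k1 := cauchy_schwarz (U x) (Wdiff W U (2^-1 ^+ k) (W (2^-1 ^+ k) x) - T (W (2^-1 ^+ k) x)).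
  have k2 := cauchy_schwarz (U x) (T (W (2^-1 ^+ k) x - x)).
  rewrite (unitary_iso x unitaryU) in k1 k2; rewrite mulrDr; apply: lerD.
    by apply: le_trans k1 _; rewrite expr2 mulrA mulrC ler_wpM2r ?rnorm_ge0.
  apply: le_trans k2 _; rewrite mulrA mulrC ler_wpM2r ?rnorm_ge0//.
  by apply: le_trans (bT _) _; rewrite mulrC ler_wpM2r// ltW.
have : cn (inner (U x) (T x)) = 0.
  apply/eqP; rewrite eq_le cn_ge0 andbT; apply/ler_addgt0Pl => e e0; rewrite addr0.
  have c0 : 0 < rnorm x ^+ 2 + b * rnorm x + 1.
    by rewrite ltr_wpDl// addr_ge0 ?sqr_ge0// mulr_ge0 ?rnorm_ge0.
  have h := near0 (e / (rnorm x ^+ 2 + b * rnorm x + 1)) (divr_gt0 e0 c0).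
  apply: le_trans h _; rewrite mulrAC ler_pdivrMr// ler_wpM2l ?(ltW e0)//; lra.
by move/cn_eq0; rewrite /re => ->.
Qed.

Variables (Theta : set (torus R)) (c : R) (K : H -> H).
Hypotheses (openT : open Theta) (c0 : 0 < c) (cK : compact_op K).
Hypothesis mourre : forall x, E Theta x = x -> c * rnorm x ^+ 2 + re x (K x) <= re (U x) (T x).

Let mT : measurable (Theta : set (borel_torus R)) := open_measurable_torus openT.

Lemma no_orthonormal_eigenvectors e (t : nat -> torus R) : (forall n, orthonormal_upto n e) ->
  (forall n, Theta (t n)) -> (forall n, U (e n) = (set_val (t n) : R[i]) *: e n) -> False.
Proof.
move=> oe Tt Ue.
have e1 n : rnorm (e n) = 1.
  have := oe n.+1 n n (ltnSn n) (ltnSn n); rewrite eqxx inner_rnorm => /(congr1 (@complex.Re R)) /=.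
  by move/eqP; rewrite -[X in _ == X](expr1n _ 2) eqrXn2// ?rnorm_ge0// => /eqP.
have e1' n : rnorm (e n) <= 1 by rewrite e1.
have [y hy] := compact_op_cluster cK e1'.
(* By the Bessel inequality [e n] is asymptotically orthogonal to the cluster point [y], while
   [K (e n)] is close to [y] for arbitrarily late [n]. Hence
   [- re (e n) (K (e n)) < c / 4 + c / 2 < c], against the estimate. *)
have sb : summable_seq (fun k => cn (inner (e k) y) ^+ 2).
  by split=> [k|]; [rewrite sqr_ge0 | exists (rnorm y ^+ 2) => n; apply: bessel].
have c4 : 0 < (c / 4) ^+ 2 by rewrite exprn_gt0// divr_gt0.
have [N hN] := summable_cvg0 sb c4.
have c2 : 0 < c / 2 by rewrite divr_gt0.
have [n Nn hn] := hy (c / 2) N c2.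
have := mourre (eigenvector_spectral unitaryU HE openT (Tt n) (Ue n)).
rewrite (virial (Ue n)) e1 expr1n mulr1.
have h1 : cn (inner (e n) y) <= c / 4.
  by rewrite -(@ler_pXn2r _ 2)// ?nnegrE ?cn_ge0 ?hN// divr_ge0// ltW.
have -> : K (e n) = y + (K (e n) - y) by hring.
rewrite reDr.
have h2 : - re (e n) y <= c / 4.
  by apply: le_trans h1; rewrite -reNr; apply: le_trans (Re_le_cn _) _; rewrite innerNr cnN.
have h3 : - re (e n) (K (e n) - y) < c / 2.
  rewrite -reNr; apply: le_lt_trans (re_le _ _) _; by rewrite e1 mul1r rnormN.
lra.
Qed.

(** The projections on shrinking balls tend strongly to the atom at [t], which is [0] because
    [spectral_atom] makes it an eigenvector; composition with the compact [K] turns this into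
    convergence in norm. *)
Lemma compact_localized (t : torus R) : (forall x, U x = (set_val t : R[i]) *: x -> x = 0) ->
  forall e, 0 < e -> exists N, forall n, (N <= n)%N ->
    forall x, rnorm (E (torus_ball (set_val t) n.+1%:R^-1) (K x)) <= e * rnorm x.
Proof.
move=> ne e e0; pose F n : set (borel_torus R) := torus_ball (set_val t) n.+1%:R^-1.
have mF n : measurable (F n) := torus_ball_measurable _ _.
have dF n m : (n <= m)%N -> F m `<=` F n.
  move=> nm s; rewrite /F /torus_ball/= => h; apply: lt_le_trans h _.
  by rewrite lef_pV2 ?posrE ?ltr0n// ler_nat.
have F0 y : E (\bigcap_n F n) y = 0.
  rewrite (bigcap_torus_ball t); exact: ne (spectral_atom unitaryU HE t y).
have linK : linear K by case: cK => -[].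
have [N hN] : exists N, forall x, rnorm x <= 1 -> rnorm (E (F N) (K x)) <= e.
  apply: contrapT => nh.
  have ch n : exists x, rnorm x <= 1 /\ e < rnorm (E (F n) (K x)).
    apply: contrapT => h; apply: nh; exists n => x x1; rewrite leNgt; apply/negP => ex.
    by apply: h; exists x.
  have [x hx] := choice ch.
  have [y hy] := compact_op_cluster cK (fun n => (hx n).1).
  have e2 : 0 < (e / 2) ^+ 2 by rewrite exprn_gt0// divr_gt0.
  have [N hN] := pvm_decreasing HP mF dF (F0 y) e2.
  have [n Nn hn] := hy (e / 2) N (divr_gt0 e0 (ltr0Sn R 1)).
  have := (hx n).2; have := hN n Nn.
  rewrite ltr_pXn2r ?nnegrE ?rnorm_ge0 ?divr_ge0 ?(ltW e0)//.
  have -> : K (x n) = y + (K (x n) - y) by hring.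
  rewrite (lopD (pvm_linear HP (mF n))).
  have := rnormD (E (F n) y) (E (F n) (K (x n) - y)).
  have := pvm_le HP (K (x n) - y) (mF n); lra.
exists N => n Nn x; rewrite -/(F n).
have -> : E (F n) (K x) = E (F n) (E (F N) (K x)).
  by rewrite -(pvm_setI HP)// setIidl//; exact: dF.
apply: le_trans (pvm_le HP _ (mF n)) _.
have [->|x0] := eqVneq x 0.
  by rewrite (lop0 linK) (lop0 (pvm_linear HP (mF N))) rnorm0 mulr0.
have xp : 0 < rnorm x by rewrite lt_def rnorm_ge0 andbT; apply: contra_neq x0; exact: rnorm_eq0.
have := hN ((rnorm x)^-1%:C *: x).
rewrite (lopZ linK) (lopZ (pvm_linear HP (mF N))) !rnormZ cnR ger0_norm ?invr_ge0 ?rnorm_ge0//.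
by rewrite mulVf ?gt_eqF// => /(_ (lexx _)); rewrite mulrC ler_pdivrMr.
Qed.

Lemma strict_at_noneigenvalue (t : torus R) : Theta t ->
  (forall x, U x = (set_val t : R[i]) *: x -> x = 0) ->
  exists2 r, 0 < r & strict_at U T E t r.
Proof.
move=> Tt ne; have [r r0 hr] := torus_open_ball openT Tt.
have [N hN] := compact_localized ne (divr_gt0 c0 (ltr0Sn R 1)).
have [M hM] := ltr_add_invr r0; rewrite add0r in hM.
pose n := maxn N M; exists n.+1%:R^-1; first by rewrite invr_gt0 ltr0n.
exists (c / 2); first by rewrite divr_gt0.
move=> x; have mB := torus_ball_measurable (set_val t : R[i]) (n.+1%:R^-1 : R).
set y := E _ x.
have Py : E (torus_ball (set_val t) n.+1%:R^-1) y = y by rewrite /y (pvm_idem HP).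
have Ty : E Theta y = y.
  rewrite -Py -(pvm_setI HP)// setIidr// => s; rewrite /torus_ball/= => h; apply: hr.
  apply: lt_trans h _; apply: le_lt_trans hM.
  by rewrite lef_pV2 ?posrE ?ltr0n// ler_nat ltnS leq_maxr.
apply: le_trans (mourre Ty).
have : - re y (K y) <= c / 2 * rnorm y ^+ 2.
  rewrite -{1}Py /re (pvm_adj HP mB) -/(re _ _) -reNr; apply: le_trans (re_le _ _) _.
  rewrite rnormN mulrC expr2 mulrA ler_wpM2r ?rnorm_ge0//.
  exact: hN (leq_maxl _ _) y.
lra.
Qed.

End Virial.

Section EigenvalueFiniteness.
Context {R : realType} {H : hilbertType R}.
Variables (U : H -> H) (Theta : set (torus R)).
Hypothesis unitaryU : unitary U.
Hypothesis no_seq : forall (e : nat -> H) (t : nat -> torus R), (forall n, orthonormal_upto n e) ->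
  (forall n, Theta (t n)) -> (forall n, U (e n) = (set_val (t n) : R[i]) *: e n) -> False.

Let linU : linear U. Proof. by case: unitaryU => -[]. Qed.

Let no_unit_eigenvectors (G : set H) :
  (forall x, G x -> rnorm x = 1 /\ exists2 t, Theta t & U x = (set_val t : R[i]) *: x) ->
  ~ (forall n e, (forall i, (i < n)%N -> G (e i)) -> orthonormal_upto n e ->
    exists2 y, G y & forall i, (i < n)%N -> inner (e i) y = 0).
Proof.
move=> hG ext; have [e Ge oe] := orthonormal_sequence (fun x Gx => (hG x Gx).1) ext.
have /choice[t ht] n : exists t, Theta t /\ U (e n) = (set_val t : R[i]) *: e n.
  by have [_ [t Tt Ut]] := hG _ (Ge n); exists t.
by apply: (no_seq oe (t := t)) => n; case: (ht n).
Qed.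

Lemma eigenvalues_finite :
  finite_set ((set_val @` Theta : set R[i]^o) `&` point_spectrum U).
Proof.
apply: contrapT => inf.
apply: (@no_unit_eigenvectors
  [set x | rnorm x = 1 /\ exists2 t, Theta t & U x = (set_val t : R[i]) *: x]) => //.
move=> n e Ge _.
(* The numbers [inner (e i) (U (e i))] are the eigenvalues of the vectors already chosen; a new
   eigenvalue gives a vector orthogonal to them. *)
have [l [[[t Tt <-] [x x0 Ux]] nl]] : exists l,
   ((set_val @` Theta : set R[i]^o) `&` point_spectrum U) l /\
   ~ [set inner (e i) (U (e i)) | i in `I_n] l.
  apply: contrapT => h; apply: inf.
  apply: sub_finite_set (finite_image (fun i => inner (e i) (U (e i))) (finite_II n)).
  by move=> l Sl; apply: contrapT => nl; apply: h; exists l.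
have xp : rnorm x != 0 by apply: contra_neq x0; exact: rnorm_eq0.
have Uy : U ((rnorm x)^-1%:C *: x) = (set_val t : R[i]) *: ((rnorm x)^-1%:C *: x).
  by rewrite (lopZ linU) Ux !scalerA mulrC.
exists ((rnorm x)^-1%:C *: x) => [/=|i i_n].
  split; first by rewrite rnormZ cnR ger0_norm ?invr_ge0 ?rnorm_ge0// mulVf.
  by exists t.
have [e1 [s Ts Us]] := Ge i i_n.
apply: (eigenvectors_orthogonal unitaryU Us Uy) => st; apply: nl; exists i => //.
by rewrite Us innerZr inner_rnorm e1 expr1n mulr1 st.
Qed.

Lemma eigenspaces_finite_dim l : (set_val @` Theta : set R[i]^o) l ->
  finite_dim (eigen_subspace U l).
Proof.
move=> [t Tt <-]; apply: contrapT => nV.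
apply: (@no_unit_eigenvectors [set x | eigen_subspace U (set_val t) x /\ rnorm x = 1]).
  by move=> x [Ux x1]; split => //; exists t.
move=> n e Ge oe.
have [|a x y|y Vy [y1 yo]] := not_finite_dim_orthogonal nV oe; last by exists y.
- by move=> i /Ge[].
- rewrite /eigen_subspace/= => Ux Uy; rewrite (lopD linU) (lopZ linU) Ux Uy.
  by rewrite scalerDr !scalerA mulrC.
Qed.

End EigenvalueFiniteness.

(** * Boundary values of the resolvent *)

Section BoundaryExtension.
Context {R : realType}.
Implicit Types (f g : R[i] -> R[i]) (p w z : R[i]).

(** At points of the open disk this is continuity, on the circle it is the existence of a limit from
    inside; [disk_cauchy_extends] treats both at once. *)
Definition disk_cauchy f p := forall e, 0 < e -> exists2 d, 0 < d & forall w w',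
  cn w < 1 -> cn w' < 1 -> cn (w - p) < d -> cn (w' - p) < d -> cn (f w - f w') <= e.

Lemma disk_approx p d : cn p <= 1 -> 0 < d -> exists2 w, cn w < 1 & cn (w - p) < d.
Proof.
move=> p1 d0; pose s := Num.min (d / 2) 1.
have s0 : 0 < s by rewrite lt_min divr_gt0// ltr01.
have s1 : s <= 1 by rewrite ge_min lexx orbT.
have sd : s <= d / 2 by rewrite ge_min lexx.
exists ((1 - s)%:C * p).
  rewrite cnM cnR ger0_norm ?subr_ge0//; have := cn_ge0 p; nra.
have -> : (1 - s)%:C * p - p = (- s)%:C * p by rewrite !rmorphB/= rmorphN /= rmorph1; ring.
rewrite cnM cnR normrN ger0_norm ?(ltW s0)//; have := cn_ge0 p; nra.
Qed.

Let real_complete (u : nat -> R) :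
  (forall e : R, 0 < e -> exists n, forall m, (n <= m)%N -> `|u m - u n| < e) ->
  exists l, forall e : R, 0 < e -> exists n, forall m, (n <= m)%N -> `|u m - l| < e.
Proof.
move=> h; have /cauchy_cvgP/cvg_ex[l /= ul] : cauchy (u @ \oo).
  apply: cauchy_exP => r r0.
  have [n hn] := h r r0; exists (u n).
  by exists n => // m /= nm; rewrite /ball/= distrC; exact: hn.
exists l => e e0; have /cvgrPdist_lt/(_ e e0)[n _ hn] := ul.
by exists n => m nm; rewrite distrC; apply: hn.
Qed.

Lemma disk_cauchy_limit f p : cn p <= 1 -> disk_cauchy f p ->
  exists l, forall e, 0 < e -> exists2 d, 0 < d & forall w,
    cn w < 1 -> cn (w - p) < d -> cn (f w - l) <= e.
Proof.
move=> p1 hf.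
have /choice[s hs] n : exists w, cn w < 1 /\ cn (w - p) < (n.+1%:R : R)^-1.
  have [|w ? ?] := disk_approx (d := n.+1%:R^-1) p1; first by rewrite invr_gt0.
  by exists w.
have near d : 0 < d -> exists N, forall n, (N <= n)%N -> cn (s n - p) < d.
  move=> d0; have [N hN] := ltr_add_invr d0; rewrite add0r in hN; exists N => n Nn.
  apply: lt_trans (hs n).2 _; apply: le_lt_trans hN.
  by rewrite lef_pV2 ?posrE ?ltr0n// ler_nat.
have cauchy_s (e : R) : 0 < e -> exists n, forall m, (n <= m)%N -> cn (f (s m) - f (s n)) < e.
  move=> e0; have [d d0 hd] := hf (e / 2) (divr_gt0 e0 (ltr0Sn R 1)).
  have [N hN] := near d d0; exists N => m Nm.
  have := hd _ _ (hs m).1 (hs N).1 (hN m Nm) (hN N (leqnn _)); lra.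
have Im_cn (a : R[i]) : `|complex.Im a| <= cn a.
  rewrite -(@ler_pXn2r _ 2)// ?nnegrE ?cn_ge0// cn_sqr real_normK ?num_real//.
  by rewrite lerDr sqr_ge0.
have [l1 h1] : exists l, forall e : R, 0 < e -> exists n, forall m, (n <= m)%N ->
    `|complex.Re (f (s m)) - l| < e.
  apply: real_complete => e /cauchy_s[n hn]; exists n => m nm.
  by apply: le_lt_trans (hn m nm); apply: le_trans (cn_Re _); case: (f _); case: (f _).
have [l2 h2] : exists l, forall e : R, 0 < e -> exists n, forall m, (n <= m)%N ->
    `|complex.Im (f (s m)) - l| < e.
  apply: real_complete => e /cauchy_s[n hn]; exists n => m nm.
  by apply: le_lt_trans (hn m nm); apply: le_trans (Im_cn _); case: (f _); case: (f _).
exists (l1 +i* l2) => e e0; have e4 : 0 < e / 4 by rewrite divr_gt0.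
have [d d0 hd] := hf (e / 4) e4; exists d => // w w1 wp.
have [N hN] := near d d0; have [N1 k1] := h1 (e / 4) e4; have [N2 k2] := h2 (e / 4) e4.
pose n := maxn N (maxn N1 N2).
have j1 := hd w (s n) w1 (hs n).1 wp (hN n (leq_maxl _ _)).
have j2 := k1 n (leq_trans (leq_maxl _ _) (leq_maxr _ _)).
have j3 := k2 n (leq_trans (leq_maxr _ _) (leq_maxr _ _)).
have -> : f w - (l1 +i* l2) = (f w - f (s n)) + ((complex.Re (f (s n)) - l1)%:C +
    'i%C * (complex.Im (f (s n)) - l2)%:C).
  by case: (f (s n)) => a b; case: (f w) => a' b'; apply/eqP; rewrite eq_complex /=;
    apply/andP; split; apply/eqP; ring.
have := cnD (f w - f (s n)) ((complex.Re (f (s n)) - l1)%:C + 'i%C * (complex.Im (f (s n)) - l2)%:C).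
have := cnD ((complex.Re (f (s n)) - l1)%:C : R[i]) ('i%C * (complex.Im (f (s n)) - l2)%:C).
rewrite cnM cn_i !cnR; lra.
Qed.

Lemma disk_cauchy_extends (f : R[i]^o -> R[i]^o) (S : set R[i]^o) :
  (forall p, (@disk R `|` S) p -> cn p <= 1 /\ disk_cauchy f p) ->
  extends_continuously f (@disk R) S.
Proof.
move=> hf.
pose L p l := forall e : R, 0 < e -> exists2 d, 0 < d & forall w,
    cn w < 1 -> cn (w - p) < d -> cn (f w - l) <= e.
have diskE p : disk p = (cn p < 1) :> Prop by rewrite /disk/= norm_cn ltcR.
pose g p := if cn p < 1 then f p else xget 0 [set l | L p l].
have gL p : (@disk R `|` S) p -> L p (g p).
  move=> Dp; have [p1 cp] := hf p Dp; rewrite /g; case: ifP => [pd|_].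
    move=> e /cp[d d0 hd]; exists d => // w w1 wp; apply: hd => //.
    by rewrite subrr cn0.
  have [l hl] := disk_cauchy_limit p1 cp.
  exact: (xgetPex (P := [set l | L p l]) _ (ex_intro _ l hl)).
exists g; split; first by move=> p; rewrite inE diskE /g => ->.
apply/subspace_continuousP => p Dp; apply/cvg_cn => e e0.
have e3 : 0 < e / 3 by rewrite divr_gt0.
have [d d0 hd] := gL p Dp (e / 3) e3.
rewrite /within/=; apply/nbhs_cn; exists (d / 2); first by rewrite divr_gt0.
move=> w wp Dw; have [w1 _] := hf w Dw; have [d' d'0 hd'] := gL w Dw (e / 3) e3.
have dd : 0 < Num.min d' (d / 2) by rewrite lt_min d'0 divr_gt0.
(* [w] may lie on the circle, where only limits from inside are known, so [g w] and [g p] are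
   compared through a point [v] of the open disk. *)
have [v v1] := disk_approx w1 dd; rewrite lt_min => /andP[vd vd'].
have h1 := hd' v v1 vd; have h2 : cn (v - p) < d.
  by have := cnD (v - w) (w - p); rewrite addrA subrK; lra.
have h3 := hd v v1 h2.
have -> : g w - g p = (f v - g p) - (f v - g w) by ring.
have := cnD (f v - g p) (- (f v - g w)); rewrite cnN; lra.
Qed.

Lemma disk_cauchy_conj f p : disk_cauchy f (conjc p) -> disk_cauchy (fun z => f (conjc z)) p.
Proof.
have cB (a b : R[i]) : conjc a - conjc b = conjc (a - b) by rewrite rmorphB.
move=> h e /h[d d0 hd]; exists d => // w w' w1 w1' wp wp'.
by apply: hd; rewrite ?cB cn_conj.
Qed.

Lemma disk_cauchy_affine c f p : disk_cauchy f p -> disk_cauchy (fun z => c - f z) p.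
Proof.
move=> h e /h[d d0 hd]; exists d => // w w' w1 w1' wp wp'.
by rewrite -cnN (_ : - _ = f w - f w'); [exact: hd | ring].
Qed.

Lemma disk_cauchy_conj_val f p : disk_cauchy f p -> disk_cauchy (fun z => conjc (f z)) p.
Proof.
move=> h e /h[d d0 hd]; exists d => // w w' w1 w1' wp wp'.
by rewrite -(rmorphB (@conjc R)) cn_conj hd.
Qed.

Lemma boundary_uniform_cauchy (l : torus R) r f : 0 < r ->
  boundary_uniform (local_disk l r) f -> disk_cauchy f (conjc (set_val l)).
Proof.
move=> r0 [_ h] e /h[d d0 hd]; exists (Num.min (r / 2) (d / 2)); first by rewrite lt_min !divr_gt0.
move=> w w' w1 w1'; rewrite !lt_min => /andP[h1 h2] /andP[h3 h4].
apply: hd => //; [split; exact: ltW|split; exact: ltW|].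
have := cnD (w - conjc (set_val l)) (- (w' - conjc (set_val l))); rewrite cnN.
have -> : w - conjc (set_val l) - (w' - conjc (set_val l)) = w - w' by ring.
lra.
Qed.

End BoundaryExtension.

(** * The resolvent inside the disk *)

Section ResolventRegularity.
Context {R : realType} {H : hilbertType R}.
Variables (V Vs : H -> H).
Hypotheses (adjV : adjp V Vs) (bV : bnd 1 V).

Lemma resolvent_identity z h y : cn z < 1 -> cn (z + h) < 1 ->
  resolventU V (z + h) y - resolventU V z y =
  h *: resolventU V (z + h) (V (resolventU V z y)).
Proof.
move=> z1 zh1; have cz := one_sub_cop adjV bV z1; have czh := one_sub_cop adjV bV zh1.
have lR := op_inv_linear czh; rewrite -/(resolventU V (z + h)) in lR.
have e1 : resolventU V z y - z *: V (resolventU V z y) = y := op_invK y cz.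
have e2 x : resolventU V (z + h) (x - (z + h) *: V x) = x := op_invKV x czh.
have e : resolventU V z y = resolventU V (z + h) (y - h *: V (resolventU V z y)).
  by rewrite -[LHS]e2; congr (resolventU V (z + h) _); rewrite -[X in _ = X - _]e1; hring.
by rewrite {1}e (lopB lR) (lopZ lR); hring.
Qed.

Lemma resolvent_bound z y : cn z < 1 -> rnorm (resolventU V z y) <= rnorm y / (1 - cn z).
Proof. by move=> z1; exact: op_inv_le y (one_sub_cop adjV bV z1). Qed.

Lemma resolvent_holomorphic x y :
  holomorphic_on (@disk R) (fun z : R[i]^o => inner x (resolventU V z y) : R[i]^o).
Proof.
move=> z; rewrite /disk/= norm_cn ltcR => z1; apply/cvg_ex.
(* The derivative of the resolvent [R] at [z] is [R V R], as read off [resolvent_identity]. *)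
pose w := V (resolventU V z y); exists (inner x (resolventU V z w)).
apply/cvg_cn => e e0.
pose C := rnorm x * (rnorm (V (resolventU V z w)) / ((1 - cn z) / 2)).
have z10 : 0 < (1 - cn z) / 2 by rewrite divr_gt0// subr_gt0.
have C0 : 0 <= C by rewrite !mulr_ge0 ?rnorm_ge0// invr_ge0 ltW.
have C1 : 0 < C + 1 by rewrite ltr_wpDl.
rewrite /within/=; apply/nbhs_cn; exists (Num.min ((1 - cn z) / 2) (e / (C + 1))).
  by rewrite lt_min z10 divr_gt0.
move=> h; rewrite subr0 lt_min (ltr_pdivlMr _ _ C1) => /andP[h1 h2] h0.
have zh1 : cn (z + h) <= 1 - (1 - cn z) / 2 by have := cnD z h; lra.
have zh2 : cn (z + h) < 1 by lra.
rewrite /= [h *: 1]mulr1 [h + z]addrC -innerBr resolvent_identity// innerZr.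
rewrite /GRing.scale/= mulrA mulVf// mul1r -innerBr resolvent_identity// innerZr cnM.
apply: le_lt_trans h2; apply: ler_wpM2l; first exact: cn_ge0.
apply: le_trans (_ : C <= _); last by rewrite lerDl.
apply: le_trans (cauchy_schwarz _ _) _; rewrite ler_wpM2l ?rnorm_ge0//.
apply: le_trans (resolvent_bound _ zh2) _; rewrite ler_wpM2l ?rnorm_ge0//.
by rewrite lef_pV2 ?posrE//; lra.
Qed.

Lemma resolvent_disk_cauchy x y p : cn p < 1 ->
  disk_cauchy (fun z => inner x (resolventU V z y)) p.
Proof.
move=> p1 e e0; pose C := rnorm x * (rnorm (V (resolventU V p y)) / ((1 - cn p) / 2)).
have p10 : 0 < (1 - cn p) / 2 by rewrite divr_gt0// subr_gt0.
have C0 : 0 <= C by rewrite !mulr_ge0 ?rnorm_ge0// invr_ge0 ltW.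
have C1 : 0 < 2 * (C + 1) by rewrite mulr_gt0// ltr_wpDl.
exists (Num.min ((1 - cn p) / 2) (e / (2 * (C + 1)))); first by rewrite lt_min p10 divr_gt0.
have near w : cn (w - p) < Num.min ((1 - cn p) / 2) (e / (2 * (C + 1))) ->
    cn (inner x (resolventU V w y) - inner x (resolventU V p y)) <= e / 2.
  rewrite lt_min (ltr_pdivlMr _ _ C1) => /andP[h1 h2].
  have w1 : cn w <= 1 - (1 - cn p) / 2 by have := cnD (w - p) p; rewrite subrK; lra.
  have w2 : cn w < 1 by lra.
  have e1 : w = p + (w - p) by ring.
  rewrite -innerBr e1 resolvent_identity -?e1// innerZr cnM.
  have k : cn (inner x (resolventU V w (V (resolventU V p y)))) <= C.
    apply: le_trans (cauchy_schwarz _ _) _; rewrite ler_wpM2l ?rnorm_ge0//.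
    apply: le_trans (resolvent_bound _ w2) _; rewrite ler_wpM2l ?rnorm_ge0//.
    by rewrite lef_pV2 ?posrE//; lra.
  have : cn (w - p) * cn (inner x (resolventU V w (V (resolventU V p y)))) <= cn (w - p) * (C + 1).
    by rewrite ler_wpM2l ?cn_ge0//; lra.
  lra.
move=> w w' _ _ /near h1 /near h2.
have -> : inner x (resolventU V w y) - inner x (resolventU V w' y) =
  (inner x (resolventU V w y) - inner x (resolventU V p y)) -
  (inner x (resolventU V w' y) - inner x (resolventU V p y)) by ring.
by apply: le_trans (cnD _ _) _; rewrite cnN; lra.
Qed.

End ResolventRegularity.

Section ResolventIdentification.
Context {R : realType} {H : hilbertType R}.
Variable (U : H -> H).
Hypothesis unitaryU : unitary U.

Let adjU := unitary_adjp unitaryU.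
Let bU : bnd 1 U.
Proof. by move=> x; rewrite unitary_iso// mul1r. Qed.
Let bUs : bnd 1 (adj U).
Proof. by apply: adjp_bnd adjU bU. Qed.
Let UsU x : adj U (U x) = x.
Proof. by case: unitaryU => _ h _; rewrite -[LHS]/((adj U \o U) x) h. Qed.
Let UUs x : U (adj U x) = x.
Proof. by case: unitaryU => _ _ h; rewrite -[LHS]/((U \o adj U) x) h. Qed.

(** [1 - z U^*] is the adjoint of [1 - conjc z U], so boundary values at [z] come from those of
    [resolventU U] at the conjugate point, with the vectors exchanged. *)
Lemma resolvent_inE phi psi z : cn z < 1 ->
  resolvent_in U phi psi z = conjc (inner psi (resolventU U (conjc z) phi)).
Proof.
move=> z1; rewrite /resolvent_in -innerC.
have cz : cn (conjc z) < 1 by rewrite cn_conj.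
by have := op_inv_swap phi psi (copC (one_sub_cop adjU bU cz)); rewrite conjcK => <-.
Qed.

(** With [w = conjc z], the factorization [1 - w^-1 U^* = - w^-1 U^* (1 - w U)] gives the inverse
    [1 - (1 - w U)^-1]; the formula also reproduces the value [0] at [z = 0]. *)
Lemma resolvent_outE phi psi z : cn z < 1 ->
  resolvent_out U phi psi z = inner phi psi - inner phi (resolventU U (conjc z) psi).
Proof.
move=> z1; have cz : cn (conjc z) < 1 by rewrite cn_conj.
have cU := one_sub_cop adjU bU cz.
have lR := op_inv_linear cU; rewrite -/(resolventU U (conjc z)) in lR.
rewrite /resolvent_out; case: eqP => [z0|/eqP z0].
  have : resolventU U (conjc z) psi - conjc z *: U (resolventU U (conjc z) psi) = psi := op_invK psi cU.
  by rewrite z0 conjc0 scale0r subr0 => ->; rewrite subrr.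
have cz0 : conjc z != 0 by rewrite conjc_eq0.
rewrite -innerBr; congr (inner phi _).
have E1 x : resolventU U (conjc z) (x - conjc z *: U x) = x := op_invKV x cU.
have E2 x : resolventU U (conjc z) x - conjc z *: U (resolventU U (conjc z) x) = x := op_invK x cU.
pose S x := x - resolventU U (conjc z) x.
pose T x := x - (conjc z)^-1 *: adj U x.
have ST x : S (T x) = x.
  rewrite /S /T; have -> : x - (conjc z)^-1 *: adj U x = (- (conjc z)^-1 *: adj U x) -
      conjc z *: U (- (conjc z)^-1 *: adj U x).
    rewrite (lopZ (adjp_linear adjU)) UUs.
    by apply: inner_ext => v; rewrite !(innerDr, innerNr, innerZr); field.
  rewrite E1 (lopZ (adjp_linear adjU)) UUs.
  by apply: inner_ext => v; rewrite !(innerDr, innerNr, innerZr); field.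
have TS x : T (S x) = x.
  have e : x - resolventU U (conjc z) x = - conjc z *: U (resolventU U (conjc z) x).
    by rewrite -{1}(E2 x); hring.
  rewrite /T /S {2}e (lopZ (adjp_linear (adjpC adjU))) UsU.
  by apply: inner_ext => v; rewrite !(innerDr, innerNr, innerZr); field.
have [k _] := xgetPex (P := [set B | cancel T B /\ cancel B T]) (fun=> 0)
  (ex_intro _ S (conj ST TS)).
by have := k (S psi); rewrite TS.
Qed.

End ResolventIdentification.

(** * Absolute continuity *)

Section NullSets.
Context {R : realType}.

Lemma lebesgue_null_cover (S : set R) : lebesgue_measure S = 0%E -> forall e, 0 < e ->
  exists a b : nat -> R, [/\ forall k, a k <= b k, S `<=` \bigcup_k `]a k, b k[%classic &
   forall n, \sum_(k < n) (b k - a k) <= e].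
Proof.
move=> S0 e e0.
have {}S0 : ((@wlength R idfun)^* S)%mu = 0%E by exact: S0.
rewrite outer_measure_open_itv_cover in S0.
have [|_ [F [itvF SF] <-] Fe] := @lb_ereal_inf_adherent _
  [set \sum_(k <oo) (@wlength R idfun) (F k) | F in open_itv_cover S]%E e e0.
  by rewrite S0.
rewrite S0 add0e in Fe.
have /choice[ab hab] := itvF.
(* The maximum gives the empty intervals of the cover the length zero instead of a negative one. *)
exists (fun k => (ab k).1), (fun k => Num.max (ab k).1 (ab k).2); split.
- by move=> k; rewrite le_max lexx.
- move=> s /SF[k _]; rewrite hab /= => h; exists k => //=.
  by move: h; rewrite !in_itv/= lt_max => /andP[-> ->]; rewrite orbT.
have lE k : wlength idfun (F k) = (Num.max (ab k).1 (ab k).2 - (ab k).1)%:E.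
  rewrite hab wlength_itv/= lte_fin /Num.max; case: ifPn => // _; by rewrite subrr.
move=> n; rewrite -lee_fin -sumEFin; apply: le_trans (ltW Fe).
apply: le_trans (nneseries_lim_ge (m := 0) n _); last first.
  by move=> k _ _; rewrite lE lee_fin subr_ge0 le_max lexx.
by rewrite big_mkord; apply: lee_sum => k _; rewrite lE.
Qed.

Lemma dist_by_derivative (f df : R -> R) : (forall x : R, is_derive x 1 f (df x)) ->
  (forall x, `|df x| <= 1) -> forall s t, `|f t - f s| <= `|t - s|.
Proof.
move=> hf hdf; have cf x : {for x, continuous f}.
  by apply: differentiable_continuous; apply/derivable1_diffP; case: (hf x).
have main s t : s <= t -> `|f t - f s| <= `|t - s|.
  move=> st; have [c _ ->] := MVT_segment st (fun x _ => hf x) (@continuous_subspaceT _ _ _ _ cf).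
  by rewrite normrM -[leRHS]mul1r ler_wpM2r.
move=> s t; have [|/ltW ts] := leP s t; first exact: main.
by rewrite distrC [leRHS]distrC; exact: main.
Qed.

Lemma cn_cos_sin (s t : R) : cn ((cos t +i* sin t) - (cos s +i* sin s)) <= 2 * `|t - s|.
Proof.
have hs := dist_by_derivative (@is_derive_sin R) (@cos_max R) s t.
have hc : `|cos t - cos s| <= `|t - s|.
  apply: (dist_by_derivative (@is_derive_cos R)) => x; rewrite normrN; exact: sin_max.
have -> : (cos t +i* sin t) - (cos s +i* sin s) =
    (cos t - cos s)%:C + 'i%C * (sin t - sin s)%:C :> R[i].
  by apply/eqP; rewrite eq_complex /=; apply/andP; split; apply/eqP; ring.
apply: le_trans (cnD _ _) _; rewrite cnM cn_i !cnR; lra.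
Qed.

Lemma torus_angle (t : torus R) :
  exists2 s : R, 0 <= s < 2 * pi & set_val t = cos s +i* sin s.
Proof.
have := cn_sqr (set_val t : R[i]); rewrite cn_torus expr1n.
case: (set_val t) => p q /= pq.
have p1 : -1 <= p <= 1.
  by rewrite -ler_norml -(@ler_pXn2r _ 2)// ?nnegrE// expr1n real_normK ?num_real// pq lerDl sqr_ge0.
have cp : cos (acos p) = p by rewrite acosK// in_itv.
have sp : sin (acos p) = `|q| by rewrite sin_acos// pq addrC addKr sqrtr_sqr.
have s0 := acos_ge0 p1; have spi := acos_lepi p1; have pi0 := pi_gt0 R.
have [q0|q0] := leP 0 q.
  exists (acos p); first by apply/andP; split => //; lra.
  by rewrite cp sp ger0_norm.
exists (2 * pi - acos p).
  have : 0 < acos p; last by move=> ?; apply/andP; split; lra.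
  apply: acos_gt0; case/andP: p1 => -> p1 /=; rewrite lt_neqAle p1 andbT.
  apply/eqP => pe; rewrite pe expr1n in pq.
  have /eqP : q ^+ 2 = 0 by lra.
  by rewrite sqrf_eq0 lt_eqF.
have e2 : 2 * pi = pi *+ 2 :> R by rewrite mulr_natl.
rewrite e2 addrC cosD2pi sinD2pi cosN sinN cp sp ltr0_norm// opprK//.
Qed.

End NullSets.

Section AbsoluteContinuity.
Context {R : realType} {H : hilbertType R}.
Variables (U : H -> H) (E : set (borel_torus R) -> H -> H).
Hypotheses (unitaryU : unitary U) (HE : spectral_family U E).

Let HP : projection_valued_measure E := HE.1.
Let adjU := unitary_adjp unitaryU.
Let linU : linear U. Proof. exact: adjp_linear adjU. Qed.
Let bU : bnd 1 U.
Proof. by move=> x; rewrite unitary_iso// mul1r. Qed.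

(* With u = (1 - z U)^-1 x one has (1 - |z|^2) |u|^2 = 2 Re <u, x> - |x|^2,
   while E_D x = E_D (1 - z U) u is small when 1 - z t is small on D. *)
Lemma arc_mass (l : torus R) r x Y : 0 < r -> 0 <= Y ->
  (forall z, local_disk l r z -> cn z < 1 -> cn (inner x (resolventU U z x)) <= Y) ->
  forall (t : torus R) h, cn (set_val t - set_val l) < r / 4 -> 0 < h -> h <= r / 4 -> h <= 2^-1 ->
  rnorm (E (torus_ball (set_val t) h) x) ^+ 2 <= 8 * Y * h.
Proof.
move=> r0 Y0 hY t h tl h0 hr h1; have mD := torus_ball_measurable (set_val t : R[i]) h.
pose z := (1 - h)%:C * conjc (set_val t : R[i]).
have zn : cn z = 1 - h by rewrite /z cnM cn_conj cn_torus mulr1 cnR ger0_norm// subr_ge0; lra.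
have zd : cn (z - conjc (set_val t)) = h.
  have -> : z - conjc (set_val t) = (- h)%:C * conjc (set_val t : R[i]).
    by rewrite /z rmorphB /= rmorphN /= rmorph1; ring.
  by rewrite cnM cn_conj cn_torus mulr1 cnR normrN ger0_norm// ltW.
have z1 : cn z < 1 by rewrite zn; lra.
have Zz : local_disk l r z.
  split; first exact: ltW.
  have := cnD (z - conjc (set_val t)) (conjc (set_val t) - conjc (set_val l)).
  rewrite addrA subrK zd -[X in _ + cn X](rmorphB (@conjc R)) cn_conj; lra.
pose u := resolventU U z x.
have ux : u - z *: U u = x := op_invK x (one_sub_cop adjU bU z1).
have k1 : rnorm (E (torus_ball (set_val t) h) x) <= 2 * h * rnorm u.
  rewrite -{1}ux (lopB (pvm_linear HP mD)) (lopZ (pvm_linear HP mD)) (spectral_commute unitaryU HE)//.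
  apply: le_trans (_ : 2 * h * rnorm (E (torus_ball (set_val t) h) u) <= _); last first.
    by rewrite ler_wpM2l ?(pvm_le HP)//; lra.
  apply: (spectral_upper_bound unitaryU HE) => //; first by lra.
  move=> s; rewrite /torus_ball/= => hs.
  have -> : 1 - z * set_val s = (1 - conjc (set_val t) * set_val s) - (z - conjc (set_val t)) * set_val s.
    by ring.
  have := cnD (1 - conjc (set_val t) * set_val s) (- ((z - conjc (set_val t)) * set_val s)).
  rewrite cnN cnM cn_torus mulr1 zd cn_torus_dist; lra.
have k2 : (1 - cn z ^+ 2) * rnorm u ^+ 2 <= 2 * Y.
  have : rnorm (u - x) ^+ 2 = (cn z * rnorm u) ^+ 2.
    by congr (_ ^+ 2); rewrite -(unitary_iso u unitaryU) -rnormZ -[X in u - X]ux; congr rnorm; hring.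
  rewrite rnormB_sqr; have : re u x <= Y.
    by rewrite reC; apply: le_trans (Re_le_cn _) _; exact: hY.
  have := sqr_ge0 (rnorm x); rewrite exprMn; lra.
(* [1 - cn z ^+ 2 = h * (2 - h) >= h]; combined with [k1] this yields
   [(2 * h)^2 * (2 * Y / h) = 8 * Y * h]. *)
have k3 : h * rnorm u ^+ 2 <= 2 * Y.
  apply: le_trans k2; rewrite ler_wpM2r ?sqr_ge0// zn; nra.
have k4 : rnorm (E (torus_ball (set_val t) h) x) ^+ 2 <= (2 * h * rnorm u) ^+ 2.
  by rewrite ler_pXn2r ?nnegrE ?rnorm_ge0// !mulr_ge0 ?rnorm_ge0// ltW.
apply: le_trans k4 _; have -> : (2 * h * rnorm u) ^+ 2 = 4 * h * (h * rnorm u ^+ 2) by ring.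
have -> : 8 * Y * h = 4 * h * (2 * Y) by ring.
by rewrite ler_wpM2l//; lra.
Qed.

Lemma null_set_mass (l : torus R) r x Y (N : set (borel_torus R)) : 0 < r -> 0 <= Y ->
  (forall z, local_disk l r z -> cn z < 1 -> cn (inner x (resolventU U z x)) <= Y) ->
  measurable N -> arc_length N = 0%E -> E (N `&` torus_ball (set_val l) (r / 4)) x = 0.
Proof.
move=> r0 Y0 hY mN N0; set D := torus_ball _ _; have mD : measurable D := torus_ball_measurable _ _.
have main e : 0 < e -> e <= r / 8 -> e <= 4^-1 ->
    rnorm (E (N `&` D) x) ^+ 2 <= 16 * Y * e.
  move=> e0 er e1; have [a [b [ab cov sum]]] := lebesgue_null_cover N0 e0.
  have small k : b k - a k <= e.
    apply: le_trans (sum k.+1); rewrite big_ord_recr/= lerDr.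
    by apply: sumr_ge0 => i _; rewrite subr_ge0.
  pose P k (t : torus R) := D t /\ exists2 s : R, `]a k, b k[%classic s & set_val t = cos s +i* sin s.
  (* The centre is taken inside [D], as [arc_mass] requires, and the radius is twice the length by
     [cn_cos_sin]. The conditions [e <= r / 8] and [e <= 4^-1] become those of [arc_mass] on the
     radius. *)
  pose F k : set (borel_torus R) := if pselect (exists t, P k t) is left h then
    torus_ball (set_val (sval (cid h)) : R[i]) (2 * (b k - a k)) else set0.
  apply: (pvm_cover HP (F := F) (c := fun k => 16 * Y * (b k - a k))).
  - exact: measurableI.
  - by move=> k; rewrite /F; case: pselect => // h; exact: torus_ball_measurable.
  - move=> t [Nt Dt].
    have [s hs ts] := torus_angle t.
    have [k _ sk] : (\bigcup_k `]a k, b k[%classic) s by apply: cov; split => //; exists t.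
    exists k => //; rewrite /F; case: pselect => [h|]; last by case; exists t; split => //; exists s.
    case: (cid h) => t' [Dt' [s' s'k ts']] /=; rewrite /torus_ball/= ts ts'.
    apply: le_lt_trans (cn_cos_sin _ _) _; rewrite ltr_pM2l//.
    move: sk s'k; rewrite /= !in_itv/= => /andP[? ?] /andP[? ?].
    by rewrite ltr_norml; apply/andP; split; lra.
  - move=> k; rewrite /F; case: pselect => [h|_]; last first.
      by rewrite (pvm_set0 HP) rnorm0 expr0n !mulr_ge0// subr_ge0.
    case: (cid h) => t' [Dt' [s' s'k ts']] /=.
    have -> : 16 * Y * (b k - a k) = 8 * Y * (2 * (b k - a k)) by ring.
    move: s'k; rewrite /= in_itv/= => /andP[? ?].
    by apply: arc_mass r0 Y0 hY _ _ _ _ _ _ => //; have := small k; lra.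
  - by move=> n; rewrite -mulr_sumr ler_wpM2l ?sum// mulr_ge0.
apply: rnorm_eq0; apply/eqP; rewrite -sqrf_eq0 eq_le sqr_ge0 andbT.
pose m := Num.min 1 (Num.min (r / 8) 4^-1).
have m0 : 0 < m by rewrite !lt_min ltr01 divr_gt0//= invr_gt0.
apply: (@le_small _ _ 0 (16 * Y * m)); first by rewrite !mulr_ge0// ltW.
move=> e e0 e1; rewrite add0r -[leRHS]mulrA; apply: main; first exact: mulr_gt0.
- apply: le_trans (_ : m * 1 <= _); first by rewrite ler_wpM2l// ltW.
  by rewrite mulr1 /m !ge_min lexx /= orbT.
- apply: le_trans (_ : m * 1 <= _); first by rewrite ler_wpM2l// ltW.
  by rewrite mulr1 /m !ge_min lexx /= !orbT.
Qed.

End AbsoluteContinuity.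

(** * Null sets of arc length in the whole of Theta *)

Section NullSetsGlobal.
Context {R : realType} {H : hilbertType R}.

Lemma pvm_null_cover (E : set (borel_torus R) -> H -> H) (HP : projection_valued_measure E)
    (I : countType) x N (F : I -> set (borel_torus R)) :
  measurable N -> (forall i, measurable (F i)) -> (forall i, E (F i) x = 0) ->
  (forall t, N t -> exists i, F i t) -> E N x = 0.
Proof.
move=> mN mF F0 NF; apply: rnorm_eq0; apply/eqP; rewrite -sqrf_eq0 eq_le sqr_ge0 andbT.
pose G n := if @unpickle I n is Some i then F i else set0.
apply: (pvm_cover HP (F := G) (c := fun=> 0)) => //.
- by move=> n; rewrite /G; case: unpickle.
- by move=> t /NF[i Fi]; exists (pickle i) => //; rewrite /G pickleK.
- by move=> n; rewrite /G; case: unpickle => [i|]; rewrite ?F0 ?(pvm_set0 HP) rnorm0 expr0n.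
- by move=> n; rewrite big1.
Qed.

Variables (A : partial_op H) (W : R -> H -> H) (U T : H -> H).
Variables (E : set (borel_torus R) -> H -> H) (b : R) (p : nat -> R).
Hypotheses (linA : linear_partial_op A) (denseA : dense (dom A)) (WA : unitary_group A W).
Hypotheses (unitaryU : unitary U) (HE : spectral_family U E).
Hypotheses (adT : is_ad A U T) (bT : bnd b T) (b0 : 0 <= b).
Hypotheses (zyg : zygmund W U p) (sp : summable_seq p).

Let HP : projection_valued_measure E := HE.1.

(** The resolvent bound is available for vectors of [dom A], but the vanishing of the projection
    passes to all vectors by density. *)
Lemma strict_at_null (l : torus R) r (N : set (borel_torus R)) x : 0 < r -> strict_at U T E l r ->
  measurable N -> arc_length N = 0%E -> E (N `&` torus_ball (set_val l) (r / 4)) x = 0.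
Proof.
move=> r0 sl mN N0; set D := _ `&` _.
have mD : measurable D by apply: measurableI => //; exact: torus_ball_measurable.
have domD y : dom A y -> E D y = 0.
  move=> /dyadic_interp_dom Dy.
  have [[Y hY] _] := lap linA denseA WA unitaryU HE adT bT b0 zyg sp r0 sl Dy Dy.
  apply: (null_set_mass unitaryU HE (Y := `|Y|)) => // z Zz z1.
  by apply: le_trans (hY z Zz z1) _; exact: ler_norm.
apply: rnorm_eq0; apply/eqP; rewrite eq_le rnorm_ge0 andbT.
apply/ler_addgt0Pl => e e0; rewrite addr0.
have [y Dy xy] := dense_approx denseA x e0.
have -> : E D x = E D (x - y) by rewrite (lopB (pvm_linear HP mD)) (domD y Dy) subr0.
by apply: le_trans (pvm_le HP _ mD) _; rewrite rdistC ltW.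
Qed.

Lemma rational_center (z : R[i]) (e : R) : 0 < e ->
  exists q1 q2 : rat, cn (z - (ratr q1 +i* ratr q2)) < e.
Proof.
move=> e0; case: z => a c.
have [q1] : exists q : rat, ratr q \in `]a - e / 2, a + e / 2[.
  by apply: rat_in_itvoo; lra.
have [q2] : exists q : rat, ratr q \in `]c - e / 2, c + e / 2[.
  by apply: rat_in_itvoo; lra.
rewrite !in_itv/= => /andP[h1 h2] /andP[h3 h4]; exists q1, q2.
have -> : (a +i* c) - (ratr q1 +i* ratr q2) = (a - ratr q1)%:C + 'i%C * (c - ratr q2)%:C.
  by apply/eqP; rewrite eq_complex /=; apply/andP; split; apply/eqP; ring.
apply: le_lt_trans (cnD _ _) _; rewrite cnM cn_i !cnR.
have k1 : `|a - ratr q1| < e / 2 by rewrite ltr_norml; apply/andP; split; lra.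
have k2 : `|c - ratr q2| < e / 2 by rewrite ltr_norml; apply/andP; split; lra.
lra.
Qed.

Variables (Theta : set (torus R)).
Hypothesis openT : open Theta.
Hypothesis finE : finite_set ((set_val @` Theta : set R[i]^o) `&` point_spectrum U).
Hypothesis strictT : forall t, Theta t -> (forall x, U x = (set_val t : R[i]) *: x -> x = 0) ->
  exists2 r, 0 < r & strict_at U T E t r.

(** The radius in [strict_at] depends on the point, so countability comes from rational balls that
    fit in such neighbourhoods; the remaining points are the finitely many eigenvalues, where there
    is no atom. *)
Lemma no_atom_null x (N : set (borel_torus R)) : measurable N -> arc_length N = 0%E ->
  (forall t, Theta t -> E [set t] x = 0) -> E (N `&` Theta) x = 0.
Proof.
move=> mN N0 noatom; have /finite_seqP[s sE] := finE.
have mT : measurable (Theta : set (borel_torus R)) := open_measurable_torus openT.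
pose B (i : rat * rat * nat) : set (borel_torus R) :=
  N `&` torus_ball (ratr i.1.1 +i* ratr i.1.2) i.2.+1%:R^-1.
have mB i : measurable (B i) by apply: measurableI => //; exact: torus_ball_measurable.
pose P k (t : torus R) := Theta t /\ (set_val t : R[i]^o) = s`_k.
(* A rational ball is kept only if its part of [N] has no mass, so the family is null by
   construction and the covering is what remains to prove. Indices beyond the list [s] yield the
   default [0], which is not on the circle. *)
pose F (i : rat * rat * nat + nat) : set (borel_torus R) := match i with
  | inl i => if E (B i) x == 0 then B i else set0
  | inr k => P k
  end.
have PE k t : P k t -> P k = [set t].
  move=> [Tt ts]; apply/seteqP; split => [u [Tu us]|u ->]; last by split.
  by apply: val_inj; exact: etrans us (esym ts).
have Pcase k : P k = set0 \/ exists2 t, Theta t & P k = [set t].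
  have [[t Pt]|h] := pselect (exists t, P k t); [right|left].
    by exists t; [case: Pt | exact: PE].
  by apply/seteqP; split => // t Pt; apply: h; exists t.
apply: (pvm_null_cover HP (F := F)).
- exact: measurableI.
- move=> [i|k] /=; first by case: ifP.
  have [->|[t _ ->]] := Pcase k; [exact: measurable0 | exact: measurable_torus1].
- move=> [i|k] /=; first by case: eqP => // _; rewrite (pvm_set0 HP).
  by have [->|[t Tt ->]] := Pcase k; [rewrite (pvm_set0 HP) | exact: noatom].
move=> t [Nt Tt].
have [ev|nev] := pselect (point_spectrum U (set_val t)).
  have : ((set_val @` Theta : set R[i]^o) `&` point_spectrum U) (set_val t).
    by split => //; exists t.
  rewrite sE /= => /(nthP 0)[k _ ks]; exists (inr k); split => //.
have [|r r0 st] := strictT Tt.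
  by move=> y Uy; apply: contrapT => /eqP y0; apply: nev; exists y.
(* A ball of radius below [r / 8] whose centre is that close to [t] is contained in the ball of
   radius [r / 4] around [t]. *)
have r8 : 0 < r / 8 by rewrite divr_gt0.
have [m hm] := ltr_add_invr r8; rewrite add0r in hm.
have m0 : 0 < (m.+1%:R : R)^-1 by rewrite invr_gt0.
have [q1 [q2 hq]] := rational_center (set_val t) m0.
exists (inl (q1, q2, m)) => /=; rewrite ifT; first by split.
apply/eqP; have -> : B (q1, q2, m) = B (q1, q2, m) `&` (N `&` torus_ball (set_val t) (r / 4)).
  rewrite setIidl// => u [Nu]; rewrite /torus_ball/= => hu; split => //.
  have := cnD (set_val u - (ratr q1 +i* ratr q2)) (- (set_val t - (ratr q1 +i* ratr q2))).
  rewrite cnN opprB addrA subrK => h; apply: le_lt_trans h _; apply: lt_trans (ltrD hu hq) _.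
  by rewrite (_ : r / 4 = r / 8 + r / 8); [exact: ltrD | field].
rewrite (pvm_setI HP)//; last by apply: measurableI => //; exact: torus_ball_measurable.
by rewrite strict_at_null// (lop0 (pvm_linear HP (mB _))).
Qed.

End NullSetsGlobal.

(** * Assembly of the statements on boundary values *)

Section Conclusion.
Context {R : realType} {H : hilbertType R}.
Variables (U T K : H -> H) (E : set (borel_torus R) -> H -> H) (Theta : set (torus R)).
Hypotheses (unitaryU : unitary U) (HE : spectral_family U E) (openT : open Theta).

Let HP : projection_valued_measure E := HE.1.
Let adjU := unitary_adjp unitaryU.
Let bU : bnd 1 U.
Proof. by move=> x; rewrite unitary_iso// mul1r. Qed.
Let bUs : bnd 1 (adj U).
Proof. by apply: adjp_bnd adjU bU. Qed.

Lemma mourre_estimate c :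
  op_le (fun x => c%:C *: E Theta x + K x) (fun x => E Theta (adj U (T (E Theta x)))) ->
  forall x, E Theta x = x -> c * rnorm x ^+ 2 + re x (K x) <= re (U x) (T x).
Proof.
move=> h x Ex; have mT : measurable (Theta : set (borel_torus R)) := open_measurable_torus openT.
have := h x; rewrite Ex innerBr -(pvm_adj HP mT) Ex -(adjpC adjU) innerDr innerZr.
rewrite lecE => /andP[_]; rewrite -re_rnorm /re.
case: (inner (U x) (T x)) => ? ?; case: (inner x (K x)) => ? ?.
case: (inner x x) => ? ? /=; lra.
Qed.

Lemma resolvent_in_holomorphic phi psi : holomorphic_on (@disk R) (resolvent_in U phi psi).
Proof. exact: (resolvent_holomorphic (adjpC adjU) bUs (x := phi) (y := psi)). Qed.

Lemma resolvent_out_antiholomorphic phi psi :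
  antiholomorphic_on (@disk R) (resolvent_out U phi psi).
Proof.
move=> z dz; have d1 := resolvent_in_holomorphic (phi := psi) (psi := phi) dz.
have := derivableB (derivable_cst (conjc (inner phi psi) : R[i]^o) z 1) d1.
apply: near_eq_derivable; move: dz; rewrite /disk/= norm_cn ltcR => z1.
apply/nbhs_cn; exists (1 - cn z); first by rewrite subr_gt0.
move=> w wz; have w1 : cn w < 1 by have := cnD (w - z) z; rewrite subrK; lra.
rewrite -[LHS]/(conjc (inner phi psi) - resolvent_in U psi phi w).
by rewrite resolvent_outE// resolvent_inE// -(rmorphB (@conjc R)).
Qed.

Variables (A : partial_op H) (W : R -> H -> H) (b : R) (p : nat -> R).
Hypotheses (linA : linear_partial_op A) (denseA : dense (dom A)) (WA : unitary_group A W).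
Hypotheses (adT : is_ad A U T) (bT : bnd b T) (b0 : 0 <= b).
Hypotheses (zyg : zygmund W U p) (sp : summable_seq p).
Hypothesis strictT : forall t, Theta t -> (forall x, U x = (set_val t : R[i]) *: x -> x = 0) ->
  exists2 r, 0 < r & strict_at U T E t r.

Let eTheta' : set R[i]^o := (set_val @` Theta : set R[i]^o) `\` point_spectrum U.

Lemma resolvent_boundary_cauchy phi psi q : dyadic_interp A phi -> dyadic_interp A psi ->
  (@disk R `|` eTheta') q ->
  cn q <= 1 /\ disk_cauchy (fun z => inner phi (resolventU U z psi)) (conjc q).
Proof.
move=> Dphi Dpsi [|[[t Tt <-] nev]].
  rewrite /disk/= norm_cn ltcR => q1; split; first exact: ltW.
  by apply: resolvent_disk_cauchy adjU bU _ _ _ _; rewrite cn_conj.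
split; first by rewrite cn_torus.
have [|r r0 st] := strictT Tt.
  by move=> y Uy; apply: contrapT => /eqP y0; apply: nev; exists y.
exact: boundary_uniform_cauchy r0
  (lap linA denseA WA unitaryU HE adT bT b0 zyg sp r0 st Dphi Dpsi).
Qed.

Let disk_cauchy_ext (f g : R[i] -> R[i]) q :
  (forall z, cn z < 1 -> f z = g z) -> disk_cauchy g q -> disk_cauchy f q.
Proof.
by move=> fg h e /h[d d0 hd]; exists d => // w w' w1 w1' *; rewrite !fg//; exact: hd.
Qed.

Lemma resolvent_in_extends phi psi : dyadic_interp A phi -> dyadic_interp A psi ->
  extends_continuously (resolvent_in U phi psi) (@disk R) eTheta'.
Proof.
move=> Dphi Dpsi; apply: disk_cauchy_extends => q Dq.
have [q1 h] := resolvent_boundary_cauchy Dpsi Dphi Dq; split => //.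
apply: disk_cauchy_ext (fun z z1 => resolvent_inE unitaryU phi psi z1) _.
exact: disk_cauchy_conj_val (disk_cauchy_conj h).
Qed.

Lemma resolvent_out_extends phi psi : dyadic_interp A phi -> dyadic_interp A psi ->
  extends_continuously (resolvent_out U phi psi) (@disk R) eTheta'.
Proof.
move=> Dphi Dpsi; apply: disk_cauchy_extends => q Dq.
have [q1 h] := resolvent_boundary_cauchy Dphi Dpsi Dq; split => //.
apply: disk_cauchy_ext (fun z z1 => resolvent_outE unitaryU phi psi z1) _.
exact: disk_cauchy_affine (disk_cauchy_conj h).
Qed.

End Conclusion.

Theorem theorem2p3 (R : realType) (H : hilbertType R)
  (infinite_dimensional : ~ finite_dim [set: H])
  (U : H -> H) (A : partial_op H) (E : set (borel_torus R) -> H -> H)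
  (Theta : set (torus R))
  (unitaryU : unitary U) (self_adjointA : self_adjoint A)
  (spectralE : spectral_family U E)
  (open_Theta : open Theta)
  (propagatingU : propagating A U E Theta)
  (C11U : in_C11 A U) :
  let eTheta : set R[i]^o := set_val @` Theta in
  let eTheta' := eTheta `\` point_spectrum U in
  let calK := interpolation1 A (2^-1) in
  let i := finite_set (eTheta `&` point_spectrum U) /\
    (forall l, (eTheta `&` point_spectrum U) l -> finite_dim (eigen_subspace U l)) in
  let ii := forall psi phi : H, calK psi -> calK phi ->
    [/\ holomorphic_on (@disk R) (resolvent_in U phi psi),
        antiholomorphic_on (@disk R) (resolvent_out U phi psi),
        extends_continuously (resolvent_in U phi psi) (@disk R) eTheta' &
        extends_continuously (resolvent_out U phi psi) (@disk R) eTheta'] in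
  let iii := no_sing_cont_on E Theta in
  [/\ i, ii, iii &
      strictly_propagating A U E Theta -> purely_ac_on E Theta].
Proof.
move=> eTheta eTheta' calK i ii iii.
have [linA denseA _] := self_adjointA.
have [_ [W [WA intU]]] := C11U.
have [_ [T [adT [c [K [c0 cK mourre]]]]]] := propagatingU.
have [b b0 bT] := bounded_op_bnd adT.1.
have [p [sp zyg]] := in_C11_zygmund WA denseA unitaryU adT bT b0 intU.
have {}mourre := mourre_estimate unitaryU spectralE open_Theta mourre.
have no_seq e t := @no_orthonormal_eigenvectors _ _ _ _ _ _ _ _ _ denseA WA unitaryU spectralE
  adT bT b0 zyg sp _ _ _ open_Theta c0 cK mourre e t.
have hi : i by split=> [|l [Tl _]]; 
  [exact: eigenvalues_finite unitaryU no_seq | have := eigenspaces_finite_dim unitaryU no_seq Tl].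
have strictT t := strict_at_noneigenvalue unitaryU spectralE open_Theta c0 cK mourre (t := t).
have null x N := no_atom_null linA denseA WA unitaryU spectralE adT bT b0 zyg sp open_Theta
  hi.1 strictT (x := x) (N := N).
have HP := spectralE.1.
have mT : measurable (Theta : set (borel_torus R)) := open_measurable_torus open_Theta.
split => //.
- move=> psi phi /(interpolation_dyadic linA) Dpsi /(interpolation_dyadic linA) Dphi; split.
  + exact: resolvent_in_holomorphic.
  + exact: resolvent_out_antiholomorphic.
  + exact: (resolvent_in_extends unitaryU spectralE linA denseA WA adT bT b0 zyg sp strictT).
  + exact: (resolvent_out_extends unitaryU spectralE linA denseA WA adT bT b0 zyg sp strictT).
- move=> x [noatom [N [mN N0 xN]]].
  have atom0 t : E [set t] x = 0.
    apply: rnorm_eq0; apply/eqP; rewrite -sqrf_eq0 -(pvm_re HP _ (measurable_torus1 t)).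
    by apply/eqP; have [] := noatom t.
  have mC := measurableC mN.
  have xC : E (~` N) x = 0.
    by apply: rnorm_eq0; apply/eqP; rewrite -sqrf_eq0 -(pvm_re HP _ mC); apply/eqP; case: xN.
  rewrite (pvm_setC HP x mN) (lopD (pvm_linear HP mT)) xC (lop0 (pvm_linear HP mT)) addr0.
  by rewrite -(pvm_setI HP)// setIC null.
- move=> [_ [T' [adT' [c' [c'0 strict']]]]] x N nullN D mD DN.
  have [b' b'0 bT'] := bounded_op_bnd adT'.1.
  have [p' [sp' zyg']] := in_C11_zygmund WA denseA unitaryU adT' bT' b'0 intU.
  have strict0 : op_le (fun y => c'%:C *: E Theta y + 0)
      (fun y => E Theta (adj U (T' (E Theta y)))) by move=> y; rewrite addr0.
  (* An atom would be an eigenvector, for which the virial theorem and the estimate with compact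
     part [0] give [c' * rnorm (E [set t] x) ^+ 2 <= 0]. *)
  have atom0 t : Theta t -> E [set t] x = 0.
    move=> Tt; have Ut := spectral_atom unitaryU spectralE t x.
    have := mourre_estimate unitaryU spectralE open_Theta strict0
      (eigenvector_spectral unitaryU spectralE open_Theta Tt Ut).
    rewrite (virial denseA WA unitaryU adT' bT' b'0 zyg' sp' Ut) /re inner0r addr0.
    rewrite pmulr_rle0// => h; apply: rnorm_eq0; apply/eqP; rewrite -sqrf_eq0 eq_le h sqr_ge0//.
  rewrite /spectral_measure -[complex.Re _]/(re _ _) (pvm_re HP _ mD) -(pvm_setI HP)//.
  by rewrite null// ?(nullN D mD DN)// rnorm0 expr0n.
Qed.
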